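(* The extraction map, sending a generic $(n,d)$-tropical oriented matroid $\mathcal T$ to the collection $\{M_{I,\bar J}\}$ where $M_{I,\bar J}$ is the unique tope of the minor $\mathcal T|_{I,\bar J}$ with position $\mathbf 1_{\bar J}$, is a bijection from generic $(n,d)$-tropical oriented matroids onto $(n,d)$-matching ensembles.
   Context: Fix positive integers $n,d$; $K_{n,d}$ is the complete bipartite graph with left vertices $[n]$ and right vertices $[\bar d]=\{\bar1,\dots,\bar d\}$; graphs are identified with edge sets; $RD$ is the vector of right-vertex degrees; $\mathbf 1_S$ the indicator vector of $S$. Two acyclic subgraphs are compatible if whenever both contain a perfect matching between the same $I\subseteq[n]$, $\bar J\subseteq[\bar d]$, the matchings coincide. An $(n,d)$-type is an $n$-tuple $T=(T_1,\dots,T_n)$ of nonempty subsets of $[\bar d]$, with graph $G(T)$ having edge $(i,\bar j)$ iff $\bar j\in T_i$. A generic $(n,d)$-tropical oriented matroid is a collection $\mathcal T$ of types with acyclic graphs such that: (Boundary) $(\{\bar j\},\dots,\{\bar j\})\in\mathcal T$ for each $\bar j$; (Surrounding) if $T\in\mathcal T$ and $T'$ is a type with $G(T')\subseteq G(T)$ then $T'\in\mathcal T$; (Compatibility) $G(U),G(V)$ are compatible for all $U,V\in\mathcal T$; (Elimination) for $U,V\in\mathcal T$ and $i\in[n]$ there is $W\in\mathcal T$ with $W_i=U_i\cup V_i$ and $W_{i'}\in\{U_{i'},V_{i'}\}$ for $i'\ne i$. A tope is a type whose graph has all left degrees $1$; its position is $RD$ of its graph. For $I\subseteq[n]$, $\bar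 J\subseteq[\bar d]$, the minor $\mathcal T|_{I,\bar J}$ is obtained by deleting the coordinates outside $I$, removing the elements outside $\bar J$ from each remaining coordinate, discarding tuples with an empty coordinate, and removing duplicates; it is known to be a generic $(|I|,|\bar J|)$-tropical oriented matroid on $I,\bar J$ containing exactly one tope of each position, so $M_{I,\bar J}$ (for $|I|=|\bar J|$) is a well-defined perfect matching between $I$ and $\bar J$. An $(n,d)$-matching ensemble is a collection of bijections $M_{I,\bar J}:I\to\bar J$ (viewed as matching graphs), one for each $I\subseteq[n]$, $\bar J\subseteq[\bar d]$ with $|I|=|\bar J|$, such that (Closure) if $I'\subseteq I$, $\bar J'\subseteq\bar J$ and $M_{I,\bar J}$ contains a perfect matching between $I'$ and $\bar J'$ then $M_{I',\bar J'}\subseteq M_{I,\bar J}$; (Left linkage) if $|I|=|\bar J|+1$, the union of $M_{I',\bar J}$ over $I'\subset I$ with $|I'|=|\bar J|$ is a spanning tree on $I\sqcup\bar J$ in which each vertex of $\bar J$ has degree 2; (Right linkage) if $|I|+1=|\bar J|$, the union of $M_{I,\bar J'}$ over $\bar J'\subset\bar J$ with $|\bar J'|=|I|$ is a spanning tree on $I\sqcup\bar J$ in which each vertex of $I$ has degree 2. *)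

(* Defs.v *)
From mathcomp Require Import all_boot.
Set Implicit Arguments. Unset Strict Implicit. Unset Printing Implicit Defensive.

Section TOM.
Variables n d : nat.

Definition graph_t := {set 'I_n * 'I_d}.
Definition tuple_t := {ffun 'I_n -> {set 'I_d}}.

Definition ldeg (G : graph_t) (i : 'I_n) : nat := #|[set j | (i, j) \in G]|.
Definition rdeg (G : graph_t) (j : 'I_d) : nat := #|[set i | (i, j) \in G]|.

Definition has_cycle (G : graph_t) : Prop :=
  exists k : nat, exists (a : 'I_k.+2 -> 'I_n) (b : 'I_k.+2 -> 'I_d),
    injective a /\ injective b /\
    forall t : 'I_k.+2, (a t, b t) \in G /\ (a (ordS t), b t) \in G.

Definition acyclic (G : graph_t) : Prop := ~ has_cycle G.

Definition adj (G : graph_t) : rel ('I_n + 'I_d) :=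
  fun x y => match x, y with
             | inl i, inr j => (i, j) \in G
             | inr j, inl i => (i, j) \in G
             | _, _ => false
             end.

Definition vset (I : {set 'I_n}) (J : {set 'I_d}) : {set 'I_n + 'I_d} :=
  [set x | match x with inl i => i \in I | inr j => j \in J end].

Definition spanning_tree (G : graph_t) (I : {set 'I_n}) (J : {set 'I_d}) : Prop :=
  G \subset setX I J /\ acyclic G /\
  (forall x y, x \in vset I J -> y \in vset I J -> connect (adj G) x y).

Definition is_pm (M : graph_t) (I : {set 'I_n}) (J : {set 'I_d}) : Prop :=
  M \subset setX I J /\ (forall i, i \in I -> ldeg M i = 1) /\
  (forall j, j \in J -> rdeg M j = 1).

Definition contains_pm (G : graph_t) (I : {set 'I_n}) (J : {set 'I_d}) : Prop :=
  exists M : graph_t, M \subset G /\ is_pm M I J.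

Definition compatible (G1 G2 : graph_t) : Prop :=
  forall I J (M1 M2 : graph_t), M1 \subset G1 -> M2 \subset G2 ->
    is_pm M1 I J -> is_pm M2 I J -> M1 = M2.

Definition tgraph (T : tuple_t) : graph_t := [set e | e.2 \in T e.1].

Definition is_type (T : tuple_t) : Prop := forall i, T i != set0.

Definition is_TOM (TT : {set tuple_t}) : Prop :=
  (forall T, T \in TT -> is_type T /\ acyclic (tgraph T)) /\
  (forall j : 'I_d, [ffun _ => [set j]] \in TT) /\
  (forall T T', T \in TT -> is_type T' -> tgraph T' \subset tgraph T -> T' \in TT) /\
  (forall U V, U \in TT -> V \in TT -> compatible (tgraph U) (tgraph V)) /\
  (forall U V (i : 'I_n), U \in TT -> V \in TT ->
     exists W, W \in TT /\ W i = U i :|: V i /\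
       forall i', i' != i -> W i' = U i' \/ W i' = V i').

(* minor T|_{I,J}: its types (tuples indexed by I with entries in J) are
   identified with their graphs G(T) ∩ (I × J); tuples with an empty
   coordinate (i in I of degree 0) are discarded; duplicates disappear. *)
Definition minor (TT : {set tuple_t}) (I : {set 'I_n}) (J : {set 'I_d})
  : {set graph_t} :=
  [set tgraph T :&: setX I J | T in TT &
     [forall i in I, 0 < ldeg (tgraph T :&: setX I J) i]].

Definition is_tope_on (I : {set 'I_n}) (G : graph_t) : bool :=
  [forall i in I, ldeg G i == 1].
Definition has_pos_ones (J : {set 'I_d}) (G : graph_t) : bool :=
  [forall j in J, rdeg G j == 1].

(* Matching ensembles are encoded as finite functions on pairs (I,J); the
   entries with #|I| <> #|J| carry no information and are fixed to set0. *)
Definition ensemble_t := {ffun {set 'I_n} * {set 'I_d} -> graph_t}.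

Definition is_ensemble (M : ensemble_t) : Prop :=
  (forall (I : {set 'I_n}) (J : {set 'I_d}), #|I| != #|J| -> M (I, J) = set0) /\
  (forall (I : {set 'I_n}) (J : {set 'I_d}), #|I| = #|J| -> is_pm (M (I, J)) I J) /\
  (forall (I I' : {set 'I_n}) (J J' : {set 'I_d}), #|I| = #|J| -> I' \subset I -> J' \subset J ->
     contains_pm (M (I, J)) I' J' -> M (I', J') \subset M (I, J)) /\
  (forall (I : {set 'I_n}) (J : {set 'I_d}), #|I| = #|J| + 1 ->
     let U := \bigcup_(I' : {set 'I_n} | (I' \subset I) && (#|I'| == #|J|)) M (I', J) in
     spanning_tree U I J /\ forall j, j \in J -> rdeg U j = 2) /\
  (forall (I : {set 'I_n}) (J : {set 'I_d}), #|I| + 1 = #|J| ->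
     let U := \bigcup_(J' : {set 'I_d} | (J' \subset J) && (#|J'| == #|I|)) M (I, J') in
     spanning_tree U I J /\ forall i, i \in I -> ldeg U i = 2).

Definition extract (TT : {set tuple_t}) : ensemble_t :=
  [ffun p : {set 'I_n} * {set 'I_d} => if #|p.1| == #|p.2| then
               odflt set0 [pick G in minor TT p.1 p.2 |
                             is_tope_on p.1 G && has_pos_ones p.2 G]
             else set0].

End TOM.

(* Main.v *)
Require Import Defs.
From mathcomp Require Import all_boot.
From mathcomp Require Import zify.
Set Implicit Arguments. Unset Strict Implicit. Unset Printing Implicit Defensive.

(* Call a graph good for an ensemble M when all its matchings belong to M. The
   inverse of extraction sends M to the set of all types with good graphs.

   Surjectivity rests on an extension property: if F is good and K, B are nonempty
   sets of left and right vertices such that F has no edge from K to B or from the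
   complement of K to that of B, then some edge from K to B can be added to F. It is proved by induction on the number of vertices, deleting a
   vertex of degree at most one; the base step attaches a new vertex to a
   connected good forest. Elimination follows by extending one of the two types
   until it contains the other on a closed set of rows.

   Conversely the types of a tropical oriented matroid satisfy the same extension
   property, by elimination. Growing a tope along it produces topes of all
   positions and the spanning trees of the linkage axioms, and shows that the
   matroid contains every type compatible with all its members; hence it is
   determined by its matchings. *)

(** * Bipartite graphs and matchings *)

(** The axioms of an ensemble concern one matching, or matchings missing a single vertex, while
    goodness concerns all matchings of a graph at once, and a union of good graphs need not be good.
    Three facts bridge this gap. Good graphs are forests, so a part of one with all degrees at least
    two would have too many edges; this is what supplies leaves to delete. A closed walk alternating
    between two compatible graphs has its edges in both, so a vertex attaches to a connected graph
    in only one place, and choices made in different smaller graphs agree. Acyclicity of the linkage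
    graphs enters only when a largest bad matching misses a vertex: rerouting it in two directions
    gives two matchings of the ensemble that place it in a linkage graph. Left and right play the
    same role, so statements about left vertices are reused on the right by transposition. *)

Section Bipartite.
Variables L R : finType.
Implicit Types (G H N P Q U V : {set L * R}) (A I K : {set L}) (B J : {set R}).

Definition row G (l : L) := [set r | (l, r) \in G].
Definition col G (r : R) := [set l | (l, r) \in G].
Definition dom G := [set p.1 | p in G].
Definition cod G := [set p.2 | p in G].

Definition matching N :=
  [forall p in N, forall q in N, (p.1 == q.1) || (p.2 == q.2) ==> (p == q)].

Lemma in_row G l r : (r \in row G l) = ((l, r) \in G).
Proof. by rewrite inE. Qed.

Lemma in_col G l r : (l \in col G r) = ((l, r) \in G).
Proof. by rewrite inE. Qed.

Lemma mem_dom G l r : (l, r) \in G -> l \in dom G.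
Proof. by move=> h; apply/imsetP; exists (l, r). Qed.

Lemma mem_cod G l r : (l, r) \in G -> r \in cod G.
Proof. by move=> h; apply/imsetP; exists (l, r). Qed.

Lemma domP G l : reflect (exists r, (l, r) \in G) (l \in dom G).
Proof.
apply: (iffP imsetP) => [[[x y] h /= ->]|[r h]]; first by exists y.
by exists (l, r).
Qed.

Lemma codP G r : reflect (exists l, (l, r) \in G) (r \in cod G).
Proof.
apply: (iffP imsetP) => [[[x y] h /= ->]|[l h]]; first by exists x.
by exists (l, r).
Qed.

Lemma matchingP N :
  reflect (forall p q, p \in N -> q \in N -> p.1 = q.1 \/ p.2 = q.2 -> p = q)
          (matching N).
Proof.
apply: (iffP forallP) => [h p q pN qN pq|h p].
  move: (h p); rewrite pN => /forallP /(_ q); rewrite qN /= => /implyP h1.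
  by apply/eqP/h1; case: pq => ->; rewrite eqxx ?orbT.
apply/implyP => pN; apply/forallP => q; apply/implyP => qN; apply/implyP => pq.
by apply/eqP/h => //; case/orP: pq => /eqP; auto.
Qed.

Lemma matching_fun N l r r' :
  matching N -> (l, r) \in N -> (l, r') \in N -> r = r'.
Proof. by move/matchingP => h a b; case: (h _ _ a b (or_introl erefl)). Qed.

Lemma matching_inj N l l' r :
  matching N -> (l, r) \in N -> (l', r) \in N -> l = l'.
Proof. by move/matchingP => h a b; case: (h _ _ a b (or_intror erefl)). Qed.

Lemma matchingI N :
  (forall l r r', (l, r) \in N -> (l, r') \in N -> r = r') ->
  (forall l l' r, (l, r) \in N -> (l', r) \in N -> l = l') -> matching N.
Proof.
move=> h1 h2; apply/matchingP => -[l r] [l' r'] /= a b [e|e].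
  by move: b; rewrite -e => b; rewrite (h1 _ _ _ a b).
by move: b; rewrite -e => b; rewrite (h2 _ _ _ a b).
Qed.

Lemma matching_sub N N' : N' \subset N -> matching N -> matching N'.
Proof.
by move=> /subsetP s /matchingP h; apply/matchingP => p q /s pN /s qN; apply: h.
Qed.

Lemma card_dom N : matching N -> #|dom N| = #|N|.
Proof.
move/matchingP => h; rewrite card_in_imset // => p q pN qN e.
by apply: h => //; left.
Qed.

Lemma card_cod N : matching N -> #|cod N| = #|N|.
Proof.
move/matchingP => h; rewrite card_in_imset // => p q pN qN e.
by apply: h => //; right.
Qed.

Lemma dom_sub N N' : N' \subset N -> dom N' \subset dom N.
Proof. by move=> s; apply: imsetS. Qed.

Lemma cod_sub N N' : N' \subset N -> cod N' \subset cod N.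
Proof. by move=> s; apply: imsetS. Qed.

Lemma domU1 N l r : dom ((l, r) |: N) = l |: dom N.
Proof. by rewrite /dom imsetU1. Qed.

Lemma codU1 N l r : cod ((l, r) |: N) = r |: cod N.
Proof. by rewrite /cod imsetU1. Qed.

Lemma matchingU1 N l r :
  matching N -> l \notin dom N -> r \notin cod N -> matching ((l, r) |: N).
Proof.
move=> mN lN rN; apply: matchingI => [x y y'|x x' y]; rewrite !inE !xpair_eqE.
  case/orP => [/andP[/eqP-> /eqP->]|h]; case/orP => [/andP[/eqP e /eqP e']|h'].
  - by rewrite e'.
  - by rewrite (mem_dom h') in lN.
  - by rewrite e in h; rewrite (mem_dom h) in lN.
  - exact: matching_fun mN h h'.
case/orP => [/andP[/eqP-> /eqP->]|h]; case/orP => [/andP[/eqP e /eqP e']|h'].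
- by rewrite e.
- by rewrite (mem_cod h') in rN.
- by rewrite e' in h; rewrite (mem_cod h) in rN.
- exact: matching_inj mN h h'.
Qed.

Lemma domD1 N l r : matching N -> (l, r) \in N -> dom (N :\ (l, r)) = dom N :\ l.
Proof.
move=> mN h; apply/setP => x; rewrite !inE; apply/domP/andP => [[y]|[xl /domP[y hy]]].
  rewrite !inE => /andP[ne hy]; split; last exact: mem_dom hy.
  apply: contra ne => /eqP e; rewrite e in hy.
  by rewrite e (matching_fun mN hy h).
by exists y; rewrite !inE hy xpair_eqE (negPf xl).
Qed.

Lemma codD1 N l r : matching N -> (l, r) \in N -> cod (N :\ (l, r)) = cod N :\ r.
Proof.
move=> mN h; apply/setP => y; rewrite !inE; apply/codP/andP => [[x]|[yr /codP[x hx]]].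
  rewrite !inE => /andP[ne hx]; split; last exact: mem_cod hx.
  apply: contra ne => /eqP e; rewrite e in hx.
  by rewrite e (matching_inj mN hx h).
by exists x; rewrite !inE hx xpair_eqE (negPf yr) andbF.
Qed.

Lemma matching_sub_eq N N' :
  matching N -> N' \subset N -> dom N \subset dom N' -> N' = N.
Proof.
move=> mN s d; apply/eqP; rewrite eqEcard s -!card_dom //; last exact: matching_sub mN.
exact: subset_leq_card.
Qed.

Lemma matching_sub2 N N1 N2 :
  matching N -> N1 \subset N -> N2 \subset N -> dom N1 \subset dom N2 -> N1 \subset N2.
Proof.
move=> mN /subsetP s1 /subsetP s2 /subsetP d; apply/subsetP => -[l r] h.
have /domP[r' h'] := d _ (mem_dom h).
by rewrite (matching_fun mN (s1 _ h) (s2 _ h')).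
Qed.

Definition pre N B := [set l | [exists r in B, (l, r) \in N]].

Lemma preP N B l : reflect (exists2 r, r \in B & (l, r) \in N) (l \in pre N B).
Proof. by rewrite inE; apply: exists_inP. Qed.

Lemma card_pre N B : matching N -> B \subset cod N -> #|pre N B| = #|B|.
Proof.
move=> mN /subsetP sB; pose N' := [set p in N | p.2 \in B].
have mN' : matching N' by apply: matching_sub mN; apply/subsetP => p; rewrite inE => /andP[].
have -> : pre N B = dom N'.
  apply/setP => l; apply/preP/domP => [[r rB h]|[r]]; first by exists r; rewrite inE h.
  by rewrite inE => /andP[h rB]; exists r.
have eB : cod N' = B.
  apply/setP => r; apply/codP/idP => [[l]|rB]; first by rewrite inE => /andP[].
  by have /codP[l h] := sB _ rB; exists l; rewrite inE h.
by rewrite card_dom // -card_cod // eB.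
Qed.

(** The sets I and J of the usual compatibility are read off the matchings themselves as [dom] and
    [cod]. *)
Definition compat U V := forall N1 N2, N1 \subset U -> N2 \subset V ->
  matching N1 -> matching N2 -> dom N1 = dom N2 -> cod N1 = cod N2 -> N1 = N2.

Lemma compatC U V : compat U V -> compat V U.
Proof. by move=> h N1 N2 *; apply/esym; apply: h. Qed.

Lemma compat_sub U V U' V' : U' \subset U -> V' \subset V -> compat U V -> compat U' V'.
Proof.
move=> sU sV h N1 N2 s1 s2; apply: h; first exact: subset_trans s1 sU.
exact: subset_trans s2 sV.
Qed.

(** One round of an alternating walk, seen from the right vertices only: into a left vertex along
    [U], out of it along [V]. *)
Definition step U V : rel R :=
  fun r r' => [exists l, ((l, r) \in U) && ((l, r') \in V)].

Lemma stepP U V r r' :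
  reflect (exists2 l, (l, r) \in U & (l, r') \in V) (step U V r r').
Proof.
apply: (iffP existsP) => [[l /andP[h h']]|[l h h']]; exists l => //.
by rewrite h h'.
Qed.

Section Walk.
Variables U V : {set L * R}.

(** An alternating walk that keeps its left vertices, so that matchings can be read off it. *)
Fixpoint walk (v : R) (s : seq (L * R)) : bool :=
  if s is (k, j) :: s' then [&& (k, v) \in U, (k, j) \in V & walk j s'] else true.

Lemma walk_cat v s1 s2 :
  walk v (s1 ++ s2) = walk v s1 && walk (last v (unzip2 s1)) s2.
Proof. by elim: s1 v => [|[k j] s1 IH] v //=; rewrite IH !andbA. Qed.

Lemma walk_path v p : path (step U V) v p -> exists2 s, walk v s & unzip2 s = p.
Proof.
elim: p v => [|j p IH] v /=; first by exists [::].
case/andP => /stepP[k h h'] /IH[s w e]; exists ((k, j) :: s) => /=; last by rewrite e.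
by rewrite h h' w.
Qed.

Lemma nth_last_take v (s : seq (L * R)) i :
  i <= size s -> nth v (v :: unzip2 s) i = last v (unzip2 (take i s)).
Proof.
elim: s v i => [|[k j] s IH] v [|i] //= h; rewrite -IH //.
by apply: set_nth_default; rewrite /= size_map.
Qed.

End Walk.

Lemma zip_matching (s : seq L) (t : seq R) :
  uniq s -> uniq t -> size s = size t ->
  let N := [set p in zip s t] in
  [/\ matching N, dom N = [set x in s] & cod N = [set x in t]].
Proof.
elim: s t => [|x s IH] [|y t] //=.
  move=> _ _ _; have -> : [set p : L * R in [::]] = set0 by apply/setP => p; rewrite !inE.
  split; first by apply: matchingI => ? ? ?; rewrite inE.
    by apply/setP => l; rewrite !inE /dom imset0 inE.
  by apply/setP => l; rewrite !inE /cod imset0 inE.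
move=> /andP[xs us] /andP[yt ut] [e]; case: (IH _ us ut e) => mN dN cN.
have -> : [set p in (x, y) :: zip s t] = (x, y) |: [set p in zip s t].
  by apply/setP => p; rewrite !inE.
split; last 2 first.
- by rewrite domU1 dN; apply/setP => l; rewrite !inE.
- by rewrite codU1 cN; apply/setP => l; rewrite !inE.
by apply: matchingU1 => //; rewrite ?dN ?cN inE.
Qed.

(* A shortest closed alternating walk through the edge (l, v) of V visits its
   vertices once, hence consists of two matchings with the same vertices. *)
Lemma alternating_walk U V l j v :
  compat U V -> (l, j) \in U -> (l, v) \in V -> connect (step U V) v j ->
  (l, v) \in U.
Proof.
move=> cUV lj lv /connectP[p /walk_path[s w <-]] ej; move: lj; rewrite ej => {ej p j}.
have [n le] := ubnP (size s); elim: n s le w => // n IH s le w lj.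
(* A right vertex met twice: cut out the loop between the two visits. *)
have [uv|] := boolP (uniq (v :: unzip2 s)); last first.
  move/(uniqPn v) => [a [b [ab]]]; rewrite /= size_map ltnS => lb.
  rewrite !nth_last_take ?(ltnW (leq_trans ab lb)) // => e.
  apply: (IH (take a s ++ drop b s)).
  - by rewrite size_cat size_drop size_takel; lia.
  - have := w; rewrite -{1}(cat_take_drop a s) walk_cat => /andP[wa _].
    rewrite walk_cat wa e /=.
    by have := w; rewrite -{1}(cat_take_drop b s) walk_cat => /andP[].
  - have := lj; rewrite -{1}(cat_take_drop b s) /unzip2 !map_cat !last_cat.
    by rewrite -/unzip2 e.
(* A left vertex met twice: if it is [l], the walk stops on its return there; otherwise the [U]-edge
   of the first visit is followed by the [V]-edge of the second. *)
have [uk|] := boolP (uniq (l :: unzip1 s)); last first.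
  move/(uniqPn l) => [[|a] [[|b] [ab]]] //; rewrite /= size_map ltnS => lb /=.
    move=> e; apply: (IH (take b s)).
    - by rewrite size_take lb; lia.
    - by have := w; rewrite -{1}(cat_take_drop b s) walk_cat => /andP[].
    - have := w; rewrite -{1}(cat_take_drop b s) walk_cat => /andP[_].
      rewrite (drop_nth (l, v)) // [nth (l, v) s b]surjective_pairing /=.
      by rewrite -(nth_map _ l) // -e => /andP[].
  move=> e; apply: (IH (take a s ++ drop b s)).
  - by rewrite size_cat size_drop size_takel; lia.
  - have la : a < size s by lia.
    have := w; rewrite -{1}(cat_take_drop b s) walk_cat => /andP[_].
    have := w; rewrite -{1}(cat_take_drop a s) walk_cat => /andP[wa].
    rewrite walk_cat wa /= (drop_nth (l, v)) // (drop_nth (l, v) lb).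
    rewrite [nth (l, v) s b]surjective_pairing [nth (l, v) s a]surjective_pairing /=.
    by rewrite -!(nth_map _ l) // e => /andP[-> _] /andP[_].
  - have := lj; rewrite -{1}(cat_take_drop b s) /unzip2 !map_cat !last_cat.
    rewrite (drop_nth (l, v)) //=.
have sz1 : size (l :: unzip1 s) = size (v :: unzip2 s) by rewrite /= !size_map.
have sz2 : size (rcons (unzip1 s) l) = size (v :: unzip2 s) by rewrite size_rcons -sz1.
have uk' : uniq (rcons (unzip1 s) l) by rewrite rcons_uniq.
(* Pairing each right vertex with the left vertex before it gives edges of [V], starting with (l,
   v); with the one after it, edges of [U], ending at [l]. *)
have [m1 d1 c1] := zip_matching uk uv sz1.
have [m2 d2 c2] := zip_matching uk' uv sz2.
set N1 := [set _ in _] in m1 d1 c1; set N2 := [set _ in _] in m2 d2 c2.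
have s1 : N1 \subset V.
  apply/subsetP => q; rewrite inE /= zip_unzip inE => /predU1P[->//|].
  elim: s v w {le IH lv lj uv uk sz1 sz2 uk' m1 d1 c1 m2 d2 c2 N1 N2} => [|[k j] s IH] v //=.
  case/and3P => _ h w; rewrite inE => /predU1P[->//|]; exact: IH w.
have s2 : N2 \subset U.
  apply/subsetP => q; rewrite inE /=.
  elim: s v w lj {le IH lv uv uk sz1 sz2 uk' m1 d1 c1 m2 d2 c2 N1 N2 s1} => [|[k j] s IH] v //=.
    by move=> _ h; rewrite inE => /eqP->.
  case/and3P => h _ w lj; rewrite inE => /predU1P[->//|]; exact: IH w lj.
have e : N2 = N1.
  apply: cUV => //; last by rewrite c1 c2.
  by rewrite d1 d2; apply/setP => x; rewrite !inE mem_rcons inE.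
by apply: (subsetP s2); rewrite e inE /= inE eqxx.
Qed.

End Bipartite.

(** * Forests and connectivity *)

Section Transpose.
Variables L R : finType.
Implicit Types (G N : {set L * R}).

Definition tr G : {set R * L} := [set p | (p.2, p.1) \in G].

Lemma in_tr G r l : ((r, l) \in tr G) = ((l, r) \in G).
Proof. by rewrite inE. Qed.

Lemma tr_subset G N : (tr G \subset tr N) = (G \subset N).
Proof.
apply/subsetP/subsetP => s [x y]; first by move=> h; rewrite -in_tr s // in_tr.
by rewrite !in_tr; apply: s.
Qed.

Lemma dom_tr N : dom (tr N) = cod N.
Proof.
by apply/setP => r; apply/domP/codP => -[l]; rewrite ?in_tr => h; exists l; rewrite ?in_tr.
Qed.

Lemma cod_tr N : cod (tr N) = dom N.
Proof.
by apply/setP => r; apply/codP/domP => -[l]; rewrite ?in_tr => h; exists l; rewrite ?in_tr.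
Qed.

Lemma matching_tr N : matching N -> matching (tr N).
Proof.
move=> mN; apply: matchingI => ? ? ?; rewrite !in_tr.
  exact: matching_inj.
exact: matching_fun.
Qed.

Lemma trU1 G l r : tr ((l, r) |: G) = (r, l) |: tr G.
Proof. by apply/setP => -[x y]; rewrite in_tr !inE !xpair_eqE andbC. Qed.

Lemma row_tr G r : row (tr G) r = col G r.
Proof. by apply/setP => l; rewrite !inE. Qed.

End Transpose.

Lemma trK (L R : finType) (G : {set L * R}) : tr (tr G) = G.
Proof. by apply/setP => -[x y]; rewrite !in_tr. Qed.

Lemma card_tr (L R : finType) (G : {set L * R}) : #|tr G| = #|G|.
Proof.
have -> : tr G = [set (p.2, p.1) | p in G].
  apply/setP => -[r l]; rewrite in_tr; apply/idP/imsetP => [h|[[x y] h [-> ->]]] //.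
  by exists (l, r).
by rewrite card_imset // => -[x y] [x' y'] [-> ->].
Qed.

Lemma matching_trE (L R : finType) (N : {set L * R}) : matching (tr N) = matching N.
Proof. by apply/idP/idP => /matching_tr; rewrite ?trK. Qed.

Section Deletion.
Variables L R : finType.
Implicit Types (G : {set L * R}).

Definition del G l := [set p in G | p.1 != l].
Definition delr G r := [set p in G | p.2 != r].

Lemma in_del G l x y : ((x, y) \in del G l) = ((x, y) \in G) && (x != l).
Proof. by rewrite inE. Qed.

Lemma in_delr G r x y : ((x, y) \in delr G r) = ((x, y) \in G) && (y != r).
Proof. by rewrite inE. Qed.

Lemma del_sub G l : del G l \subset G.
Proof. by apply/subsetP => p; rewrite inE => /andP[]. Qed.

Lemma delr_sub G l : delr G l \subset G.
Proof. by apply/subsetP => p; rewrite inE => /andP[]. Qed.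

End Deletion.

Lemma tr_delr (L R : finType) (G : {set L * R}) r : tr (delr G r) = del (tr G) r.
Proof. by apply/setP => -[x y]; rewrite in_tr in_del in_delr in_tr. Qed.

Lemma tr_setX (L R : finType) (I : {set L}) (J : {set R}) : tr (setX I J) = setX J I.
Proof. by apply/setP => -[x y]; rewrite in_tr !in_setX andbC. Qed.

Section Forests.
Variables L R : finType.
Implicit Types (F G H N U V : {set L * R}) (A I K : {set L}) (B J : {set R}).

Lemma withinP G I J :
  reflect (forall l r, (l, r) \in G -> l \in I /\ r \in J) (G \subset setX I J).
Proof.
apply: (iffP subsetP) => h; first by move=> l r /h; rewrite in_setX => /andP[].
by move=> [l r] /h [lI rJ]; rewrite in_setX lI rJ.
Qed.

(** No edge of [G] crosses the cut: [A] and [B] together form a union of components. *)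
Definition resp G A B := forall l r, (l, r) \in G -> (l \in A) = (r \in B).

Lemma resp_sub G H A B : H \subset G -> resp G A B -> resp H A B.
Proof. by move=> /subsetP s h l r /s; apply: h. Qed.

Lemma respC G A B : resp G A B -> resp G (~: A) (~: B).
Proof. by move=> h l r /h e; rewrite !inE e. Qed.

Lemma respI G A B A' B' : resp G A B -> resp G A' B' -> resp G (A :&: A') (B :&: B').
Proof. by move=> h h' l r lr; rewrite !inE (h _ _ lr) (h' _ _ lr). Qed.

(* Every edge is a bridge: the cut (A, B) separates its endpoints and is
   crossed by no other edge. *)
Definition forest G := forall l r, (l, r) \in G ->
  exists A B, [/\ l \in A, r \notin B & resp (G :\ (l, r)) A B].

Lemma forest_sub G H : H \subset G -> forest G -> forest H.
Proof.
move=> s h l r lr; case: (h _ _ (subsetP s _ lr)) => A [B [lA rB rs]].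
by exists A, B; split=> //; apply: resp_sub rs; apply: setSD.
Qed.

Lemma forest_leaf F i c : i \notin dom F -> forest F -> forest ((i, c) |: F).
Proof.
move=> iF h l r; rewrite inE => /orP[/set1P[-> ->]|lr].
  exists [set i], set0; split; rewrite ?inE // => x y.
  rewrite !inE => /andP[/negPf ne]; rewrite ne /= => xy.
  by apply/negbTE; apply: contra iF => /eqP <-; apply: mem_dom xy.
case: (h _ _ lr) => A [B [lA rB rs]].
have li : l != i by apply: contra iF => /eqP <-; apply: mem_dom lr.
(* The new vertex [i] goes to the side of [c], so the added edge does not cross. *)
exists (if c \in B then i |: A else A :\ i), B; split => //.
  by case: ifP; rewrite !inE lA ?orbT ?li.
move=> x y; rewrite !inE => /andP[ne /orP[/eqP[-> ->]|xy]].
  by case: ifP => cB; rewrite !inE eqxx ?cB.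
have xi : x != i by apply: contra iF => /eqP <-; apply: mem_dom xy.
by rewrite -(rs x y) ?inE ?ne //; case: ifP; rewrite !inE (negPf xi).
Qed.

Lemma card_rows G : #|G| = \sum_l #|row G l|.
Proof.
rewrite -sum1_card (eq_bigr (fun l => \sum_(r in row G l) 1)); last first.
  by move=> l _; rewrite sum1_card.
rewrite pair_big_dep /=.
by apply: eq_bigl => -[l r] /=; rewrite inE.
Qed.

Lemma card_rows_ge2 G A :
  (forall l, l \in A -> 1 < #|row G l|) -> 2 * #|A| <= #|G|.
Proof.
move=> h; rewrite card_rows (bigID (mem A)) /=.
apply: leq_trans (leq_addr _ _).
by rewrite mulnC -sum_nat_const; apply: leq_sum => l /h.
Qed.

(** Deleting an edge splits the forest along its cut into two parts with nonempty vertex sets, and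
    the two strict bounds leave room for the deleted edge. With [card_rows_ge2] and [card_cols_ge2]
    this produces vertices of degree at most one. *)
Lemma forest_card G A B : forest G -> G \subset setX A B ->
  (A != set0) || (B != set0) -> #|G| < #|A| + #|B|.
Proof.
have [n le] := ubnP #|G|; elim: n G A B le => // n IH G A B le fG /withinP s ne.
have [->|[[l r] lr]] := set_0Vmem G.
  by rewrite cards0 addn_gt0 !card_gt0.
case: (fG _ _ lr) => A0 [B0 [lA rB rs]].
pose G1 := [set p in G :\ (l, r) | p.1 \in A0].
pose G2 := [set p in G :\ (l, r) | p.1 \notin A0].
have cG : #|G| = (#|G1| + #|G2|).+1.
  rewrite (cardsD1 (l, r)) lr add1n -(cardsID [set p | p.1 \in A0]).
  congr (_ + _).+1; apply: eq_card => p; rewrite !inE //.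
  by rewrite andbC.
have s1 : G1 \subset G by apply/subsetP => p; rewrite !inE => /andP[/andP[]].
have s2 : G2 \subset G by apply/subsetP => p; rewrite !inE => /andP[/andP[]].
have [lA' rB'] := s _ _ lr.
have h1 : #|G1| < #|A :&: A0| + #|B :&: B0|.
  apply: IH; [lia|exact: forest_sub fG| |].
    apply/withinP => x y; rewrite inE /= => /andP[xy xA].
    have [xA' yB] : x \in A /\ y \in B by apply: s; move: xy; rewrite !inE => /andP[].
    by rewrite !inE xA xA' yB -(rs x y).
  by apply/orP; left; apply/set0Pn; exists l; rewrite inE lA lA'.
have h2 : #|G2| < #|A :\: A0| + #|B :\: B0|.
  apply: IH; [lia|exact: forest_sub fG| |].
    apply/withinP => x y; rewrite inE /= => /andP[xy xA].
    have [xA' yB] : x \in A /\ y \in B by apply: s; move: xy; rewrite !inE => /andP[].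
    by rewrite !inE xA xA' yB -(rs x y) // xA.
  by apply/orP; right; apply/set0Pn; exists r; rewrite inE rB rB'.
by have := cardsID A0 A; have := cardsID B0 B; lia.
Qed.

(** Connectivity through cuts instead of paths: adding or deleting a leaf then changes only one set
    of the cut. *)
Definition conn G I J := forall A B, A \subset I -> B \subset J -> resp G A B ->
  (A != set0) || (B != set0) -> A = I /\ B = J.

Lemma conn_del G I J i c : conn G I J -> i \in I -> c \in J -> row G i = [set c] ->
  conn (del G i) (I :\ i) J.
Proof.
move=> cG iI cJ ri A B sA sB rs ne.
have iA : i \notin A by apply/negP => /(subsetP sA); rewrite !inE eqxx.
pose A' := if c \in B then i |: A else A.
have AA' : A = A' :\ i.
  rewrite /A'; apply/setP => x; case: ifP => _; rewrite !inE; case: eqP => [->|//].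
    by rewrite (negPf iA).
  by rewrite (negPf iA).
have iA' : (i \in A') = (c \in B).
  by rewrite /A'; case: ifP; rewrite ?inE ?eqxx // (negPf iA).
have sA' : A' \subset I.
  rewrite /A'; case: ifP => _; last by apply: subset_trans sA (subD1set _ _).
  by rewrite subUset sub1set iI; apply: subset_trans sA (subD1set _ _).
case: (cG A' B sA' sB) => [x y xy||<- ->]; last by [].
  have [e|xi] := eqVneq x i.
    have : y \in row G i by rewrite inE -e.
    by rewrite ri e => /set1P ->.
  rewrite -(rs x y) ?AA' ?inE ?xy ?xi //.
case/orP: ne => [/set0Pn[x xA]|->]; last by rewrite orbT.
by apply/orP; left; apply/set0Pn; exists x; move: xA; rewrite AA' inE => /andP[].
Qed.

Lemma conn_leaf G I J i c : G \subset setX I J -> conn G I J -> i \notin I -> c \in J ->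
  conn ((i, c) |: G) (i |: I) J.
Proof.
move=> /withinP sG cG iI cJ A B sA sB rs ne.
have ic : (i \in A) = (c \in B) by apply: rs; rewrite !inE eqxx.
have [eA eB] : A :\ i = I /\ B = J.
  apply: cG => //.
  - by apply/subsetP => x; rewrite inE => /andP[xi /(subsetP sA)]; rewrite !inE in xi *; rewrite (negPf xi).
  - move=> x y xy; rewrite !inE.
    have e : (x \in A) = (y \in B) by apply: rs; rewrite !inE xy orbT.
    have -> : x != i by apply: contra iI => /eqP <-; case: (sG _ _ xy).
    by rewrite e.
  case/orP: ne => [/set0Pn[x xA]|->]; last by rewrite orbT.
  have [e|xi] := eqVneq x i.
    by apply/orP; right; apply/set0Pn; exists c; rewrite -ic -e.
  by apply/orP; left; apply/set0Pn; exists x; rewrite !inE xi.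
by split=> //; rewrite -eA setD1K // ic eB.
Qed.

Lemma conn_connect G I J r r' : conn G I J -> G \subset setX I J -> r \in J -> r' \in J ->
  connect (step G G) r r'.
Proof.
move=> cG /withinP s rJ rJ'.
pose B := [set x in J | connect (step G G) r x].
pose A := [set l in I | [exists x in B, (l, x) \in G]].
have [_ eB] : A = I /\ B = J.
  apply: cG; rewrite ?/A ?/B ?setIdE ?subsetIl //; last first.
    by apply/orP; right; apply/set0Pn; exists r; rewrite !inE rJ connect0.
  rewrite -!setIdE -/B -/A => x y xy; case: (s _ _ xy) => xI yJ.
  rewrite inE xI /=; apply/exists_inP/idP => [[z]|yB]; last by exists y.
  rewrite !inE yJ => /andP[zJ zr] xz; apply: connect_trans zr (connect1 _).
  by apply/stepP; exists x.
by move: rJ'; rewrite -eB inE => /andP[].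
Qed.

Lemma step_sub2 G U V : G \subset U -> G \subset V ->
  subrel (connect (step G G)) (connect (step U V)).
Proof.
move=> /subsetP s /subsetP s'; apply: connect_sub => x y /stepP[l h h']; apply: connect1.
by apply/stepP; exists l; [apply: s|apply: s'].
Qed.

Lemma conn_row G I J i : conn G I J -> G \subset setX I J -> i \in I -> J != set0 ->
  row G i != set0.
Proof.
move=> cG /withinP s iI /set0Pn[j jJ]; apply/eqP => e.
have [_ eJ] : [set i] = I /\ set0 = J.
  apply: cG; rewrite ?sub0set ?sub1set //; last first.
    by apply/orP; left; apply/set0Pn; exists i; rewrite inE.
  move=> l r lr; rewrite !inE; apply/negbTE/eqP => li; have : r \in row G i by rewrite inE -li.
  by rewrite e inE.
by rewrite -eJ inE in jJ.
Qed.

(** [F] joins [j'] to [j] by a walk common to both graphs; closing it at [a] forces (a, j') into the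
    graph where (a, j) is the only edge at [a]. *)
Lemma attach_unique F I J a j j' :
  compat ((a, j) |: F) ((a, j') |: F) -> a \notin dom F -> conn F I J -> F \subset setX I J ->
  j \in J -> j' \in J -> j = j'.
Proof.
move=> c aF cF sF jJ jJ'.
have : (a, j') \in (a, j) |: F.
  apply: (alternating_walk (j := j) c); rewrite ?inE ?eqxx //.
  by apply: step_sub2 (conn_connect cF sF jJ' jJ); apply: subsetUr.
by rewrite !inE xpair_eqE eqxx => /orP[/eqP->|/mem_dom]; last by rewrite (negPf aF).
Qed.

End Forests.

Lemma conn_tr (L R : finType) (G : {set L * R}) I J : conn G I J -> conn (tr G) J I.
Proof.
move=> cG B A sB sA rs ne; have [] := cG A B sA sB.
- by move=> l r lr; rewrite (rs r l) // in_tr.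
- by rewrite orbC.
by [].
Qed.

Lemma conn_delr (L R : finType) (G : {set L * R}) I J r i :
  conn G I J -> r \in J -> i \in I -> col G r = [set i] -> conn (delr G r) I (J :\ r).
Proof.
move=> /conn_tr cG rJ iI cr; rewrite -[delr G r]trK tr_delr; apply: conn_tr.
by apply: conn_del cG rJ iI _; rewrite row_tr.
Qed.

Lemma forest_tr (L R : finType) (G : {set L * R}) : forest G -> forest (tr G).
Proof.
move=> fG r l; rewrite in_tr => /fG[A [B [lA rB rs]]].
exists (~: B), (~: A); rewrite !inE negbK lA rB; split=> // y x.
rewrite in_setD1 in_tr xpair_eqE => /andP[ne xy]; rewrite !inE (rs x y) //.
by rewrite in_setD1 xy andbT xpair_eqE andbC.
Qed.

Lemma card_cols (L R : finType) (G : {set L * R}) : #|G| = \sum_r #|col G r|.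
Proof. by rewrite -card_tr card_rows; apply: eq_bigr => r _; rewrite row_tr. Qed.

Lemma card_cols_ge2 (L R : finType) (G : {set L * R}) (B : {set R}) :
  (forall r, r \in B -> 1 < #|col G r|) -> 2 * #|B| <= #|G|.
Proof.
by move=> h; rewrite -card_tr; apply: card_rows_ge2 => r /h; rewrite row_tr.
Qed.

(** * Matching ensembles *)

Definition matching_family (L R : finType) := {set L} -> {set R} -> {set L * R}.

Section EnsembleDef.
Variables L R : finType.
Implicit Types (G N : {set L * R}) (I : {set L}) (J : {set R}) (M : matching_family L R).

(** Containment of [N] in the union of the left linkage axiom, stated edge by edge. *)
Definition lcovered M I J N := forall l r, (l, r) \in N ->
  exists I', [/\ I' \subset I, #|I'| = #|J| & (l, r) \in M I' J].

Definition rcovered M I J N := forall l r, (l, r) \in N ->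
  exists J', [/\ J' \subset J, #|J'| = #|I| & (l, r) \in M I J'].

(* Of the linkage axioms only acyclicity is retained, in the form: two
   matchings of the linkage graph on the same vertices coincide. *)
Record ensemble M : Prop := Ensemble {
  ens_matching : forall I J, #|I| = #|J| ->
    [/\ matching (M I J), dom (M I J) = I & cod (M I J) = J];
  ens_closed : forall I J N, #|I| = #|J| -> N \subset M I J -> N = M (dom N) (cod N);
  ens_left : forall I J N N', #|I| = #|J| + 1 -> lcovered M I J N -> lcovered M I J N' ->
    matching N -> matching N' -> dom N = dom N' -> cod N = cod N' -> N = N';
  ens_right : forall I J N N', #|I| + 1 = #|J| -> rcovered M I J N -> rcovered M I J N' ->
    matching N -> matching N' -> dom N = dom N' -> cod N = cod N' -> N = N' }.

Definition good M G :=
  [forall N : {set L * R}, (N \subset G) && matching N ==> (N == M (dom N) (cod N))].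

Lemma goodP M G :
  reflect (forall N, N \subset G -> matching N -> N = M (dom N) (cod N)) (good M G).
Proof.
apply: (iffP forallP) => [h N s m|h N]; last first.
  by apply/implyP => /andP[s m]; apply/eqP/h.
by apply/eqP; move: (h N); rewrite s m.
Qed.

Definition trf M : matching_family R L := fun J I => tr (M I J).

End EnsembleDef.

Section Ensembles.
Variables L R : finType.
Implicit Types (F G H N P U V : {set L * R}) (I K : {set L}) (J B : {set R})
  (M : matching_family L R).

Lemma good_tr M G : good (trf M) (tr G) = good M G.
Proof.
apply/goodP/goodP => h N s m.
  have := h (tr N); rewrite tr_subset matching_trE => /(_ s m).
  by rewrite dom_tr cod_tr => /(can_inj (@trK _ _)).
have := h (tr N); rewrite -tr_subset trK matching_trE => /(_ s m).
by rewrite dom_tr cod_tr /trf => <-; rewrite trK.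
Qed.

Lemma good_sub M G H : G \subset H -> good M H -> good M G.
Proof. by move=> s /goodP h; apply/goodP => N sN; apply: h; apply: subset_trans sN s. Qed.

Lemma good_compat M U V : good M U -> good M V -> compat U V.
Proof.
move=> /goodP gU /goodP gV N1 N2 s1 s2 m1 m2 d c.
by rewrite (gU _ s1 m1) (gV _ s2 m2) d c.
Qed.

(** For an edge (l, r), let [B] be the right vertices reached from [l] once that edge is deleted. If
    [r] belonged to [B], a walk alternating between [G'] and [G] would close at [l] and put (l, r)
    back into [G']. *)
Lemma good_forest M G : good M G -> forest G.
Proof.
move=> gG l r lr; pose G' := G :\ (l, r).
have sG' : G' \subset G by apply: subD1set.
pose B := [set y | [exists x in row G' l, connect (step G' G') x y]].
pose A := l |: [set x | [exists y in B, (x, y) \in G']].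
exists A, B; split.
- by rewrite !inE eqxx.
- apply/negP; rewrite inE => /exists_inP[x]; rewrite in_row => lx xr.
  suff : (l, r) \in G' by rewrite !inE eqxx.
  apply: (alternating_walk (U := G') (V := G) (j := x)) => //.
    exact: compat_sub (good_compat gG gG).
  move: xr.
  have sC : connect_sym (step G' G').
    apply: sym_connect_sym => y z; apply/stepP/stepP => -[k h1 h2]; by exists k.
  rewrite sC; apply: connect_sub => y z /stepP[k h h']; apply: connect1.
  by apply/stepP; exists k => //; apply: (subsetP sG').
move=> x y xy; rewrite !inE; apply/idP/idP => [/orP[/eqP e|/exists_inP[z]]|h].
- apply/exists_inP; exists y; rewrite ?connect0 // in_row -e //.
- rewrite inE => /exists_inP[w wl wz] xz; apply/exists_inP; exists w => //.
  by apply: connect_trans wz (connect1 _); apply/stepP; exists x.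
by apply/orP; right; apply/exists_inP; exists y => //; rewrite inE.
Qed.

(* A matching uses at most one edge at a vertex. *)
Lemma good_addrow M F i j :
  good M F -> good M ((i, j) |: del F i) -> good M ((i, j) |: F).
Proof.
move=> /goodP gF /goodP gF'; apply/goodP => N s m.
have [ij|ij] := boolP ((i, j) \in N); last first.
  apply: gF => //; apply/subsetP => p pN; have := subsetP s _ pN.
  by rewrite !inE => /predU1P[e|//]; rewrite -e pN in ij.
apply: gF' => //; apply/subsetP => -[x y] xy; have := subsetP s _ xy.
rewrite !inE => /predU1P[->|xyF]; rewrite ?eqxx // xyF /=.
have [e|_] := eqVneq x i; last by rewrite orbT.
by rewrite e in xy *; rewrite (matching_fun m xy ij) eqxx.
Qed.

Lemma ensemble_tr M : ensemble M -> ensemble (trf M).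
Proof.
case=> e1 e2 e3 e4; split.
- move=> J I e; rewrite /trf dom_tr cod_tr matching_trE.
  by have [h1 h2 h3] := e1 I J (esym e); split.
- move=> J I N e s; have := e2 I J (tr N) (esym e).
  by rewrite -tr_subset trK dom_tr cod_tr => /(_ s) h; rewrite /trf -h trK.
- move=> J I N N' e c c' m m' d d'; apply: (can_inj (@trK _ _)).
  apply: (e4 I J); rewrite ?matching_trE ?dom_tr ?cod_tr //.
  + move=> l r; rewrite in_tr => /c[J' [s e' h]]; exists J'; split=> //.
    by rewrite -in_tr.
  + move=> l r; rewrite in_tr => /c'[J' [s e' h]]; exists J'; split=> //.
    by rewrite -in_tr.
- move=> J I N N' e c c' m m' d d'; apply: (can_inj (@trK _ _)).
  apply: (e3 I J); rewrite ?matching_trE ?dom_tr ?cod_tr //.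
  + move=> l r; rewrite in_tr => /c[J' [s e' h]]; exists J'; split=> //.
    by rewrite -in_tr.
  + move=> l r; rewrite in_tr => /c'[J' [s e' h]]; exists J'; split=> //.
    by rewrite -in_tr.
Qed.

Section Fixed.
Variables (M : matching_family L R) (eM : ensemble M).

Lemma good_M I J : #|I| = #|J| -> good M (M I J).
Proof. by move=> e; apply/goodP => N s _; apply: ens_closed s. Qed.

Lemma matching_sizes N : matching N -> #|dom N| = #|cod N|.
Proof. by move=> m; rewrite card_dom // card_cod. Qed.

Lemma good1 l r : good M [set (l, r)].
Proof.
apply/goodP => N s m; have [d1 d2 d3] := ens_matching eM (matching_sizes m).
have [e0|[p pN]] := set_0Vmem N.
  apply/eqP; rewrite {1}e0 eq_sym -subset0; apply/subsetP => -[x y] /mem_dom.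
  by rewrite d2 e0 => /domP[z]; rewrite inE.
apply: (matching_sub_eq d1); last by rewrite d2.
have eN : N = [set (l, r)].
  by apply/eqP; rewrite eqEsubset s sub1set -(set1P (subsetP s _ pN)).
have /codP[x xr] : r \in cod (M (dom N) (cod N)).
  by rewrite d3; apply: (@mem_cod _ _ _ l); rewrite eN inE.
have := mem_dom xr; rewrite d2 => /domP[y]; rewrite {1}eN => /set1P[ex _].
by rewrite {1}eN sub1set -ex.
Qed.

(** Since [N1] and [N2] belong to the ensemble, [P] lies in the left linkage graph of [x |: dom P]
    and [cod P]. So does [M (dom P) (cod P)], and acyclicity identifies the two. *)
Lemma two_flips P x N1 N2 mu1 mu2 :
  matching P -> x \notin dom P -> mu1 \in dom P -> mu2 \in dom P ->
  matching N1 -> matching N2 ->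
  dom N1 = x |: dom P :\ mu1 -> dom N2 = x |: dom P :\ mu2 ->
  cod N1 = cod P -> cod N2 = cod P ->
  N1 = M (dom N1) (cod N1) -> N2 = M (dom N2) (cod N2) ->
  P \subset N1 :|: N2 -> P = M (dom P) (cod P).
Proof.
move=> mP xP h1 h2 m1 m2 d1 d2 c1 c2 g1 g2 s.
have eP := matching_sizes mP.
have [mT dT cT] := ens_matching eM eP.
apply: (ens_left eM (I := x |: dom P) (J := cod P)) => //.
- by rewrite cardsU1 xP eP addnC.
- move=> l r /(subsetP s); rewrite inE => /orP[] h.
    exists (dom N1); split; last by rewrite -c1 -g1.
    + by rewrite d1; apply: setUS; apply: subD1set.
    + by rewrite matching_sizes // c1.
  exists (dom N2); split; last by rewrite -c2 -g2.
  + by rewrite d2; apply: setUS; apply: subD1set.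
  + by rewrite matching_sizes // c2.
- by move=> l r h; exists (dom P); split=> //; apply: subsetUr.
Qed.

End Fixed.

Lemma flip_edge P x l r : matching P -> (l, r) \in P -> x \notin dom P ->
  let P0 := (x, r) |: P :\ (l, r) in
  [/\ matching P0, dom P0 = x |: dom P :\ l & cod P0 = cod P].
Proof.
move=> mP lr xP; have d := domD1 mP lr; have c := codD1 mP lr.
have rP := mem_cod lr; split.
- apply: matchingU1; first by apply: matching_sub mP; apply: subD1set.
    by rewrite d in_setD1 (negPf xP) andbF.
  by rewrite c in_setD1 eqxx.
- by rewrite domU1 d.
- by rewrite codU1 c setD1K.
Qed.

(** A chain of displacements: [x] takes [rho], the former partner of [rho] takes the next vertex of
    the path, and so on until [mu], the partner of the last one, is left over. Pairs off the path
    stay. *)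
Lemma flip_path G P x rho p :
  matching P -> P \subset G -> x \notin dom P -> (x, rho) \in G -> rho \in cod P ->
  path [rel r r' | step P G r r' && (r' \in cod P)] rho p -> uniq (rho :: p) ->
  exists mu N, [/\ (mu, last rho p) \in P, N \subset G, matching N,
    dom N = x |: dom P :\ mu /\ cod N = cod P &
    forall l r, (l, r) \in P -> r \notin rho :: p -> (l, r) \in N].
Proof.
elim: p P x rho => [|r p IH] P x rho mP sP xP xr /codP[l lr].
all: pose P0 := (x, rho) |: P :\ (l, rho).
all: have [m0 d0 c0] := flip_edge mP lr xP; rewrite -/P0 in m0 d0 c0.
all: have s0 : P0 \subset G by rewrite subUset sub1set xr; apply: subset_trans sP; apply: subD1set.
  move=> _ _; exists l, P0; split=> // a b ab; rewrite !inE xpair_eqE => brho.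
  by rewrite ab andbT xpair_eqE (negPf brho) !andbF.
rewrite /= => /andP[/andP[/stepP[l' l'r l'G] rcP] pp] /andP[nin up].
have el : l' = l by apply: matching_inj mP l'r lr.
have xl : x != l by apply: contra xP => /eqP->; apply: mem_dom lr.
case: (IH P0 l r) => //.
- by rewrite d0 !inE eqxx /= orbF eq_sym.
- by rewrite -el.
- by rewrite c0.
- apply: sub_in_path pp; last exact: allss.
  move=> a b ain bin /= /andP[/stepP[k ka kb] bP]; rewrite c0 bP andbT.
  apply/stepP; exists k => //; rewrite !inE ka andbT !xpair_eqE.
  have -> : (a == rho) = false by apply: contraNF nin => /eqP <-.
  by rewrite !andbF.
move=> mu [N [h1 h2 h3 [h4 h5] h6]]; exists mu, N.
have lastne : last r p != rho by apply: contraNneq nin => <-; apply: mem_last.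
have h1' : (mu, last r p) \in P.
  by move: h1; rewrite !inE !xpair_eqE (negPf lastne) !andbF.
have mul : mu != l.
  by apply: contraNneq lastne => e; rewrite e in h1'; rewrite (matching_fun mP h1' lr).
have mux : mu != x by apply: contra xP => /eqP <-; apply: mem_dom h1'.
split=> //; last first.
- move=> a b ab; rewrite inE negb_or => /andP[brho bin]; apply: h6 => //.
  by rewrite !inE ab !xpair_eqE (negPf brho) !andbF.
split; last by rewrite h5.
rewrite h4 d0; apply/setP => y; rewrite !inE.
have [->|yl] := eqVneq y l; first by rewrite (mem_dom lr) [l == mu]eq_sym mul orbT.
have [->|yx] := eqVneq y x; first by rewrite [x == mu]eq_sym mux.
by [].
Qed.

End Ensembles.

(** * Extending good graphs by an edge *)

Section Cover.
Variables (L R : finType) (M : matching_family L R) (eM : ensemble M).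
Implicit Types (F G H N P U V : {set L * R}) (I K A : {set L}) (J B : {set R}).

(* From an uncovered vertex x, alternating paths in two different directions
   end at a leaf or can be augmented; either way they give good matchings. *)
Lemma cover_left G P I :
  (forall l, l \in I -> row G l != set0) ->
  (forall l, l \in I -> #|row G l| = 1 -> good M (del G l)) ->
  dom G \subset I -> forest G -> P \subset G -> matching P -> P <> M (dom P) (cod P) ->
  (forall P', P' \subset G -> matching P' -> #|P| < #|P'| -> P' = M (dom P') (cod P')) ->
  I \subset dom P.
Proof.
move=> hdeg hleaf sGI fG sP mP bP maxP; apply/subsetP => x xI; apply/negPn/negP => xP.
have noP G' : good M G' -> P \subset G' -> False.
  by move=> /goodP g s; apply: bP; apply: g.
(* A matching of the size of [P] that can be augmented lies in a larger one, which is not bad by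
   maximality; closure then passes to the smaller one. *)
have aug N mu y : N \subset G -> matching N -> #|N| = #|P| -> (mu, y) \in G ->
    mu \notin dom N -> y \notin cod N -> N = M (dom N) (cod N).
  move=> sN mN cN myG muN yN; have mN' := matchingU1 mN muN yN.
  have e : (mu, y) |: N = M (dom ((mu, y) |: N)) (cod ((mu, y) |: N)).
    apply: maxP => //; first by rewrite subUset sub1set myG.
    rewrite cardsU1 (_ : _ \notin N) ?cN //.
    by apply: contra muN; apply: mem_dom.
  apply: (ens_closed eM (matching_sizes mN')).
  by rewrite -e subsetUr.
have covn r : (x, r) \in G -> r \in cod P.
  move=> xr; apply/negPn/negP => rP; apply: bP; exact: aug xr xP rP.
have degx : 1 < #|row G x|.
  rewrite ltn_neqAle eq_sym card_gt0 hdeg // andbT; apply/negP => /eqP d1.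
  apply: (noP _ (hleaf _ xI d1)); apply/subsetP => -[l r] lr; rewrite in_del (subsetP sP) //=.
  by apply: contra xP => /eqP <-; apply: mem_dom lr.
pose e := [rel r r' | step P G r r' && (r' \in cod P)].
have eP r r' : r \in cod P -> connect e r r' -> r' \in cod P.
  move=> rP /connectP[p pp ->]; elim: p r rP pp => //= r1 p IH r rP /andP[/andP[_ r1P]].
  exact: IH.
(* The displacement started at [r] stops at some [mu] that has degree one or a neighbour outside
   [cod P]. In the first case the new matching avoids the leaf [mu], whose deletion leaves a good
   graph; in the second [aug] applies. *)
have flip r : (x, r) \in G -> exists mu N, [/\ mu \in dom P, matching N,
    dom N = x |: dom P :\ mu /\ cod N = cod P, N = M (dom N) (cod N) &
    forall l r', (l, r') \in P -> ~~ connect e r r' -> (l, r') \in N].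
  move=> xr; have rP := covn _ xr.
  have [/existsP[r1 /andP[rr1 /existsP[mu /andP[mur1 hmu]]]]|nex] :=
    boolP [exists r1, connect e r r1 && [exists mu, ((mu, r1) \in P) &&
      ((#|row G mu| == 1) || [exists y, ((mu, y) \in G) && (y \notin cod P)])]].
    case/connectP: rr1 => p0 pp0 er1; move: mur1; rewrite er1.
    case/shortenP: pp0 => p pp up _ mur1.
    have [mu' [N [h1 h2 h3 [h4 h5] h6]]] := flip_path mP sP xP xr rP pp up.
    have emu := matching_inj mP h1 mur1; rewrite {}emu in h1 h4.
    have muP := mem_dom h1.
    have mux : mu != x by apply: contra xP => /eqP <-.
    have muN : mu \notin dom N by rewrite h4 !inE eqxx andFb orbF.
    exists mu, N; split=> //; last first.
      move=> l r' lr' nc; apply: h6 => //; apply: contra nc => rin.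
      case/splitPl: rin pp => p1 p2 <-; rewrite cat_path => /andP[pp1 _].
      by apply/connectP; exists p1.
    case/orP: hmu => [/eqP d1|/existsP[y /andP[muy yP]]]; last first.
      by apply: aug muy _ _ => //; rewrite -?card_cod // h5.
    have /goodP g := hleaf mu (subsetP sGI _ (mem_dom (subsetP sP _ h1))) d1.
    apply: g => //; apply/subsetP => -[l y] ly; rewrite in_del (subsetP h2) //=.
    by apply: contra muN => /eqP <-; apply: mem_dom ly.
  (* Otherwise the partners [Lam] of the reached set [D] have degree at least two and all their
     edges end in [D]: too many for a forest, as |Lam| = |D|. *)
  exfalso; pose D := [set y | connect e r y].
  have DP : D \subset cod P by apply/subsetP => y; rewrite inE; apply: eP.
  pose Lam := pre P D.
  have LD := card_pre mP DP; rewrite -/Lam in LD.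
  pose G' := [set p in G | p.1 \in Lam].
  have sG' : G' \subset G by apply/subsetP => p; rewrite inE => /andP[].
  have G'LD : G' \subset setX Lam D.
    apply/withinP => l y; rewrite inE /= => /andP[ly lL]; split=> //.
    have /preP[z zD lz] := lL; move: (zD); rewrite !inE => rz.
    have yP : y \in cod P.
      apply/negPn/negP => yP; case/negP: nex; apply/existsP; exists z; rewrite rz.
      apply/existsP; exists l; rewrite lz; apply/orP; right.
      by apply/existsP; exists y; rewrite ly.
    apply: connect_trans rz (connect1 _); rewrite /= yP andbT.
    by apply/stepP; exists l.
  have h2 : 2 * #|Lam| <= #|G'|.
    apply: card_rows_ge2 => l lL; have /preP[z zD lz] := lL; move: (zD); rewrite inE => rz.
    have -> : row G' l = row G l by apply/setP => y; rewrite !in_row inE /= lL andbT.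
    have lz' := subsetP sP _ lz.
    rewrite ltn_neqAle eq_sym card_gt0 hdeg ?(subsetP sGI) ?(mem_dom lz') // andbT.
    apply/negP => d1; case/negP: nex; apply/existsP; exists z; rewrite rz.
    by apply/existsP; exists l; rewrite lz d1.
  have lt : #|G'| < #|Lam| + #|D|.
    apply: forest_card G'LD _; first exact: forest_sub fG.
    by apply/orP; right; apply/set0Pn; exists r; rewrite inE connect0.
  by move: h2 lt; rewrite LD; clear; lia.
have [r1 [r2 [r1x r2x r12]]] : exists r1 r2, [/\ (x, r1) \in G, (x, r2) \in G & r1 != r2].
  have /set0Pn[r1 r1x] : row G x != set0 by apply: hdeg.
  have /set0Pn[r2] : row G x :\ r1 != set0.
    by rewrite -card_gt0; move: degx; rewrite (cardsD1 r1) r1x; lia.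
  by rewrite !inE in r1x * => /andP[ne r2x]; exists r1, r2; rewrite eq_sym.
have [mu1 [N1 [m1 mN1 [d1 c1] g1 h1]]] := flip _ r1x.
have [mu2 [N2 [m2 mN2 [d2 c2] g2 h2]]] := flip _ r2x.
apply: bP; apply: (two_flips eM mP xP m1 m2 mN1 mN2 d1 d2 c1 c2 g1 g2).
apply/subsetP => -[l r] lr; rewrite inE.
have [c1r|nc] := boolP (connect e r1 r); last by rewrite h1.
rewrite (h2 _ _ lr) ?orbT //; apply/negP => c2r.
(* The edge (x, r1) is a bridge and the walks avoid [x], so nothing is reached from both [r1] and
   [r2]: each edge of [P] survives in [N1] or in [N2]. *)
have [A [B [xA r1B rs]]] := fG _ _ r1x.
have cl : closed e (mem B).
  move=> y z /andP[/stepP[k ky kz] _].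
  have kx : k != x by apply: contra xP => /eqP <-; apply: mem_dom ky.
  have h w : (k, w) \in G -> (k \in A) = (w \in B).
    by move=> kw; apply: rs; rewrite !inE kw andbT xpair_eqE (negPf kx).
  by rewrite /= -(h _ kz) -(h y) // (subsetP sP).
have r2B : r2 \in B.
  by rewrite -(rs x r2) // !inE r2x andbT xpair_eqE eqxx /= eq_sym.
move: (closed_connect cl c1r) (closed_connect cl c2r); rewrite /= => <-.
by rewrite r2B (negPf r1B).
Qed.

End Cover.

(** * Comparing a perfect matching with that of the ensemble *)

Section Blocks.
Variables (L R : finType).
Implicit Types (F G H N P T U V : {set L * R}) (I K A : {set L}) (J B : {set R}).

Definition restr N B := [set p in N | p.2 \in B].

Lemma in_restr N B l r : ((l, r) \in restr N B) = ((l, r) \in N) && (r \in B).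
Proof. by rewrite inE. Qed.

Lemma restr_sub N B : restr N B \subset N.
Proof. by apply/subsetP => p; rewrite inE => /andP[]. Qed.

Lemma dom_restr N B : dom (restr N B) = pre N B.
Proof.
apply/setP => l; apply/domP/preP => [[r]|[r rB h]]; last by exists r; rewrite in_restr h.
by rewrite in_restr => /andP[h rB]; exists r.
Qed.

Lemma cod_restr N B : cod (restr N B) = cod N :&: B.
Proof.
apply/setP => r; rewrite inE; apply/codP/andP => [[l]|[/codP[l h] rB]].
  by rewrite in_restr => /andP[h rB]; rewrite (mem_cod h).
by exists l; rewrite in_restr h.
Qed.

Lemma preC N B : matching N -> pre N (~: B) = dom N :\: pre N B.
Proof.
move=> mN; apply/setP => l; rewrite [RHS]inE; apply/preP/andP => [[r]|[lB /domP[r lr]]].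
  rewrite inE => rB lr; split; last exact: mem_dom lr.
  by apply: contra rB => /preP[r' r'B lr']; rewrite (matching_fun mN lr lr').
by exists r => //; rewrite inE; apply: contra lB => rB; apply/preP; exists r.
Qed.

Lemma preU N B B' : pre N (B :|: B') = pre N B :|: pre N B'.
Proof.
apply/setP => l; rewrite [RHS]inE; apply/preP/orP => [[r]|[]/preP[r rB h]].
- by rewrite inE => /orP[] rB h; [left|right]; apply/preP; exists r.
- by exists r; rewrite // inE rB.
- by exists r; rewrite // inE rB orbT.
Qed.

Variables (M : matching_family L R).

(** On [B] and on its complement, [P] and [T] restrict to matchings with the same vertices, all of
    them good; so the restrictions coincide. *)
Lemma block_eq P T B :
  matching P -> matching T -> dom P = dom T -> cod P = cod T -> pre P B = pre T B ->
  good M T -> good M (restr P B) -> good M (restr P (~: B)) -> P = T.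
Proof.
move=> mP mT d c e /goodP gT gB gC.
have key B' : good M (restr P B') -> pre P B' = pre T B' -> restr P B' = restr T B'.
  move=> /goodP g e'; have mR N : matching N -> matching (restr N B').
    by apply: matching_sub; apply: restr_sub.
  rewrite (g _ (subxx _)) ?mR // (gT (restr T B')) ?restr_sub ?mR //.
  by rewrite !dom_restr !cod_restr e' c.
have h1 := key _ gB e.
have h2 : restr P (~: B) = restr T (~: B) by apply: key => //; rewrite !preC // e d.
apply/setP => -[l r]; have := in_restr P B l r; have := in_restr P (~: B) l r.
rewrite h1 h2 !in_restr !inE; case: (r \in B); rewrite ?andbT ?andbF //.
Qed.

(* R1 is the set of right vertices reached from the T-partner of i by steps
   r, l, T(l) along edges (l, r) of G with l <> i, a. *)
Lemma reach_block G P T i a c ti :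
  let R1 := [set y | connect (step (del (del G i) a) T) ti y] in
  let N1 := pre G R1 :\ a in
  matching P -> matching T -> P \subset G -> cod P = cod T -> dom G \subset dom T ->
  row G i = [set c] -> (i, ti) \in T -> c \notin R1 ->
  [/\ pre T R1 = i |: N1, pre P R1 = a |: N1 & i \notin pre G R1].
Proof.
move=> R1 N1 mP mT sP ecod sG ri iti cR1.
have iN : i \notin pre G R1.
  apply/negP => /preP[r rR ir]; have : r \in row G i by rewrite in_row.
  by rewrite ri => /set1P e; rewrite -e rR in cR1.
have R1T : R1 \subset cod T.
  apply/subsetP => y; rewrite inE => /connectP[p pp ->].
  elim: p ti iti pp {R1 N1 cR1 iN} => [|z p IH] t it /=; first by move=> _; apply: mem_cod it.
  case/andP => /stepP[k _ kz] pp; elim: p z k kz pp {IH} => [|w p IH] z k kz /=.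
    by move=> _; apply: mem_cod kz.
  by case/andP => /stepP[k' _ kw]; apply: IH kw.
have cT := card_pre mT R1T.
have cP : #|pre P R1| = #|R1| by apply: card_pre; rewrite ?ecod.
have tiR : ti \in R1 by rewrite inE connect0.
have s1 : i |: N1 \subset pre T R1.
  rewrite subUset sub1set; apply/andP; split; first by apply/preP; exists ti.
  apply/subsetP => l; rewrite in_setD1 => /andP[la lN]; have /preP[r rR lr] := lN.
  have /domP[t lt] := subsetP sG _ (mem_dom lr).
  apply/preP; exists t => //; rewrite inE; move: (rR); rewrite inE => rr.
  apply: connect_trans rr (connect1 _); apply/stepP; exists l => //.
  rewrite !in_del lr la andbT; apply: contraNneq iN => <-.
  by apply/preP; exists r.
have s2 : pre P R1 \subset a |: N1.
  apply/subsetP => l /preP[r rR lr]; rewrite in_setU1 in_setD1; case: (l =P a) => //= _.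
  by apply/preP; exists r => //; apply: (subsetP sP).
have c1 : #|i |: N1| = #|N1|.+1.
  by rewrite cardsU1 in_setD1 (negPf iN) andbF.
have c2 : #|a |: N1| = #|N1|.+1 by rewrite cardsU1 in_setD1 eqxx.
(* Both preimages have the size of [R1], which is squeezed between |N1| + 1 and |N1| + 1, so both
   inclusions are equalities. *)
have l1 := subset_leq_card s1; have l2 := subset_leq_card s2.
by split=> //; apply/eqP; [rewrite eq_sym eqEcard s1 cT -cP c1 -c2|rewrite eqEcard s2 cP -cT c2 -c1].
Qed.

End Blocks.

Section Perfect.
Variables (L R : finType) (M : matching_family L R) (eM : ensemble M).
Implicit Types (F G H N P T U V : {set L * R}) (I K A : {set L}) (J B : {set R}).

(* If P differs from T = M I J, no nontrivial set of right vertices has the same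
   preimage under P and T. Counting then makes the sets reached from the
   T-partners of the leaves i and a first disjoint, then a partition of J, which
   contradicts connectivity of G. *)
Lemma perfect_good G P I J i a c b :
  G \subset setX I J -> conn G I J -> forest G ->
  P \subset G -> matching P -> dom P = I -> cod P = J ->
  i \in I -> a \in I -> i != a -> row G i = [set c] -> row G a = [set b] ->
  (forall l, l \in I -> #|row G l| = 1 -> good M (del G l)) ->
  (forall r, r \in J -> #|col G r| = 1 -> good M (delr G r)) ->
  P = M I J.
Proof.
move=> sG cG fG sP mP dP cP iI aI ia ri ra hleaf hleafr.
have eIJ : #|I| = #|J| by rewrite -dP -cP matching_sizes.
have [mT dT cT] := ens_matching eM eIJ; have gT := good_M eM eIJ.
move: mT dT cT gT; set T := M I J => mT dT cT gT.
have gi : good M (del G i) by apply: hleaf; rewrite ?ri ?cards1.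
have ga : good M (del G a) by apply: hleaf; rewrite ?ra ?cards1.
apply/eqP/negPn/negP => ne.
have block B G1 G2 : pre P B = pre T B -> good M G1 -> good M G2 ->
    restr P B \subset G1 -> restr P (~: B) \subset G2 -> False.
  move=> e g1 g2 s1 s2; case/eqP: ne; apply: (block_eq mP mT) e gT _ _.
  - by rewrite dP dT.
  - by rewrite cP cT.
  - exact: good_sub g1.
  - exact: good_sub g2.
have /domP[ti iti] : i \in dom T by rewrite dT.
have /domP[ta ata] : a \in dom T by rewrite dT.
have icP : (i, c) \in P.
  have /domP[x ix] : i \in dom P by rewrite dP.
  have : x \in row G i by rewrite in_row (subsetP sP).
  by rewrite ri => /set1P <-.
have abP : (a, b) \in P.
  have /domP[x ix] : a \in dom P by rewrite dP.
  have : x \in row G a by rewrite in_row (subsetP sP).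
  by rewrite ra => /set1P <-.
(* A common edge of [P] and [T] is a block with [B] = {r}. *)
have noagree l r : (l, r) \in P -> (l, r) \in T -> good M (del G l) -> False.
  move=> lP lT g; apply: (block [set r] [set (l, r)] _ _ (good1 eM _ _) g).
  - apply/setP => x; apply/preP/preP => -[y /set1P -> h]; exists r; rewrite ?inE //.
      by rewrite (matching_inj mP h lP).
    by rewrite (matching_inj mT h lT).
  - apply/subsetP => -[x y]; rewrite in_restr !inE => /andP[xy /eqP e].
    by rewrite e in xy *; rewrite (matching_inj mP xy lP) eqxx.
  apply/subsetP => -[x y]; rewrite in_restr in_del !inE => /andP[xy yr].
  rewrite (subsetP sP) //=; apply: contra yr => /eqP e.
  by rewrite e in xy; rewrite (matching_fun mP xy lP).
pose Gia := del (del G i) a.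
pose R1 := [set y | connect (step Gia T) ti y].
pose R2 := [set y | connect (step Gia T) ta y].
have sia x : Gia \subset del G x -> subrel (connect (step Gia T)) (connect (step (del G x) T)).
  move=> s; apply: connect_sub => y z /stepP[l h h']; apply: connect1.
  by apply/stepP; exists l => //; apply: (subsetP s).
(* If [c] were reached, the alternating walk through [i] would put (i, ti) into [G], so [ti] = [c]
   and (i, c) would be common to [P] and [T]. *)
have cR1 : c \notin R1.
  apply/negP; rewrite inE => h.
  have : (i, ti) \in del G a.
    apply: (alternating_walk (U := del G a) (V := T) (j := c)) => //.
    - exact: good_compat ga gT.
    - by rewrite in_del (subsetP sP).
    - apply: sia h; apply/subsetP => p; rewrite !inE => /andP[/andP[-> _] ->] //.
  rewrite in_del => /andP[itG _].
  have : ti \in row G i by rewrite in_row.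
  by rewrite ri => /set1P e; rewrite e in iti; apply: noagree iti gi.
have bR2 : b \notin R2.
  apply/negP; rewrite inE => h.
  have : (a, ta) \in del G i.
    apply: (alternating_walk (U := del G i) (V := T) (j := b)) => //.
    - exact: good_compat gi gT.
    - by rewrite in_del (subsetP sP) // eq_sym.
    - apply: sia h; apply/subsetP => p; rewrite !inE => /andP[/andP[-> ->] _] //.
  rewrite in_del => /andP[atG _].
  have : ta \in row G a by rewrite in_row.
  by rewrite ra => /set1P e; rewrite e in ata; apply: noagree ata ga.
have domG : dom G \subset dom T.
  by rewrite dT; apply/subsetP => l /domP[r /(subsetP sG)]; rewrite in_setX => /andP[].
have ecod : cod P = cod T by rewrite cP cT.
have [T1 P1 iN1] := reach_block mP mT sP ecod domG ri iti cR1.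
have eia : Gia = del (del G a) i.
  by apply/setP => p; rewrite !inE -!andbA; congr (_ && _); rewrite andbC.
have := @reach_block _ _ G P T a i b ta mP mT sP ecod domG ra ata; rewrite -eia.
case/(_ bR2) => T2 P2 aN2; rewrite -/R1 -/R2 in T1 P1 iN1 T2 P2 aN2.
set N1 := pre G R1 :\ a in T1 P1; set N2 := pre G R2 :\ i in T2 P2.
have R1J : R1 \subset J.
  apply/subsetP => y; rewrite -cT inE => /connectP[p pp ->].
  elim/last_ind: p pp => [|p z _] ; first by move=> _; apply: mem_cod iti.
  by rewrite rcons_path last_rcons => /andP[_ /stepP[k _ /mem_cod]].
have R2J : R2 \subset J.
  apply/subsetP => y; rewrite -cT inE => /connectP[p pp ->].
  elim/last_ind: p pp => [|p z _] ; first by move=> _; apply: mem_cod ata.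
  by rewrite rcons_path last_rcons => /andP[_ /stepP[k _ /mem_cod]].
(* A common part [S] has the same preimage under [P], [T] and [G]. Counting edges into [S] gives a
   right leaf [w] in [S]; the part of [P] on [S] avoids [i], the rest avoids [w], so [S] is a
   block. *)
have dis r : r \in R1 -> r \in R2 -> False.
  move=> rR1 rR2; pose S := R1 :&: R2; pose N := pre G S.
  have iN : i \notin N.
    apply: contra iN1 => /preP[x]; rewrite inE => /andP[x1 _] h.
    by apply/preP; exists x.
  have aN : a \notin N.
    apply: contra aN2 => /preP[x]; rewrite inE => /andP[_ x1] h.
    by apply/preP; exists x.
  have SJ : S \subset J by apply: subset_trans (subsetIl _ _) R1J.
  have cardT : #|pre T S| = #|S| by apply: card_pre; rewrite ?cT.
  have cardP : #|pre P S| = #|S| by apply: card_pre; rewrite ?cP.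
  have NT : N \subset pre T S.
    apply/subsetP => l lN; have /preP[x xS lx] := lN.
    have /domP[y ly] : l \in dom T by apply: (subsetP domG); apply: mem_dom lx.
    apply/preP; exists y => //.
    have st : step Gia T x y.
      apply/stepP; exists l => //; rewrite !in_del lx /=; apply/andP; split.
        by apply: contraNneq iN => <-.
      by apply: contraNneq aN => <-.
    move: xS; rewrite !inE => /andP[h1 h2].
    by rewrite (connect_trans h1 (connect1 st)) (connect_trans h2 (connect1 st)).
  have PN : pre P S \subset N.
    apply/subsetP => l /preP[x xS lx]; apply/preP; exists x => //; exact: (subsetP sP).
  have eT : N = pre T S.
    by apply/eqP; rewrite eqEcard NT cardT -cardP subset_leq_card.
  have eP : pre P S = N.
    by apply/eqP; rewrite eqEcard PN cardP -cardT subset_leq_card.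
  pose G' := restr G S.
  have lt : #|G'| < #|N| + #|S|.
    apply: forest_card; first exact: forest_sub (restr_sub _ _) fG.
      apply/withinP => x y; rewrite in_restr => /andP[xy yS]; split=> //.
      by apply/preP; exists y.
    by apply/orP; right; apply/set0Pn; exists r; rewrite inE rR1.
  have /exists_inP[w wS w1] : [exists w in S, #|col G w| <= 1].
    apply: contraT => h.
    have : 2 * #|S| <= #|G'|.
      apply: card_cols_ge2 => x xS.
      have -> : col G' x = col G x by apply/setP => y; rewrite !in_col in_restr xS andbT.
      rewrite ltnNge; apply: contra h => hx; apply/exists_inP; by exists x.
    by move: lt; rewrite -eP cardP addnn -mul2n ltnNge => /negPf->.
  have wJ := subsetP SJ _ wS.
  have gw : good M (delr G w).
    apply: hleafr => //; apply/eqP; rewrite eqn_leq w1 card_gt0.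
    have /codP[x xw] : w \in cod P by rewrite cP.
    by apply/set0Pn; exists x; rewrite in_col (subsetP sP).
  apply: (block S _ _ _ gi gw); first by rewrite eP.
    apply/subsetP => -[x y]; rewrite in_restr in_del => /andP[xy yS].
    rewrite (subsetP sP) //=; apply: contraNneq iN => <-; rewrite -eP.
    by apply/preP; exists y.
  apply/subsetP => -[x y]; rewrite in_restr in_delr in_setC => /andP[xy yS].
  by rewrite (subsetP sP) //=; apply: contraNneq yS => ->.
pose B := R1 :|: R2.
have eB : pre P B = pre T B.
  rewrite !preU T1 T2 P1 P2; apply/setP => x; rewrite !in_setU !in_set1.
  by case: (x == i); case: (x == a); rewrite ?orbT //= ?orbF.
have BJ : B \subset J by rewrite subUset R1J.
have cB : #|pre P B| = #|B| by apply: card_pre; rewrite ?cP.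
have iB : i \in pre P B by rewrite preU P2 !in_setU set11 orbT.
(* Rows in [I0] end in [J0], which has the same size. If [I0] is not empty, counting gives a left
   leaf [w] in it, and [B] is a block: its part of [P] avoids [w], the rest avoids [i]. *)
pose I0 := I :\: pre P B; pose J0 := J :\: B.
have c0 : #|I0| = #|J0|.
  rewrite !cardsD eIJ (setIidPr _) ?(setIidPr BJ) ?cB //.
  by apply/subsetP => x /preP[y _ /mem_dom]; rewrite dP.
have rowI0 l r : l \in I0 -> (l, r) \in G -> r \in J0.
  rewrite !in_setD => /andP[lB _] lr.
  have [_ rJ] := withinP _ _ _ sG _ _ lr; rewrite rJ andbT.
  apply: contra lB; rewrite preU P1 P2 inE !in_setU => /orP[] rR.
    have : l \in pre G R1 by apply/preP; exists r.
    by rewrite !in_setD1 !in_set1 => ->; case: (l == a); rewrite ?orbT.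
  have : l \in pre G R2 by apply/preP; exists r.
  by rewrite !in_setD1 !in_set1 => ->; case: (l == i); rewrite ?orbT.
have [I00|] := eqVneq I0 set0; last first.
  move=> I0n; pose G' := [set p in G | p.1 \in I0].
  have lt : #|G'| < #|I0| + #|J0|.
    apply: forest_card; rewrite ?I0n //.
      by apply: forest_sub fG; apply/subsetP => p; rewrite inE => /andP[].
    apply/withinP => x y; rewrite inE => /andP[xy /= xI0]; split=> //.
    exact: rowI0 xy.
  have /exists_inP[w wS w1] : [exists w in I0, #|row G w| <= 1].
    apply: contraT => h.
    have : 2 * #|I0| <= #|G'|.
      apply: card_rows_ge2 => x xS.
      have -> : row G' x = row G x by apply/setP => y; rewrite !in_row inE /= xS andbT.
      rewrite ltnNge; apply: contra h => hx; apply/exists_inP; by exists x.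
    by move: lt; rewrite -c0 addnn -mul2n ltnNge => /negPf->.
  have [wB wI] : w \notin pre P B /\ w \in I by move: wS; rewrite in_setD => /andP.
  have gw : good M (del G w).
    apply: hleaf => //; apply/eqP; rewrite eqn_leq w1 card_gt0.
    have /domP[x xw] : w \in dom P by rewrite dP.
    by apply/set0Pn; exists x; rewrite in_row (subsetP sP).
  apply: (block B _ _ eB gw gi).
    apply/subsetP => -[x y]; rewrite in_restr in_del => /andP[xy yS].
    rewrite (subsetP sP) //=; apply: contraNneq wB => <-.
    by apply/preP; exists y.
  apply/subsetP => -[x y]; rewrite in_restr in_del in_setC => /andP[xy yS].
  rewrite (subsetP sP) //=; apply: contraNneq yS => e; rewrite e in xy.
  by have /preP[z zB iz] := iB; rewrite (matching_fun mP xy iz).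
have J00 r : r \in J -> r \in B.
  move=> rJ; apply/negPn/negP => rB; have : r \in J0 by rewrite in_setD rB.
  have : J0 == set0 by rewrite -cards_eq0 -c0 I00 cards0.
  by move/eqP->; rewrite in_set0.
(* Now [R1] and [R2] partition [J], so no edge of [G] crosses the cut (a |: N1, R1), and
   connectivity would put [i] into [N1]. *)
have [eA _] : a |: N1 = I /\ R1 = J.
  apply: cG => //.
  - by rewrite -P1; apply/subsetP => x /preP[y _ /mem_dom]; rewrite dP.
  - move=> l r lr; have [lI rJ] := withinP _ _ _ sG _ _ lr.
    apply/idP/idP => [|rR1]; last first.
      by rewrite in_setU1 in_setD1; case: (l == a) => //=; apply/preP; exists r.
    have : r \in R1 :|: R2 := J00 _ rJ.
    rewrite in_setU => /orP[//|rR2].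
    rewrite in_setU1 => /orP[/eqP e|lN].
      have : r \in row G a by rewrite in_row -e.
      by rewrite ra => /set1P e'; rewrite e' (negPf bR2) in rR2.
    have lT1 : l \in pre T R1 by rewrite T1 in_setU1 lN orbT.
    have lN2 : l \in pre T R2.
      rewrite T2 in_setU1 in_setD1; apply/orP; right; apply/andP; split.
        apply: contraNneq iN1 => <-; by move: lN; rewrite in_setD1 => /andP[].
      by apply/preP; exists r.
    have /preP[x x1 lx] := lT1; have /preP[y y2 ly] := lN2.
    by case: (dis x x1); rewrite (matching_fun mT lx ly).
  by apply/orP; left; apply/set0Pn; exists a; rewrite in_setU1 eqxx.
move: iI; rewrite -eA in_setU1 (negPf ia) /= in_setD1 (negPf iN1) andbF //.
Qed.

End Perfect.

Definition extends (L R : finType) (M : matching_family L R) (I : {set L}) (J : {set R}) :=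
  forall (F : {set L * R}) (K : {set L}) (B : {set R}),
  good M F -> F \subset setX I J -> K \subset I -> B \subset J -> K != set0 -> B != set0 ->
  (forall l r, (l, r) \in F -> (l \in K) = (r \notin B)) ->
  exists k b, [/\ k \in K, b \in B & good M ((k, b) |: F)].

Lemma extends_tr (L R : finType) (M : matching_family L R) I J :
  extends M I J -> extends (trf M) J I.
Proof.
move=> h F K B gF sF sK sB K0 B0 sep.
case: (h (tr F) B K) => //.
- by rewrite -good_tr trK.
- by rewrite -[setX I J]trK tr_subset tr_setX.
- by move=> l r; rewrite in_tr => /sep ->; rewrite negbK.
move=> k [b [kB bK g]]; exists b, k; split=> //.
by rewrite -[F]trK -trU1 good_tr.
Qed.

Lemma cardsD1_lt (T : finType) (A : {set T}) x : x \in A -> #|A :\ x| < #|A|.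
Proof. by move=> xA; rewrite [ltnRHS](cardsD1 x) xA. Qed.

(** * Attaching leaves to a connected good forest *)

Section Attach.
Variables (L R : finType) (M : matching_family L R) (eM : ensemble M).
Implicit Types (F G H N P T U V : {set L * R}) (I K A : {set L}) (J B : {set R}).

(** Take a largest good graph above [F]. A nontrivial cut (A, B) of it separates [A] from [J :\: B]
    or [I :\: A] from [B], and extension would add an edge. *)
Lemma extends_conn I J F : extends M I J -> I != set0 -> J != set0 ->
  good M F -> F \subset setX I J ->
  exists F', [/\ F \subset F', good M F', F' \subset setX I J & conn F' I J].
Proof.
move=> ext I0 J0 gF sF.
pose pr (X : {set L * R}) := [&& F \subset X, good M X & X \subset setX I J].
have prF : pr F by rewrite /pr subxx gF.
case: (arg_maxnP (fun X : {set L * R} => #|X|) prF) => X /and3P[FX gX sX] maxX.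
exists X; split=> // A B sA sB rs ne.
have sep l r : (l, r) \in X -> (l \in A) = (r \in B) by apply: rs.
have noext K B' : K \subset I -> B' \subset J -> K != set0 -> B' != set0 ->
    (forall l r, (l, r) \in X -> (l \in K) = (r \notin B')) -> False.
  move=> sK sB' K0 B0 sp; have [k [b [kK bB g]]] := ext X K B' gX sX sK sB' K0 B0 sp.
  have kb : (k, b) \notin X by apply/negP => /sp; rewrite kK bB.
  have := maxX ((k, b) |: X); rewrite cardsU1 kb /= add1n ltnn => hX; suff: false by []; apply: hX.
  rewrite /pr g subUset sub1set in_setX (subsetP sK) // (subsetP sB') // sX /= andbT.
  by apply: subset_trans FX _; apply: subsetUr.
have [A0|A0] := eqVneq A set0.
  have B0 : B != set0 by move: ne; rewrite A0 eqxx.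
  case: (noext I B) => // l r lr; rewrite -(sep _ _ lr) A0 inE.
  by have [-> _] := withinP _ _ _ sX _ _ lr.
have [BJ|BJ] := eqVneq (J :\: B) set0.
  have eB : B = J by apply/eqP; rewrite eqEsubset sB -setD_eq0 BJ eqxx.
  have [AI|AI] := eqVneq (I :\: A) set0.
    by split=> //; apply/eqP; rewrite eqEsubset sA -setD_eq0 AI eqxx.
  case: (noext (I :\: A) B) => //; first exact: subsetDl.
    by rewrite eB.
  move=> l r lr; rewrite inE -(sep _ _ lr).
  by have [-> _] := withinP _ _ _ sX _ _ lr; rewrite andbT.
case: (noext A (J :\: B)) => //; first exact: subsetDl.
move=> l r lr; rewrite inE (sep _ _ lr).
by have [_ ->] := withinP _ _ _ sX _ _ lr; rewrite andbT negbK.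
Qed.

Lemma extends_attach I J F a : extends M I J -> a \in I -> J != set0 ->
  good M F -> F \subset setX (I :\ a) J -> exists2 j, j \in J & good M ((a, j) |: F).
Proof.
move=> ext aI J0 gF sF.
case: (ext F [set a] J) => //.
- by apply: subset_trans sF _; apply: setXS => //; apply: subD1set.
- by rewrite sub1set.
- by apply/set0Pn; exists a; rewrite inE.
- move=> l r lr; have [lI rJ] := withinP _ _ _ sF _ _ lr.
  by move: lI; rewrite !inE rJ => /andP[/negPf->].
by move=> k [b [/set1P -> bJ g]]; exists b.
Qed.

Lemma good_attach_unique F I J a j j' :
  good M ((a, j) |: F) -> good M ((a, j') |: F) -> a \notin I -> conn F I J ->
  F \subset setX I J -> j \in J -> j' \in J -> j = j'.
Proof.
move=> g g' aI cF sF jJ jJ'; apply: (attach_unique (good_compat g g') _ cF sF) => //.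
by apply: contra aI => /domP[r /(withinP _ _ _ sF)[]].
Qed.

Lemma col_row_sub G H l : G \subset H -> row G l \subset row H l.
Proof. by move=> s; apply/subsetP => r; rewrite !in_row; apply: subsetP. Qed.

(* Here i and a are two leaves attached to H. A largest bad matching would be
   perfect by cover_left on both sides, which perfect_good excludes. *)
Lemma two_leaves I0 J H i a c b (I := i |: (a |: I0)) :
  (forall I' J', I' \subset I -> J' \subset J -> #|I'| + #|J'| < #|I| + #|J| ->
    extends M I' J') ->
  H \subset setX I0 J -> conn H I0 J -> i != a -> i \notin I0 -> a \notin I0 ->
  c \in J -> b \in J -> good M ((i, c) |: H) -> good M ((a, b) |: H) ->
  good M ((i, c) |: ((a, b) |: H)).
Proof.
move=> IH sH cH ia iI0 aI0 cJ bJ gi ga.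
have sHP := withinP _ _ _ sH.
set G := (i, c) |: _.
have delGi : del G i \subset (a, b) |: H.
  apply/subsetP => -[x y]; rewrite in_del !inE !xpair_eqE => /andP[h xi].
  by move: h; rewrite (negPf xi).
have delGa : del G a \subset (i, c) |: H.
  apply/subsetP => -[x y]; rewrite in_del !inE !xpair_eqE => /andP[h xi].
  by move: h; rewrite (negPf xi).
(* With both leaves on one right vertex, no matching uses both leaf edges. *)
have [ecb|cb] := eqVneq c b.
  apply/goodP => N sN mN.
  have [iN|iN] := boolP (i \in dom N); last first.
    move/goodP: ga; apply=> //; apply: subset_trans _ delGi; apply/subsetP => -[x y] xy.
    by rewrite in_del (subsetP sN) //=; apply: contraNneq iN => <-; apply: mem_dom xy.
  have [aN|aN] := boolP (a \in dom N); last first.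
    move/goodP: gi; apply=> //; apply: subset_trans _ delGa; apply/subsetP => -[x y] xy.
    by rewrite in_del (subsetP sN) //=; apply: contraNneq aN => <-; apply: mem_dom xy.
  case/domP: iN => x ix; case/domP: aN => y ay; case/negP: (ia).
  have noi z : (i, z) \notin H by apply: contra iI0 => /sHP[].
  have noa z : (a, z) \notin H by apply: contra aI0 => /sHP[].
  have ex : x = c.
    have := subsetP sN _ ix; rewrite !inE !xpair_eqE (negPf ia) (negPf (noi _)) eqxx /=.
    by rewrite orbF => /eqP.
  have ey : y = b.
    have := subsetP sN _ ay; rewrite !inE !xpair_eqE eq_sym (negPf ia) (negPf (noa _)) eqxx /=.
    by rewrite orbF => /eqP.
  by apply/eqP; apply: matching_inj mN ix _; rewrite ex ecb -ey.
have I00 : I0 != set0.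
  apply: contraNneq cb => e; have [_ eJ] : set0 = I0 /\ [set b] = J.
    apply: cH; rewrite ?sub0set ?sub1set //; first by move=> l r /sHP[lI]; rewrite e inE in lI.
    by apply/orP; right; apply/set0Pn; exists b; rewrite inE.
  by move: cJ; rewrite -eJ inE.
have J0 : J != set0 by apply/set0Pn; exists c.
have iI : i \in I by rewrite !inE eqxx.
have aI : a \in I by rewrite !inE eqxx orbT.
have I0I : I0 \subset I by rewrite /I setUA; apply: subsetUr.
have sG : G \subset setX I J.
  apply/withinP => x y; rewrite inE => /orP[/set1P[-> ->]//|].
  by rewrite inE => /orP[/set1P[-> ->]//|/sHP[/(subsetP I0I)]].
have cardI : #|I| = #|I0|.+2.
  by rewrite /I !cardsU1 !inE (negPf ia) (negPf iI0) aI0.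
have rowG l : l \in I0 -> row G l = row H l.
  move=> lI; apply/setP => y; rewrite !in_row !inE !xpair_eqE.
  have -> : (l == i) = false by apply: contraNF iI0 => /eqP <-.
  by have -> : (l == a) = false by apply: contraNF aI0 => /eqP <-.
have rowi : row G i = [set c].
  apply/setP => y; rewrite in_row !inE !xpair_eqE eqxx (negPf ia) /=.
  by rewrite (_ : _ \in H = false) ?orbF //; apply: contraNF iI0 => /sHP[].
have rowa : row G a = [set b].
  apply/setP => y; rewrite in_row !inE !xpair_eqE eqxx eq_sym (negPf ia) /=.
  by rewrite (_ : _ \in H = false) ?orbF //; apply: contraNF aI0 => /sHP[].
have fG : forest G.
  have fH : forest H by apply: good_forest (good_sub (subsetUr _ _) gi).
  apply: forest_leaf; last first.
    apply: forest_leaf => //; by apply: contra aI0 => /domP[y /sHP[]].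
  by rewrite domU1 !inE negb_or ia /=; apply: contra iI0 => /domP[y /sHP[]].
have cG : conn G I J.
  apply: conn_leaf => //.
  - apply/withinP => x y; rewrite inE => /orP[/set1P[-> ->]|/sHP[xI yJ]].
      by rewrite !inE eqxx.
    by rewrite !inE xI orbT.
  - exact: conn_leaf.
  - by rewrite !inE negb_or ia.
have hleaf l : l \in I -> #|row G l| = 1 -> good M (del G l).
  rewrite /I !inE => /or3P[/eqP->|/eqP->|lI] d1.
  - exact: good_sub ga.
  - exact: good_sub gi.
  have /cards1P[c' rl] : #|row H l| == 1 by rewrite -rowG // d1.
  have c'J : c' \in J.
    have : c' \in row H l by rewrite rl inE.
    by rewrite in_row => /sHP[].
  have cl := conn_del cH lI c'J rl.
  have sl : del H l \subset setX (I0 :\ l) J.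
    by apply/withinP => x y; rewrite in_del !inE => /andP[/sHP[-> ->] ->].
  have lI' : l \in I by apply: (subsetP I0I).
  have al : a != l by apply: contraNneq aI0 => ->.
  have il : i != l by apply: contraNneq iI0 => ->.
  have ext : extends M (I :\ l) J.
    apply: IH => //; first exact: subD1set.
    by rewrite ltn_add2r cardsD1_lt.
  (* Without [l], the vertex [a] attaches at some [b']; as [del H l] is still connected, uniqueness
     of the attachment gives [b'] = [b]. *)
  have [b' b'J g'] : exists2 b', b' \in J & good M ((a, b') |: ((i, c) |: del H l)).
    apply: (extends_attach ext) => //; first by rewrite !inE al eqxx orbT.
      by apply: good_sub gi; apply: setUS; apply: del_sub.
    apply/withinP => x y; rewrite inE => /orP[/set1P[-> ->]|].
      by rewrite !inE eqxx ia il.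
    rewrite in_del => /andP[/sHP[xI yJ] xl]; rewrite !inE xI xl !orbT yJ !andbT.
    by split=> //; apply: contraNneq aI0 => <-.
  have eb : b = b'.
    apply: (good_attach_unique _ _ _ cl sl) => //; first 1 last.
    - by apply: good_sub g'; apply: setUS; apply: subsetUr.
    - by rewrite !inE (negPf aI0) andbF.
    - by apply: good_sub ga; apply: setUS; apply: del_sub.
  rewrite -eb in g'; apply: good_sub g'; apply/subsetP => -[x y]; rewrite in_del !inE.
  by case/andP => h xl; move: h; rewrite /= xl andbT orbCA.
have colH r : r \in J -> col H r != set0.
  move=> rJ; rewrite -row_tr; apply: conn_row (conn_tr cH) _ rJ I00.
  by rewrite -tr_setX tr_subset.
have colG r : col H r \subset col G r.
  by apply/subsetP => x; rewrite !in_col !inE => ->; rewrite !orbT.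
have hleafr r : r \in J -> #|col G r| = 1 -> good M (delr G r).
  move=> rJ d1; have /set0Pn[k kr] := colH _ rJ.
  have /cards1P[k' ek] : #|col G r| == 1 by rewrite d1.
  have ekk : k' = k by have := subsetP (colG r) _ kr; rewrite ek inE => /eqP.
  have kI : k \in I0 by move: kr; rewrite in_col => /sHP[].
  have rc : r != c.
    apply: contraNneq iI0 => e; have : i \in col G r by rewrite in_col !inE e eqxx.
    by rewrite ek ekk => /set1P ->.
  have rb : r != b.
    apply: contraNneq aI0 => e; have : a \in col G r by rewrite in_col !inE e eqxx orbT.
    by rewrite ek ekk => /set1P ->.
  have colr : col H r = [set k].
    apply/eqP; rewrite eqEsubset sub1set kr andbT; apply: subset_trans (colG r) _.
    by rewrite ek ekk.
  have cl := conn_delr cH rJ kI colr.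
  have sl : delr H r \subset setX I0 (J :\ r).
    by apply/withinP => x y; rewrite in_delr !inE => /andP[/sHP[-> ->] ->].
  have ext : extends M I (J :\ r).
    apply: IH => //; first exact: subD1set.
    by rewrite ltn_add2l cardsD1_lt.
  have bJ' : b \in J :\ r by rewrite !inE eq_sym rb.
  have [b' b'J g'] : exists2 b', b' \in J :\ r & good M ((a, b') |: ((i, c) |: delr H r)).
    apply: (extends_attach ext) => //; first by apply/set0Pn; exists b.
      by apply: good_sub gi; apply: setUS; apply: delr_sub.
    apply/withinP => x y; rewrite inE => /orP[/set1P[-> ->]|].
      by rewrite !inE eqxx ia [c == r]eq_sym rc.
    rewrite in_delr => /andP[/sHP[xI yJ] xl]; rewrite !inE xI xl !orbT yJ !andbT.
    by split=> //; apply: contraNneq aI0 => <-.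
  have eb : b = b'.
    apply: (good_attach_unique _ _ aI0 cl sl) => //; first 1 last.
    - by apply: good_sub g'; apply: setUS; apply: subsetUr.
    - by apply: good_sub ga; apply: setUS; apply: delr_sub.
  rewrite -eb in g'; apply: good_sub g'; apply/subsetP => -[x y]; rewrite in_delr !inE.
  by case/andP => h xl; move: h; rewrite /= xl andbT orbCA.
have [//|bG] := boolP (good M G).
pose bad (P : {set L * R}) := [&& P \subset G, matching P & P != M (dom P) (cod P)].
have [P0 bP0] : exists P0, bad P0.
  case/forallPn: bG => P0; rewrite negb_imply => /andP[/andP[h1 h2] h3].
  by exists P0; rewrite /bad h1 h2.
case: (arg_maxnP (fun X : {set L * R} => #|X|) bP0) => P /and3P[sP mP /eqP bP] maxP.
have maxP' P' : P' \subset G -> matching P' -> #|P| < #|P'| -> P' = M (dom P') (cod P').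
  move=> s m lt; apply/eqP; apply: contraTT lt => b'; rewrite -leqNgt; apply: maxP.
  by rewrite /bad s m.
have domG : dom G \subset I by apply/subsetP => x /domP[y /(withinP _ _ _ sG)[]].
have codG : cod G \subset J by apply/subsetP => x /codP[y /(withinP _ _ _ sG)[]].
have dP : dom P = I.
  apply/eqP; rewrite eqEsubset; apply/andP; split.
    by apply: subset_trans domG; apply: dom_sub.
  apply: (cover_left eM _ hleaf domG fG sP mP bP maxP') => l lI.
  move: lI; rewrite /I !inE => /or3P[/eqP->|/eqP->|lI].
  - by rewrite rowi; apply/set0Pn; exists c; rewrite inE.
  - by rewrite rowa; apply/set0Pn; exists b; rewrite inE.
  by rewrite rowG //; apply: conn_row cH sH lI J0.
have cP : cod P = J.
  apply/eqP; rewrite eqEsubset; apply/andP; split.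
    by apply: subset_trans codG; apply: cod_sub.
  rewrite -dom_tr; apply: (cover_left (ensemble_tr eM) (G := tr G)).
  - move=> r rJ; rewrite row_tr; apply: contraNneq (colH r rJ) => e.
    by rewrite -subset0 -e.
  - by move=> r rJ; rewrite row_tr -tr_delr good_tr; apply: hleafr.
  - by rewrite dom_tr.
  - exact: forest_tr.
  - by rewrite tr_subset.
  - exact: matching_tr.
  - by rewrite dom_tr cod_tr /trf => /(can_inj (@trK _ _)).
  move=> P' s m; rewrite card_tr -[#|P'|]card_tr => lt.
  apply: (can_inj (@trK _ _)); rewrite {1}(maxP' (tr P')) //.
  - by rewrite dom_tr cod_tr /trf trK.
  - by rewrite -tr_subset trK.
  - exact: matching_tr.
case: bP; rewrite dP cP.
exact: (perfect_good eM sG cG fG sP mP dP cP iI aI ia rowi rowa hleaf hleafr).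
Qed.

End Attach.

Lemma good_addcol (L R : finType) (M : matching_family L R) (F : {set L * R}) a w :
  good M F -> good M ((a, w) |: delr F w) -> good M ((a, w) |: F).
Proof.
move=> gF gF'; rewrite -good_tr trU1; apply: good_addrow; rewrite ?good_tr //.
by rewrite -tr_delr -trU1 good_tr.
Qed.

(* The separation K = {a}, B = J: a new left vertex can be attached somewhere. *)
Section Star.
Variables (L R : finType) (M : matching_family L R) (eM : ensemble M).
Implicit Types (F G H N P T U V : {set L * R}) (I K A : {set L}) (J B : {set R}).

Variables (I : {set L}) (J : {set R}) (a : L).
Hypothesis IH : forall I' J', I' \subset I -> J' \subset J ->
  #|I'| + #|J'| < #|I| + #|J| -> extends M I' J'.
Hypotheses (aI : a \in I) (J0 : J != set0).

Section Connected.
Variable F : {set L * R}.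
Hypotheses (gF : good M F) (sF : F \subset setX (I :\ a) J) (cF : conn F (I :\ a) J).

Let sFP := withinP _ _ _ sF.

(** Without the leaf [i], [a] attaches at some [b] by induction; [two_leaves] puts [i] back. *)
Lemma star_left_leaf i : i \in I :\ a -> #|row F i| = 1 ->
  exists2 j, j \in J & good M ((a, j) |: F).
Proof.
move=> iI /eqP/cards1P[c ri].
have ia : i != a by move: iI; rewrite !inE => /andP[].
have iI' : i \in I by move: iI; rewrite !inE => /andP[].
have ic : (i, c) \in F by rewrite -in_row ri inE.
have [_ cJ] := sFP ic.
have cH := conn_del cF iI cJ ri; pose H := del F i.
have sH : H \subset setX (I :\ a :\ i) J.
  by apply/withinP => x y; rewrite in_del in_setD1 => /andP[/sFP[-> ->] ->].
have ext : extends M (I :\ i) J.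
  by apply: IH => //; [apply: subD1set | rewrite ltn_add2r cardsD1_lt].
have [b bJ gb] : exists2 b, b \in J & good M ((a, b) |: H).
  apply: (extends_attach ext) => //.
  - by rewrite !inE eq_sym ia.
  - exact: good_sub (del_sub _ _) gF.
  - by rewrite setDDl setUC -setDDl.
exists b => //.
have eF : F = (i, c) |: H.
  apply/setP => -[x y]; rewrite in_setU1 in_del xpair_eqE.
  have [->|xi] := eqVneq x i; last by rewrite andbT.
  by rewrite andbF orbF -in_row ri inE.
have eI : i |: (a |: (I :\ a :\ i)) = I.
  by rewrite setUCA setD1K // setD1K.
rewrite eF setUCA; apply: (two_leaves eM) sH cH _ _ _ _ _ _ gb => //.
- by rewrite eI.
- by rewrite !inE eqxx.
- by rewrite !inE eqxx !andbF.
- by rewrite -eF.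
Qed.

(** Remove both leaves and keep (a, j). Then [w'] goes back at [l'], [w] attaches at some [l1] by
    induction, and the transposed [two_leaves] allows both. If [l1] = [a], then [a] attaches to [F]
    at [w]; otherwise uniqueness over [delr F w] gives [l1] = [l], and [j] works. *)
Lemma star_right_leaves w w' j : w \in J -> w' \in J -> w != w' ->
  #|col F w| = 1 -> #|col F w'| = 1 -> j \in J -> j != w -> j != w' ->
  good M ((a, j) |: delr F w) -> exists2 j, j \in J & good M ((a, j) |: F).
Proof.
move=> wJ w'J ww' /eqP/cards1P[l cw] /eqP/cards1P[l' cw'] jJ jw jw' gj.
have lw : (l, w) \in F by rewrite -in_col cw inE.
have lw' : (l', w') \in F by rewrite -in_col cw' inE.
have [lI _] := sFP lw; have [lI' _] := sFP lw'.
have w'J' : w' \in J :\ w by rewrite !inE eq_sym ww'.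
pose D := delr F w; pose E := delr D w'.
have cD : conn D (I :\ a) (J :\ w) := conn_delr cF wJ lI cw.
have cwD : col D w' = [set l'].
  by rewrite -cw'; apply/setP => x; rewrite !in_col in_delr eq_sym ww' andbT.
have cE : conn E (I :\ a) (J :\ w :\ w') := conn_delr cD w'J' lI' cwD.
have sD : D \subset setX (I :\ a) (J :\ w).
  by apply/withinP => x y; rewrite in_delr [y \in _]in_setD1 => /andP[/sFP[-> ->] ->].
have sE : E \subset setX (I :\ a) (J :\ w :\ w').
  by apply/withinP => x y; rewrite in_delr [y \in _]in_setD1 => /andP[/(withinP _ _ _ sD)[-> ->] ->].
pose H := (a, j) |: E.
have jJ' : j \in J :\ w :\ w' by rewrite !inE jw jw'.
have eI : a |: (I :\ a) = I by rewrite setD1K.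
have cH : conn H I (J :\ w :\ w').
  by rewrite -eI; apply: conn_leaf => //; rewrite !inE eqxx.
have sH : H \subset setX I (J :\ w :\ w').
  apply/withinP => x y; rewrite in_setU1 => /orP[/eqP[-> ->]//|/(withinP _ _ _ sE)[xI yJ]].
  by split=> //; move: xI; rewrite inE => /andP[].
have ED : E \subset D by apply: delr_sub.
have gH : good M ((l', w') |: H).
  apply: good_sub gj; rewrite subUset sub1set setUS // andbT.
  by rewrite in_setU1 in_delr lw' [w' == w]eq_sym ww' orbT.
have I0 : I != set0 by apply/set0Pn; exists a.
have ext : extends M I (J :\ w').
  by apply: IH => //; [apply: subD1set | rewrite ltn_add2l cardsD1_lt].
have [l1 l1I gl1] : exists2 l1, l1 \in I & good (trf M) ((w, l1) |: tr H).
  apply: (extends_attach (extends_tr ext)) => //.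
  - by rewrite !inE ww'.
  - by rewrite good_tr; apply: good_sub gH; apply: subsetUr.
  - by rewrite -tr_setX tr_subset setDDl setUC -setDDl.
have eJ : w' |: (w |: (J :\ w :\ w')) = J by rewrite setUCA setD1K // setD1K.
have : good (trf M) ((w', l') |: ((w, l1) |: tr H)).
  apply: (two_leaves (ensemble_tr eM) (I0 := J :\ w :\ w') (J := I)) => //.
  - move=> I' J' s s' lt; apply: extends_tr; apply: IH => //; first by rewrite -eJ.
    by move: lt; rewrite eJ addnC [X in _ < X]addnC.
  - by rewrite -tr_setX tr_subset.
  - exact: conn_tr.
  - by rewrite eq_sym.
  - by rewrite !inE eqxx.
  - by rewrite !inE eqxx andbF.
  - by move: lI'; rewrite inE => /andP[].
  - by rewrite -trU1 good_tr.
rewrite -!trU1 good_tr => gA.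
have sDA : D \subset (l', w') |: ((l1, w) |: H).
  apply/subsetP => -[x y] xy; rewrite !in_setU1.
  have [e|yw] := eqVneq y w'; last by rewrite in_delr xy yw !orbT.
  have : x \in col D w' by rewrite in_col -e.
  by rewrite cwD e => /set1P->; rewrite eqxx.
have [e|l1a] := eqVneq l1 a.
  exists w => //; apply: good_addcol => //; apply: good_sub gA.
  by rewrite subUset sub1set !in_setU1 e eqxx orbT -e.
exists j => //.
have l1I' : l1 \in I :\ a by rewrite !inE l1a.
have eF : F = (l, w) |: D.
  apply/setP => -[x y]; rewrite in_setU1 in_delr xpair_eqE.
  have [->|xi] := eqVneq y w; last by rewrite andbF andbT.
  by rewrite !andbT andbF orbF -in_col cw inE.
have e1 : l1 = l.
  apply: (@good_attach_unique _ _ (trf M) (tr D) (J :\ w) (I :\ a) w) => //.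
  - by rewrite -trU1 good_tr; apply: good_sub gA; rewrite subUset sub1set !in_setU1 eqxx orbT.
  - by rewrite -trU1 -eF good_tr.
  - by rewrite !inE eqxx.
  - exact: conn_tr.
  - by rewrite -tr_setX tr_subset.
apply: good_sub gA; rewrite {1}eF e1 in sDA *.
by rewrite !subUset !sub1set !in_setU1 !eqxx !orbT.
Qed.

(** [a] goes where [M I J] sends it. A largest bad matching covers [I], hence [J], and uses (a, j),
    the only edge at [a]; without this edge both it and [M I J] become [M (I :\ a) (J :\ j)]. *)
Lemma star_square : (forall l, l \in I :\ a -> 1 < #|row F l|) -> #|I| = #|J| ->
  exists2 j, j \in J & good M ((a, j) |: F).
Proof.
move=> h2 eIJ; have [mT dT cT] := ens_matching eM eIJ.
have /domP[j aj] : a \in dom (M I J) by rewrite dT.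
have jJ : j \in J by rewrite -cT; apply: mem_cod aj.
exists j => //; set G := (a, j) |: F.
have [//|bG] := boolP (good M G).
have noa y : (a, y) \notin F by apply/negP => /sFP[]; rewrite !inE eqxx.
have sG : G \subset setX I J.
  apply/withinP => x y; rewrite in_setU1 => /orP[/eqP[-> ->]//|/sFP[xI yJ]].
  by split=> //; move: xI; rewrite inE => /andP[].
have rowa : row G a = [set j].
  by apply/setP => y; rewrite in_row in_setU1 (negPf (noa _)) orbF xpair_eqE eqxx inE.
have rowG l : l \in I :\ a -> row G l = row F l.
  move=> lI; apply/setP => y; rewrite !in_row in_setU1 xpair_eqE.
  by move: lI; rewrite inE => /andP[]; rewrite inE => /negPf->.
have fG : forest G.
  apply: forest_leaf; last exact: good_forest gF.
  by apply/domP => -[y]; rewrite (negPf (noa y)).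
have domG : dom G \subset I by apply/subsetP => x /domP[y /(withinP _ _ _ sG)[]].
have codG : cod G \subset J by apply/subsetP => x /codP[y /(withinP _ _ _ sG)[]].
pose bad (P : {set L * R}) := [&& P \subset G, matching P & P != M (dom P) (cod P)].
have [P0 bP0] : exists P0, bad P0.
  case/forallPn: bG => P0; rewrite negb_imply => /andP[/andP[e1 e2] e3].
  by exists P0; rewrite /bad e1 e2.
case: (arg_maxnP (fun X : {set L * R} => #|X|) bP0) => P /and3P[sP mP /eqP bP] maxP.
have maxP' P' : P' \subset G -> matching P' -> #|P| < #|P'| -> P' = M (dom P') (cod P').
  move=> s m lt; apply/eqP; apply: contraTT lt => b'; rewrite -leqNgt; apply: maxP.
  by rewrite /bad s m.
have split_I l : l \in I -> l = a \/ l \in I :\ a.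
  by move=> lI; rewrite !inE lI; case: eqP => [->|_]; [left|right].
have dP : dom P = I.
  apply/eqP; rewrite eqEsubset; apply/andP; split.
    by apply: subset_trans domG; apply: dom_sub.
  apply: (cover_left eM _ _ domG fG sP mP bP maxP') => l /split_I[->|lI].
  - by rewrite rowa; apply/set0Pn; exists j; rewrite inE.
  - by rewrite rowG // -card_gt0; apply: ltnW; apply: h2.
  - move=> _; apply: good_sub gF; apply/subsetP => -[x y].
    by rewrite in_del in_setU1 xpair_eqE => /andP[h xa]; move: h; rewrite (negPf xa).
  by rewrite rowG // => e; have := h2 _ lI; rewrite e.
have cP : cod P = J.
  apply/eqP; rewrite eqEcard (subset_trans (cod_sub sP) codG) /=.
  by rewrite -matching_sizes // dP eIJ.
have ajP : (a, j) \in P.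
  have /domP[y ay] : a \in dom P by rewrite dP.
  have : y \in row G a by rewrite in_row (subsetP sP).
  by rewrite rowa => /set1P <-.
have e1 : P :\ (a, j) = M (I :\ a) (J :\ j).
  have /goodP g := gF; rewrite [LHS]g ?domD1 ?codD1 ?dP ?cP //.
    apply/subsetP => p; rewrite in_setD1 => /andP[ne /(subsetP sP)].
    by rewrite in_setU1 (negPf ne).
  by apply: matching_sub mP; apply: subD1set.
have e2 : M I J :\ (a, j) = M (I :\ a) (J :\ j).
  by rewrite [LHS](ens_closed eM eIJ (subD1set _ _)) domD1 ?codD1 ?dT ?cT.
by case: bP; rewrite dP cP -(setD1K ajP) e1 -e2 setD1K.
Qed.

Lemma star_conn : I :\ a != set0 -> exists2 j, j \in J & good M ((a, j) |: F).
Proof.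
move=> I0.
have rowF l : l \in I :\ a -> 0 < #|row F l|.
  by move=> lI; rewrite card_gt0; apply: conn_row cF sF lI J0.
have colF r : r \in J -> 0 < #|col F r|.
  move=> rJ; rewrite card_gt0 -row_tr; apply: conn_row (conn_tr cF) _ rJ I0.
  by rewrite -tr_setX tr_subset.
have [/exists_inP[i iI /eqP ri]|nl] := boolP [exists i in I :\ a, #|row F i| == 1].
  exact: star_left_leaf ri.
have h2 l : l \in I :\ a -> 1 < #|row F l|.
  move=> lI; rewrite ltn_neqAle rowF // andbT eq_sym.
  by apply: contra nl => e; apply/exists_inP; exists l.
pose W := [set w in J | #|col F w| == 1].
(* Three right leaves, because [w] is deleted to find [j] and [w'] has to differ from both. With at
   most two, counting edges forces |I| = |J|. *)
have [W3|W2] := ltnP 2 #|W|.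
  have /set0Pn[w wW] : W != set0 by rewrite -card_gt0; apply: leq_trans W3.
  have [wJ cw] : w \in J /\ #|col F w| = 1 by move: wW; rewrite inE => /andP[-> /eqP].
  have cW1 : 1 < #|W :\ w| by move: W3; rewrite (cardsD1 w) wW add1n ltnS.
  have WJ : W :\ w \subset J :\ w.
    by apply: setSD; apply/subsetP => x; rewrite inE => /andP[].
  have J1 : J :\ w != set0.
    have /set0Pn[x xW] : W :\ w != set0 by rewrite -card_gt0; apply: ltnW.
    by apply/set0Pn; exists x; apply: (subsetP WJ).
  have ext : extends M I (J :\ w).
    by apply: IH => //; [apply: subD1set | rewrite ltn_add2l cardsD1_lt].
  have [j jJ gj] : exists2 j, j \in J :\ w & good M ((a, j) |: delr F w).
    apply: (extends_attach ext) => //; first exact: good_sub (delr_sub _ _) gF.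
    by apply/withinP => x y; rewrite in_delr [y \in _]in_setD1 => /andP[/sFP[-> ->] ->].
  have /set0Pn[w'] : W :\ w :\ j != set0.
    rewrite -card_gt0; have := cardsD1 j (W :\ w); case: (j \in _); move: cW1 => /[swap] ->;
    by rewrite ?add1n ?add0n // => /ltnW.
  rewrite !inE => /and4P[w'j w'w w'J /eqP cw']; move: jJ; rewrite !inE => /andP[jw jJ].
  by apply: (star_right_leaves wJ w'J _ cw cw' jJ) => //; rewrite eq_sym.
apply: star_square => //.
have lt : #|F| < #|I :\ a| + #|J|.
  by apply: forest_card (good_forest gF) sF _; rewrite I0.
have r2 : 2 * #|I :\ a| <= #|F| by apply: card_rows_ge2.
have c2 : 2 * #|J| <= #|F| + #|W|.
  rewrite card_cols mulnC -sum_nat_const.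
  have -> : #|W| = \sum_(r in J) (#|col F r| == 1).
    rewrite -sum1_card big_mkcond [RHS]big_mkcond /=; apply: eq_bigr => r _.
    by rewrite inE; case: (r \in J) => //=; case: (_ == 1).
  have s : \sum_(r in J) #|col F r| <= \sum_r #|col F r|.
    by rewrite [leqRHS](bigID (mem J)) leq_addr.
  apply: leq_trans (leq_add s (leqnn _)); rewrite -big_split /=.
  by apply: leq_sum => r /colF; case: #|_| => [|[|]].
have cI : #|I| = #|I :\ a|.+1 by rewrite (cardsD1 a) aI.
move: lt r2 c2 W2 cI; clear; move: #|F| #|I| #|J| #|W| #|I :\ a| => *; lia.
Qed.

End Connected.

Lemma star F : good M F -> F \subset setX (I :\ a) J ->
  exists2 j, j \in J & good M ((a, j) |: F).
Proof.
move=> gF sF; have [I0|I0] := eqVneq (I :\ a) set0.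
  have /set0Pn[j jJ] := J0; exists j => //.
  have -> : F = set0.
    by apply/eqP; rewrite -subset0; apply/subsetP => -[x y] /(withinP _ _ _ sF)[]; rewrite I0 inE.
  by rewrite setU0; apply: good1.
have ext : extends M (I :\ a) J.
  by apply: IH => //; [apply: subD1set | rewrite ltn_add2r cardsD1_lt].
have [F' [s gF' sF' cF']] := extends_conn ext I0 J0 gF sF.
have [j jJ g] := star_conn gF' sF' cF' I0.
by exists j => //; apply: good_sub g; apply: setUS.
Qed.

End Star.

(** * Extension past a left vertex of degree at most one *)

Section ExtendLeft.
Variables (L R : finType) (M : matching_family L R) (eM : ensemble M).
Implicit Types (G H N P T U V : {set L * R}) (A : {set L}).
Variables (I : {set L}) (J : {set R}).
Hypothesis IH : forall (I' : {set L}) (J' : {set R}), I' \subset I -> J' \subset J ->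
  #|I'| + #|J'| < #|I| + #|J| -> extends M I' J'.
Variables (F : {set L * R}) (K : {set L}) (B : {set R}).
Hypothesis IHF : forall (F' : {set L * R}) (K' : {set L}) (B' : {set R}), #|F| < #|F'| ->
  good M F' -> F' \subset setX I J -> K' \subset I -> B' \subset J -> K' != set0 ->
  B' != set0 -> (forall l r, (l, r) \in F' -> (l \in K') = (r \notin B')) ->
  exists k b, [/\ k \in K', b \in B' & good M ((k, b) |: F')].
Hypotheses (gF : good M F) (sF : F \subset setX I J) (sK : K \subset I) (sB : B \subset J).
Hypotheses (K0 : K != set0) (B0 : B != set0).
Hypothesis sep : forall l r, (l, r) \in F -> (l \in K) = (r \notin B).

Let concl := exists k b, [/\ k \in K, b \in B & good M ((k, b) |: F)].

(** The separation survives the added edge, so the induction on larger graphs applies, and the edge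
    it finds serves for [F] too. *)
Lemma extend_larger k b : k \in I -> b \in J -> (k \in K) = (b \notin B) -> (k, b) \notin F ->
  good M ((k, b) |: F) -> concl.
Proof.
move=> kI bJ kb kbF g; have [|||k' [b' [k'K b'B g']]] := IHF (F' := (k, b) |: F) _ g _ sK sB K0 B0.
- by rewrite cardsU1 kbF.
- by rewrite subUset sub1set in_setX kI bJ.
- by move=> l r; rewrite in_setU1 => /orP[/eqP[-> ->]|/sep].
by exists k', b'; split=> //; apply: good_sub g'; apply: setUS; apply: subsetUr.
Qed.

(* If F extends by an edge (i, j) directed the wrong way, then F + (i, j) is
   extended along a cut of F not separating K from B. *)
Lemma extend_across i j A Bs : i \in I -> j \in J -> i \notin K -> j \notin B ->
  good M ((i, j) |: F) -> (i, j) \notin F -> resp F A Bs ->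
  (exists2 k, k \in K & (k \in A) && (j \notin Bs)) \/
  (exists2 b, b \in B & (b \in Bs) && (i \notin A)) -> concl.
Proof.
move=> iI jJ iK jB g ij rs.
have rK : resp F K (~: B) by move=> l r /sep; rewrite inE.
have lt : #|F| < #|(i, j) |: F| by rewrite cardsU1 ij.
have sF' : (i, j) |: F \subset setX I J by rewrite subUset sub1set in_setX iI jJ.
have subF k b : (k, b) |: F \subset (k, b) |: ((i, j) |: F).
  by apply: setUS; apply: subsetUr.
case=> [[k kK /andP[kA jBs]]|[b bB /andP[bBs iA]]].
  have rs' := respI rs rK.
  case: (IHF (K' := A :&: K) (B' := J :\: (Bs :&: ~: B)) lt g sF').
  - by apply: subset_trans sK; apply: subsetIr.
  - exact: subsetDl.
  - by apply/set0Pn; exists k; rewrite inE kA.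
  - have /set0Pn[b bB] := B0; apply/set0Pn; exists b.
    by rewrite !inE bB andbF /= (subsetP sB).
  - move=> l r; rewrite in_setU1 => /orP[/eqP[-> ->]|lr].
      by rewrite !inE (negPf iK) andbF jJ (negPf jBs).
    by have [_ rJ] := withinP _ _ _ sF _ _ lr; rewrite in_setD rJ andbT negbK; apply: rs'.
  move=> k1 [b1 [k1A b1B g1]]; have k1K : k1 \in K by move: k1A; rewrite inE => /andP[].
  (* An edge that misses [B] respects the separation, and it is new because it crosses a cut of [F];
     so it enlarges [F]. *)
  have [bB|bB] := boolP (b1 \in B).
    by exists k1, b1; split=> //; apply: good_sub g1.
  move: b1B; rewrite inE => /andP[nb b1J].
  apply: (extend_larger (k := k1) (b := b1)) => //.
  - exact: (subsetP sK).
  - by rewrite k1K bB.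
  - by apply: contra nb => /rs' <-.
  - exact: good_sub g1.
have rs' := respI rs (respC rK).
case: (IHF (K' := I :\: (A :&: ~: K)) (B' := Bs :&: ~: ~: B) lt g sF').
- exact: subsetDl.
- by rewrite setCK; apply: subset_trans sB; apply: subsetIr.
- have /set0Pn[k kK] := K0; apply/set0Pn; exists k.
  by rewrite !inE kK andbF /= (subsetP sK).
- by apply/set0Pn; exists b; rewrite !inE negbK bBs.
- move=> l r; rewrite in_setU1 => /orP[/eqP[-> ->]|lr].
    by rewrite in_setD iI andbT !inE (negPf iA) (negPf jB) andbF.
  by have [lI _] := withinP _ _ _ sF _ _ lr; rewrite in_setD lI andbT (rs' _ _ lr).
move=> k1 [b1 [k1A b1B g1]]; have b1B' : b1 \in B by move: b1B; rewrite setCK inE => /andP[].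
move: k1A; rewrite in_setD => /andP[nk k1I].
have [kK|kK] := boolP (k1 \in K).
  by exists k1, b1; split=> //; apply: good_sub g1.
apply: (extend_larger (k := k1) (b := b1)) => //.
- exact: (subsetP sB).
- by rewrite (negPf kK) b1B'.
- by apply: contra nk => /rs' ->.
- exact: good_sub g1.
Qed.

(** Delete [i], extend by (k, b), and attach [i] again at some [j] by [star]. If [j] is not the old
    neighbour [c], then (i, j) can be added to [F] itself: it is the required edge, or enlarges [F],
    or points the wrong way. In the last case [extend_across] applies unless [F] connects all of [K]
    to [j] and all of [B] to [i], and then an alternating walk from [c] through [b] and [k] to [j]
    gives a contradiction. *)
Lemma extend_left i : i \in I -> #|row F i| <= 1 -> (i \notin K) || (K :\ i != set0) -> concl.
Proof.
move=> iI ri iK.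
have sF0 : del F i \subset setX (I :\ i) J.
  by apply/withinP => x y; rewrite in_del in_setD1 => /andP[/(withinP _ _ _ sF)[-> ->] ->].
have J0 : J != set0 by case/set0Pn: B0 => b /(subsetP sB) bJ; apply/set0Pn; exists b.
have ext : extends M (I :\ i) J.
  by apply: IH => //; [apply: subD1set | rewrite ltn_add2r cardsD1_lt].
have [||||k [b [kK bB g0]]] := ext (del F i) (K :\ i) B _ sF0 _ sB _ B0.
- exact: good_sub (del_sub _ _) gF.
- exact: setSD.
- by case/orP: iK => // iK; rewrite (setDidPl _) // disjoint_sym disjoints1.
- by move=> l r; rewrite in_del in_setD1 => /andP[/sep <- ->].
have {kK} [ki kK] : k != i /\ k \in K by move: kK; rewrite !inE => /andP[].
have [r0|/set0Pn[c]] := eqVneq (row F i) set0.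
  exists k, b; split=> //; apply: good_sub g0; apply: setUS; apply/subsetP => -[x y] xy.
  rewrite in_del xy; apply/negP => /eqP e; have : y \in row F i by rewrite in_row -e.
  by rewrite r0 inE.
rewrite in_row => ic.
have rowi y : (i, y) \in F -> y = c.
  move=> iy; have h : [set c; y] \subset row F i by rewrite subUset !sub1set !in_row ic iy.
  have := leq_trans (subset_leq_card h) ri; rewrite cards2 eq_sym.
  by case: eqP.
have [j jJ gH] : exists2 j, j \in J & good M ((i, j) |: ((k, b) |: del F i)).
  apply: (star eM IH iI J0) => //; rewrite subUset sub1set in_setX in_setD1 ki.
  by rewrite (subsetP sK) // (subsetP sB).
have [ejc|jc] := eqVneq j c.
  exists k, b; split=> //; apply: good_sub gH; apply/subsetP => -[x y].
  rewrite ejc !in_setU1 in_del => /orP[->|xy]; first by rewrite orbT.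
  rewrite xy; have [e|_] := eqVneq x i; last by rewrite !orbT.
  by rewrite e in xy *; rewrite (rowi _ xy) eqxx.
have gj : good M ((i, j) |: F).
  by apply: good_addrow => //; apply: good_sub gH; apply: setUS; apply: subsetUr.
have ij : (i, j) \notin F by apply: contra jc => /rowi->.
have [e|] := eqVneq (i \in K) (j \notin B); first exact: (extend_larger iI jJ e ij gj).
have [iK'|iK'] := boolP (i \in K); have [jB|jB] := boolP (j \in B) => //= _.
  by exists i, j.
have across := extend_across iI jJ iK' jB gj ij.
pose respb (A : {set L}) (Bs : {set R}) := [forall p in F, (p.1 \in A) == (p.2 \in Bs)].
have respP (A : {set L}) (Bs : {set R}) : reflect (resp F A Bs) (respb A Bs).
  apply: (iffP forall_inP) => [h l r /h /eqP//|h [l r] lr].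
  by apply/eqP; apply: h.
have [/exists_inP[k0 k0K /existsP[A /existsP[Bs /and3P[/respP rs h1 h2]]]]|nK] :=
  boolP [exists k0 in K, exists A, exists Bs, [&& respb A Bs, k0 \in A & j \notin Bs]].
  by apply: (across _ _ rs); left; exists k0 => //; rewrite h1.
have [/exists_inP[b0 b0B /existsP[A /existsP[Bs /and3P[/respP rs h1 h2]]]]|nB] :=
  boolP [exists b0 in B, exists A, exists Bs, [&& respb A Bs, b0 \in Bs & i \notin A]].
  by apply: (across _ _ rs); right; exists b0 => //; rewrite h1.
have linkK k0 (A : {set L}) (Bs : {set R}) : k0 \in K -> resp F A Bs -> k0 \in A -> j \in Bs.
  move=> k0K /respP rs kA; apply: contraT => jBs; case/negP: nK.
  apply/exists_inP; exists k0 => //; apply/existsP; exists A; apply/existsP; exists Bs.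
  by rewrite rs kA.
have linkB b0 (A : {set L}) (Bs : {set R}) : b0 \in B -> resp F A Bs -> i \in A -> b0 \in Bs.
  move=> b0B /respC/respP rs iA; apply: contraT => bBs; case/negP: nB.
  apply/exists_inP; exists b0 => //; apply/existsP; exists (~: A).
  by apply/existsP; exists (~: Bs); rewrite rs !inE bBs iA.
(* [H] keeps the edges of [F] off [i], so [B1] is the right half of a union of components of [F]. It
   contains [b], passes through (k, b) to the component of [k], and so contains [j]; the walk then
   closes at [i] and puts (i, c) into [H]. *)
exfalso; move: gH; set H := (i, j) |: _ => gH.
pose B1 := [set r | connect (step H F) c r].
pose A1 := i |: [set l | [exists r in B1, ((l, r) \in F) && (l != i)]].
have cB : c \in B1 by rewrite inE connect0.
have rs : resp F A1 B1.
  move=> l r lr; rewrite in_setU1; have [e|li] := eqVneq l i.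
    by rewrite e in lr; rewrite (rowi _ lr) cB.
  rewrite inE /=; apply/exists_inP/idP => [[r' r'B /andP[lr' _]]|rB]; last first.
    by exists r => //; rewrite lr.
  move: r'B; rewrite !inE => h; apply: connect_trans h (connect1 _); apply/stepP.
  by exists l => //; rewrite /H !in_setU1 in_del lr' li !orbT.
have bB1 : b \in B1 by apply: linkB rs _ => //; rewrite in_setU1 eqxx.
have /set0Pn[c1] : row F k != set0.
  apply/eqP => e; have : j \in (set0 : {set R}).
    apply: (linkK k [set k]) => //; last by rewrite inE.
    move=> l r lr; rewrite !inE; apply/negbTE/eqP => el.
    by have : r \in row F k; [rewrite in_row -el|rewrite e inE].
  by rewrite inE.
rewrite in_row => kc1.
have c1B : c1 \in B1.
  move: bB1; rewrite !inE => h; apply: connect_trans h (connect1 _); apply/stepP.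
  by exists k => //; rewrite /H !in_setU1 eqxx orbT.
have : j \in B1.
  apply: (linkK k A1) => //; rewrite in_setU1 inE; apply/orP; right.
  by apply/exists_inP; exists c1 => //; rewrite kc1.
rewrite inE => cj; have : (i, c) \in H.
  apply: (alternating_walk (good_compat gH gF) _ ic cj).
  by rewrite /H in_setU1 eqxx.
rewrite /H !in_setU1 in_del eqxx andbF orbF !xpair_eqE eqxx /= eq_sym (negPf jc) /=.
by rewrite eq_sym (negPf ki).
Qed.

End ExtendLeft.

Section ExtendAll.
Variables (L R : finType) (M : matching_family L R) (eM : ensemble M).

(** If a vertex of degree at most one can be deleted without emptying [K] or [B], [extend_left]
    applies on its side. Otherwise counting the edges between [K] and [J :\: B], and between
    [I :\: K] and [B], leaves only [K] = {k} and [B] = {b} with [F] empty. *)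
Lemma extends_step (I : {set L}) (J : {set R}) :
  (forall (I' : {set L}) (J' : {set R}), I' \subset I -> J' \subset J ->
    #|I'| + #|J'| < #|I| + #|J| -> extends M I' J') -> extends M I J.
Proof.
move=> IH F K B; have [n] := ubnP (#|{: L * R}| - #|F|).
elim: n F K B => // n IHn F K B le gF sF sK sB K0 B0 sep.
have IHF (F' : {set L * R}) (K' : {set L}) (B' : {set R}) : #|F| < #|F'| ->
    good M F' -> F' \subset setX I J -> K' \subset I -> B' \subset J -> K' != set0 ->
    B' != set0 -> (forall l r, (l, r) \in F' -> (l \in K') = (r \notin B')) ->
    exists k b, [/\ k \in K', b \in B' & good M ((k, b) |: F')].
  move=> lt; apply: IHn; apply: leq_trans (ltn_sub2l _ lt) _; last by rewrite -ltnS.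
  by apply: leq_trans lt _; apply: max_card.
have [/exists_inP[i iI /andP[r1 iK]]|nL] := boolP
  [exists i in I, (#|row F i| <= 1) && ((i \notin K) || (K :\ i != set0))].
  exact: (extend_left eM IH IHF gF sF sK sB K0 B0 sep iI r1 iK).
have [/exists_inP[r rJ /andP[r1 rB]]|nR] := boolP
  [exists r in J, (#|col F r| <= 1) && ((r \notin B) || (B :\ r != set0))].
  have [||||||b [k [bB kK g]]] := @extend_left _ _ (trf M) (ensemble_tr eM) J I _ (tr F) B K
    _ _ _ sB sK B0 K0 _ r rJ _ rB.
  - move=> J' I' s s' lt; apply: extends_tr; apply: IH => //.
    by rewrite addnC [X in _ < X]addnC.
  - move=> F' B' K' lt gF' sF' sB' sK' B'0 K'0 sep'.
    case: (IHF (tr F') K' B') => //.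
    + by rewrite card_tr -[#|F|]card_tr.
    + by rewrite -good_tr trK.
    + by rewrite -tr_subset trK tr_setX.
    + by move=> l x; rewrite in_tr => /sep' ->; rewrite negbK.
    move=> k [b [kK bB g]]; exists b, k; split=> //.
    by rewrite -[F']trK -trU1 good_tr.
  - by rewrite good_tr.
  - by rewrite -tr_setX tr_subset.
  - by move=> x l; rewrite in_tr => /sep ->; rewrite negbK.
  - by rewrite row_tr.
  exists k, b; split=> //; by rewrite -good_tr trU1.
have hL i : i \in I -> (i \notin K) || (K :\ i != set0) -> 1 < #|row F i|.
  move=> iI h; rewrite ltnNge; apply: contra nL => h1; apply/exists_inP.
  by exists i => //; rewrite h1.
have hR r : r \in J -> (r \notin B) || (B :\ r != set0) -> 1 < #|col F r|.
  move=> rJ h; rewrite ltnNge; apply: contra nR => h1; apply/exists_inP.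
  by exists r => //; rewrite h1.
have arith a b c : c < a + b -> 2 * a <= c -> 2 * b <= c -> False by lia.
have sFP := withinP _ _ _ sF.
have [/exists_inP[k kK k1]|nk] := boolP [exists k in K, #|row F k| <= 1]; last first.
  exfalso; pose FA := [set p in F | p.1 \in K].
  apply: (arith #|K| #|J :\: B| #|FA|).
  - apply: forest_card; last by rewrite K0.
      by apply: good_forest; apply: good_sub gF; apply/subsetP => p; rewrite inE => /andP[].
    apply/withinP => l r; rewrite !inE /= => /andP[lr lK]; split=> //.
    by rewrite -(sep _ _ lr) lK; case: (sFP _ _ lr).
  - apply: card_rows_ge2 => l lK.
    have -> : row FA l = row F l by apply/setP => y; rewrite !in_row inE /= lK andbT.
    by rewrite ltnNge; apply: contra nk => h; apply/exists_inP; exists l.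
  - apply: card_cols_ge2 => r; rewrite inE => /andP[rB rJ].
    have -> : col FA r = col F r.
      apply/setP => y; rewrite !in_col inE /=; have [/sep ->|//] := boolP ((y, r) \in F).
      by rewrite rB.
    by apply: hR => //; rewrite rB.
have [/exists_inP[b bB b1]|nb] := boolP [exists b in B, #|col F b| <= 1]; last first.
  exfalso; pose FB := [set p in F | p.2 \in B].
  apply: (arith #|I :\: K| #|B| #|FB|).
  - apply: forest_card; last by rewrite B0 orbT.
      by apply: good_forest; apply: good_sub gF; apply/subsetP => p; rewrite inE => /andP[].
    apply/withinP => l r; rewrite !inE /= => /andP[lr rB]; split=> //.
    by rewrite (sep _ _ lr) rB; case: (sFP _ _ lr).
  - apply: card_rows_ge2 => l; rewrite inE => /andP[lK lI].
    have -> : row FB l = row F l.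
      apply/setP => y; rewrite !in_row inE /=; have [h|//] := boolP ((l, y) \in F).
      by have := sep _ _ h; rewrite (negPf lK) => /esym/negbFE ->.
    by apply: hL => //; rewrite lK.
  - apply: card_cols_ge2 => r rB.
    have -> : col FB r = col F r by apply/setP => y; rewrite !in_col inE /= rB andbT.
    by rewrite ltnNge; apply: contra nb => h; apply/exists_inP; exists r.
exists k, b; split=> //; have -> : F = set0; last by rewrite setU0; apply: good1.
have kI := subsetP sK _ kK; have bJ := subsetP sB _ bB.
have eK x : x \in K -> x = k.
  move=> xK; apply/eqP; apply: contraT => xk; move: k1; rewrite leqNgt hL //.
  by apply/orP; right; apply/set0Pn; exists x; rewrite !inE xk.
have eB x : x \in B -> x = b.
  move=> xB; apply/eqP; apply: contraT => xb; move: b1; rewrite leqNgt hR //.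
  by apply/orP; right; apply/set0Pn; exists x; rewrite !inE xb.
apply/eqP; rewrite -subset0; apply/subsetP => -[l r] lr; have [lI rJ] := sFP _ _ lr.
have [lK|lK] := boolP (l \in K).
  have rB : r \notin B by rewrite -(sep _ _ lr).
  have := hR r rJ; rewrite rB => /(_ isT).
  suff /subset_leq_card : col F r \subset [set k] by rewrite cards1 leqNgt => /negPf->.
  by apply/subsetP => x; rewrite in_col inE => /sep; rewrite rB => /eK ->.
have rB : r \in B by move: (sep _ _ lr); rewrite (negPf lK) => /esym/negbFE.
have := hL l lI; rewrite lK => /(_ isT).
suff /subset_leq_card : row F l \subset [set b] by rewrite cards1 leqNgt => /negPf->.
apply/subsetP => x; rewrite in_row inE => /sep; rewrite (negPf lK) => /esym/negbFE/eB ->.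
by [].
Qed.

Theorem ensemble_extends I J : extends M I J.
Proof.
have [n] := ubnP (#|I| + #|J|); elim: n I J => // n IHn I J le.
apply: extends_step => I' J' _ _ lt; apply: IHn; exact: leq_trans lt _.
Qed.

End ExtendAll.

(** * Elimination and completion *)

Section Elimination.
Variables (L R : finType) (M : matching_family L R) (eM : ensemble M).
Implicit Types (F G H P T U V W X Y : {set L * R}).

Lemma step_subl X Y V : X \subset Y -> subrel (connect (step X V)) (connect (step Y V)).
Proof.
move=> /subsetP s; apply: connect_sub => x y /stepP[l h h']; apply: connect1.
by apply/stepP; exists l => //; apply: s.
Qed.

(** A vertex with the fewest reachable vertices lies in a sink component. *)
Lemma min_reach (e : rel R) (j : R) :
  exists2 j0, connect e j j0 & forall y, connect e j0 y -> connect e y j0.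
Proof.
case: (arg_minnP (fun y => #|connect e y|) (connect0 e j)) => j0 jj0 minj; exists j0 => // y j0y.
have s : connect e y \subset connect e j0.
  by apply/subsetP => z; rewrite !inE; apply: connect_trans.
have := subset_leqif_card s; move/geq_leqif; rewrite minj; last exact: connect_trans jj0 j0y.
by move/esym/subsetP/(_ j0); rewrite !inE; apply.
Qed.

(* U is enlarged to a good graph X from which every right vertex reaches, along
   the steps of (X, V), a row where U and V differ; on a sink component of this
   relation X then contains V. *)
Lemma good_elim U V i : good M U -> good M V ->
  (forall l, row U l != set0) -> (forall l, row V l != set0) ->
  exists W, [/\ good M W, row W i = row U i :|: row V i &
    forall l, l != i -> row W l = row U l \/ row W l = row V l].
Proof.
have [n] := ubnP #|[set l | row U l != row V l]|.
elim: n U => // n IHn U le gU gV tU tV.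
have [sVU|nsVU] := boolP (row V i \subset row U i).
  by exists U; split=> //; [apply/esym/setUidPl | left].
have iD : row U i != row V i by apply: contraNneq nsVU => ->.
pose C (X : {set L * R}) := [set j | [exists k, (row U k != row V k) &&
  [exists u in row X k, connect (step X V) j u]]].
have Csub X Y : X \subset Y -> C X \subset C Y.
  move=> s; apply/subsetP => j; rewrite !inE => /existsP[k /andP[kD /exists_inP[u ku ju]]].
  apply/existsP; exists k; rewrite kD; apply/exists_inP; exists u.
    by apply: (subsetP (col_row_sub k s)).
  exact: step_subl ju.
(* A row may be enlarged only if its [U]-part lies in [C X]. This makes the rows inside [C X] and
   the complement of [C X] a separation, to which extension applies. *)
pose pr (X : {set L * R}) := [&& U \subset X, good M X &
  [forall k, (row X k \subset row U k) || (row U k \subset C X)]].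
have prU : pr U by rewrite /pr subxx gU; apply/forallP => k; rewrite subxx.
case: (arg_maxnP (fun X : {set L * R} => #|X|) prU) => X /and3P[UX gX /forallP invX] maxX.
have Dk k u : row U k != row V k -> u \in row X k -> u \in C X.
  move=> kD ku; rewrite inE; apply/existsP; exists k; rewrite kD.
  by apply/exists_inP; exists u => //; apply: connect0.
have CT : C X = setT.
  apply/eqP; rewrite -subTset -setD_eq0 setTD; apply: contraT => B0.
  pose K := [set k | row X k \subset C X].
  have iK : i \in K by rewrite inE; apply/subsetP => u; apply: Dk.
  case: (@ensemble_extends _ _ _ eM setT setT X K (~: C X)) => //.
  - by apply/withinP => *; rewrite !inE.
  - by apply/set0Pn; exists i.
  - move=> l r lr; rewrite [l \in K]inE in_setC negbK.
    apply/subsetP/idP => [|rC]; first by apply; rewrite in_row.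
    apply/subsetP; apply: contraT => /subsetPn[r0 lr0 r0C].
    have eUV : row U l = row V l by apply/eqP; apply: contraNT r0C => lD; apply: Dk lr0.
    have VC v : v \in row V l -> v \notin C X.
      rewrite in_row in lr0; rewrite in_row => lv; apply: contra r0C.
      rewrite !inE => /existsP[k /andP[kD /exists_inP[u ku vu]]].
      apply/existsP; exists k; rewrite kD; apply/exists_inP; exists u => //.
      by apply: connect_trans vu; apply: connect1; apply/stepP; exists l.
    case/orP: (invX l) => [/subsetP s|/subsetP s].
      by have := VC r; rewrite rC -eUV => /(_ (s _ _)); rewrite in_row => /(_ lr).
    by have /set0Pn[u] := tU l; move=> ul; have := VC u; rewrite -eUV s // => /(_ ul).
  move=> k [b [kK bC g]]; have kb : (k, b) \notin X.
    apply/negP => kb; move: bC; rewrite inE; move: kK; rewrite inE => /subsetP->//.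
    by rewrite in_row.
  have sX : X \subset (k, b) |: X by apply: subsetUr.
  suff : pr ((k, b) |: X) by move/maxX; rewrite cardsU1 kb /= add1n ltnn.
  rewrite /pr g (subset_trans UX sX) /=; apply/forallP => k'.
  have [->|kk'] := eqVneq k' k.
    apply/orP; right; apply: subset_trans (Csub _ _ sX); move: kK; rewrite inE.
    by apply: subset_trans; apply: col_row_sub.
  have -> : row ((k, b) |: X) k' = row X k'.
    by apply/setP => y; rewrite !in_row in_setU1 xpair_eqE (negPf kk').
  case/orP: (invX k') => [->//|h]; apply/orP; right; exact: subset_trans h (Csub _ _ sX).
have /set0Pn[j _] := tU i.
have [j0 _ sink] := min_reach (step X V) j.
have : j0 \in C X by rewrite CT inE.
rewrite inE => /existsP[k /andP[kD /exists_inP[u ku j0u]]].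
(* Rows of [X] meeting the sink [Z] contain their [V]-row, because each [V]-edge there leads to a
   vertex that walks back. *)
pose Z := [set y | connect (step X V) j0 y].
pose N := [set l | [exists r in Z, (l, r) \in X]].
have kN : k \in N.
  by rewrite inE; apply/exists_inP; exists u; rewrite -?in_row // inE.
have VX l r : l \in N -> (l, r) \in V -> (l, r) \in X.
  rewrite inE => /exists_inP[z zZ lz] lr.
  apply: (alternating_walk (good_compat gX gV) lz lr).
  have j0z : connect (step X V) j0 z by move: zZ; rewrite inE.
  have zr : step X V z r by apply/stepP; exists l.
  by apply: connect_trans (sink _ (connect_trans j0z (connect1 zr))) j0z.
have [iN|iN] := boolP (i \in N).
  exists (U :|: [set p in V | p.1 == i]); split.
  - apply: good_sub gX; rewrite subUset UX; apply/subsetP => -[x y].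
    by rewrite inE => /andP[h /eqP /= e]; apply: VX => //; rewrite e.
  - by apply/setP => y; rewrite !inE eqxx andbT.
  - by move=> l li; left; apply/setP => y; rewrite !inE /= (negPf li) andbF orbF.
(* The sink misses row [i]: exchange [U] for [V] on [N], which removes at least row [k] from the
   disagreement, and recurse. *)
pose U' := [set p | if p.1 \in N then p \in V else p \in U].
have rowU' l : row U' l = if l \in N then row V l else row U l.
  by apply/setP => y; rewrite in_row inE /=; case: ifP; rewrite in_row.
have gU' : good M U'.
  apply: good_sub gX; apply/subsetP => -[x y]; rewrite inE /=; case: ifP => [xN|_].
    exact: VX.
  exact: (subsetP UX).
have [||W [gW eW hW]] := IHn U' _ gU' gV _ tV.
- rewrite -ltnS; apply: leq_trans le; rewrite ltnS; apply: proper_card; apply/properP; split.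
    by apply/subsetP => l; rewrite !inE rowU'; case: ifP; rewrite ?eqxx.
  by exists k; rewrite !inE // rowU' kN eqxx.
- by move=> l; rewrite rowU'; case: ifP.
exists W; split=> //; first by rewrite eW rowU' (negPf iN).
by move=> l li; case: (hW _ li) => ->; rewrite ?rowU'; [case: ifP; auto | right].
Qed.

(** Extension with [K] the empty rows and [B] everything adds a first edge to an empty row and
    touches no other row. This makes a matching part of a type; [r0] ensures that [B] is
    nonempty. *)
Lemma good_complete F (r0 : R) : good M F ->
  exists X, [/\ F \subset X, good M X, forall l, row X l != set0 &
    forall l, l \in dom F -> row X l = row F l].
Proof.
have [n] := ubnP #|~: dom F|; elim: n F => // n IHn F le gF.
have [d0|d0] := eqVneq (~: dom F) set0.
  exists F; split=> // l; have : l \in dom F by rewrite -[dom F]setCK d0 setC0 inE.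
  by case/domP => r lr; apply/set0Pn; exists r; rewrite in_row.
case: (@ensemble_extends _ _ _ eM setT setT F (~: dom F) setT) => //.
- by apply/withinP => *; rewrite !inE.
- by apply/set0Pn; exists r0.
- by move=> l r lr; rewrite !inE (mem_dom lr).
move=> k [b [kF _ g]]; move: kF; rewrite inE => kF.
have [|X [sX gX tX rX]] := IHn _ _ g.
  rewrite -ltnS; apply: leq_trans le; rewrite ltnS domU1; apply: proper_card.
  by rewrite properE !setCS -properE; apply: properUr; rewrite sub1set.
exists X; split=> //; first exact: subset_trans (subsetUr _ _) sX.
move=> l lF; rewrite rX; last by rewrite domU1 in_setU1 lF orbT.
apply/setP => y; rewrite !in_row in_setU1 xpair_eqE.
by have -> : (l == k) = false by apply: contraNF kF => /eqP <-.
Qed.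

End Elimination.

(** * Tropical oriented matroids as families of graphs *)

Section Tom.
Variables L R : finType.
Implicit Types (F G H N P U V W X : {set L * R}) (I K S : {set L}) (J B : {set R})
  (TT : {set {set L * R}}).

(** Types are graphs and the ground sets are subsets of fixed types, so minors are structures of the
    same kind and inductions can pass to them. *)
Record tom I J TT : Prop := Tom {
  tom_type : forall G, G \in TT -> G \subset setX I J /\ forall l, l \in I -> row G l != set0;
  tom_star : forall j, j \in J -> setX I [set j] \in TT;
  tom_sub : forall G H, G \in TT -> H \subset G ->
    (forall l, l \in I -> row H l != set0) -> H \in TT;
  tom_compat : forall U V, U \in TT -> V \in TT -> compat U V;
  tom_elim : forall U V i, U \in TT -> V \in TT -> i \in I ->
    exists W, [/\ W \in TT, row W i = row U i :|: row V i &
      forall l, l \in I -> l != i -> row W l = row U l \/ row W l = row V l] }.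

Definition tminor TT I J :=
  [set G :&: setX I J | G in TT & [forall l in I, row (G :&: setX I J) l != set0]].

Lemma row_setX G I J l : row (G :&: setX I J) l = if l \in I then row G l :&: J else set0.
Proof.
apply/setP => r; rewrite in_row !inE /=; case: ifP => lI; last by rewrite andbF inE.
by rewrite !inE.
Qed.

Lemma tminorP TT I J H :
  reflect (exists2 G, G \in TT & H = G :&: setX I J /\ forall l, l \in I -> row H l != set0)
    (H \in tminor TT I J).
Proof.
apply: (iffP imsetP) => [[G]|[G GT [-> h]]].
  by rewrite inE => /andP[GT /forall_inP h] ->; exists G.
by exists G => //; rewrite inE GT; apply/forall_inP.
Qed.

Lemma tminor_tom I J I' J' TT :
  tom I J TT -> I' \subset I -> J' \subset J -> tom I' J' (tminor TT I' J').
Proof.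
move=> tT sI sJ; split.
- by move=> G /tminorP[G0 _ [-> h]]; split=> //; apply: subsetIr.
- move=> j jJ; apply/tminorP; exists (setX I [set j]).
    by apply: (tom_star tT); apply: (subsetP sJ).
  split.
    apply/setP => -[x y]; rewrite in_setI !in_setX !in_set1; have [->|] := eqVneq y j.
      by rewrite jJ !andbT; apply/idP/andP => [xI|[]//]; rewrite xI (subsetP sI).
    by rewrite !andbF.
  by move=> l lI; apply/set0Pn; exists j; rewrite in_row !inE /= lI eqxx.
- move=> G H /tminorP[G0 G0T [eG hG]] sH hH.
  have sHX : H \subset setX I' J' by apply: subset_trans sH _; rewrite eG subsetIr.
  (* [H] has no edges outside [I']; the rows of [G0] there complete it to a type. *)
  apply/tminorP; exists (H :|: [set p in G0 | p.1 \notin I']).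
    apply: (tom_sub tT G0T).
      rewrite subUset; apply/andP; split; last by apply/subsetP => p; rewrite inE => /andP[].
      by apply: subset_trans sH _; rewrite eG subsetIl.
    move=> l lI; have [lI'|lI'] := boolP (l \in I').
      have /set0Pn[r] := hH _ lI'; rewrite in_row => lr; apply/set0Pn; exists r.
      by rewrite in_row inE lr.
    have [_ /(_ _ lI)/set0Pn[r]] := tom_type tT G0T; rewrite in_row => lr.
    by apply/set0Pn; exists r; rewrite in_row !inE lr /= lI' orbT.
  split=> //; apply/setP => -[x y]; rewrite !inE /=.
  have [xy|xy] := boolP ((x, y) \in H); last first.
    by case: (x \in I'); rewrite ?andbF.
  by move: (subsetP sHX _ xy); rewrite in_setX => ->.
- move=> U V /tminorP[U0 h [-> _]] /tminorP[V0 h' [-> _]].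
  by apply: compat_sub (tom_compat tT h h'); apply: subsetIl.
move=> U V i /tminorP[U0 hU0 [eU hU]] /tminorP[V0 hV0 [eV hV]] iI.
have [W [WT eW hW]] := tom_elim tT hU0 hV0 (subsetP sI _ iI).
have rowWi : row (W :&: setX I' J') i = row U i :|: row V i.
  by rewrite eU eV !row_setX iI eW setIUl.
have rowW l : l \in I' -> l != i ->
    row (W :&: setX I' J') l = row U l \/ row (W :&: setX I' J') l = row V l.
  move=> lI li; rewrite eU eV !row_setX lI.
  by case: (hW _ (subsetP sI _ lI) li) => ->; auto.
exists (W :&: setX I' J'); split=> //.
apply/tminorP; exists W => //; split=> // l lI.
have [->|li] := eqVneq l i; last by case: (rowW _ lI li) => ->; auto.
by rewrite rowWi setU_eq0 negb_and hU.
Qed.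

Definition maximal I J TT := forall G, G \subset setX I J ->
  (forall l, l \in I -> row G l != set0) -> (forall V, V \in TT -> compat G V) -> G \in TT.

Definition textends I J TT := forall F K B, F \in TT -> K \subset I -> B \subset J ->
  K != set0 -> B != set0 -> (forall l r, (l, r) \in F -> (l \in K) = (r \notin B)) ->
  exists k b, [/\ k \in K, b \in B & (k, b) |: F \in TT].

(* Maximality of the minor on I \ K and B gives a type V inside B that agrees
   with F outside K; eliminating between F and V yields the edge. *)
Lemma tom_extends I J TT :
  (forall I' J' TT', J' != set0 -> #|J'| < #|J| -> tom I' J' TT' -> maximal I' J' TT') ->
  tom I J TT -> textends I J TT.
Proof.
move=> IH tT F K B FT sK sB K0 B0 sep.
have [sF hF] := tom_type tT FT; have sFP := withinP _ _ _ sF.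
(* Rows of [F] in [K] are nonempty and avoid [B], so the minor has fewer right vertices, as the
   induction requires. *)
have BJ : #|B| < #|J|.
  apply: proper_card; apply/properP; split=> //.
  have /set0Pn[k kK] := K0; have /set0Pn[r] := hF _ (subsetP sK _ kK).
  rewrite in_row => kr; exists r; first by case: (sFP _ _ kr).
  by rewrite -(sep _ _ kr).
have t1 := tminor_tom tT (subxx I) sB.
have t2 := tminor_tom t1 (subsetDl I K) (subxx B).
have rowF l : l \in I :\: K -> row F l \subset B.
  rewrite inE => /andP[lK lI]; apply/subsetP => r; rewrite in_row => /sep.
  by rewrite (negPf lK) => /esym/negbFE.
have /tminorP[V VT1 [eV _]] : F :&: setX (I :\: K) B \in tminor (tminor TT I B) (I :\: K) B.
  apply: (IH _ _ _ B0 BJ t2); first exact: subsetIr.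
    move=> l lI; rewrite row_setX lI (setIidPl (rowF _ lI)); apply: hF.
    by move: lI; rewrite inE => /andP[].
  move=> X /tminorP[X1 /tminorP[X0 X0T [-> _]] [-> _]].
  apply: compat_sub (tom_compat tT FT X0T); first exact: subsetIl.
  by apply: subset_trans (subsetIl _ _) (subsetIl _ _).
have [sV hV] := tom_type t1 VT1; have sVP := withinP _ _ _ sV.
have VT : V \in TT.
  have /tminorP[V0 V0T [eV0 _]] := VT1.
  by apply: (tom_sub tT V0T) => //; rewrite eV0 subsetIl.
have rowV l : l \in I :\: K -> row V l = row F l.
  move=> lI; have := congr1 (fun G => row G l) eV; rewrite /= !row_setX lI.
  rewrite (setIidPl (rowF _ lI)) => ->; apply/esym/setIidPl/subsetP => r.
  by rewrite in_row => /sVP[].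
(* For [S] = [K] this is [V]. With a smallest nonempty [S], eliminating between [F] and [mix S] at a
   row [i] of [S] leaves other differences from [F] only in [S :\ i]; by minimality there are none,
   and [W] contains [F] and an edge from [i] to [B]. *)
pose mix (S : {set L}) := [set p | if p.1 \in S then p \in V else p \in F].
have rowmix S l : row (mix S) l = if l \in S then row V l else row F l.
  by apply/setP => r; rewrite in_row inE /=; case: ifP; rewrite in_row.
pose pr (S : {set L}) := [&& S \subset K, S != set0 & mix S \in TT].
have prK : pr K.
  rewrite /pr subxx K0; suff -> : mix K = V by [].
  apply/setP => -[x y]; rewrite inE /=; case: ifP => // xK.
  have [xI|xI] := boolP (x \in I); first by rewrite -!in_row rowV // inE xK.
  by apply/idP/idP => [/sFP[]|/sVP[]]; rewrite (negPf xI).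
case: (arg_minnP (fun S : {set L} => #|S|) prK) => S /and3P[SK S0 ST] minS.
have /set0Pn[i iS] := S0; have iK := subsetP SK _ iS; have iI := subsetP sK _ iK.
have [W [WT eW hW]] := tom_elim tT FT ST iI.
pose S1 := [set l in S :\ i | row W l != row F l].
have rowW l : l \in I -> l != i -> l \notin S1 -> row W l = row F l.
  move=> lI li; rewrite !inE li /= negb_and negbK => h.
  by case/orP: h => [lS|/eqP//]; case: (hW _ lI li); rewrite ?rowmix ?(negPf lS).
have FW l : l \in I -> l \notin S1 -> row F l \subset row W l.
  move=> lI lS1; have [->|li] := eqVneq l i; last by rewrite rowW.
  by rewrite eW subsetUl.
have [S10|S10] := eqVneq S1 set0.
  have /set0Pn[b bV] := hV _ iI.
  have bB : b \in B by move: bV; rewrite in_row => /sVP[].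
  exists i, b; split=> //; apply: (tom_sub tT WT).
    apply/subsetP => -[x y]; rewrite in_setU1 => /orP[/eqP[-> ->]|xy].
      by rewrite -in_row eW rowmix iS inE bV orbT.
    by have [xI _] := sFP _ _ xy; rewrite -in_row (subsetP (FW _ xI _)) ?S10 ?inE.
  move=> l /hF/set0Pn[r]; rewrite in_row => lr; apply/set0Pn; exists r.
  by rewrite in_row in_setU1 lr orbT.
have S1S : S1 \subset S by apply/subsetP => x; rewrite !inE => /andP[/andP[]].
suff : pr S1.
  move/minS; rewrite leqNgt; case/negP; apply: proper_card; apply/properP; split=> //.
  by exists i => //; rewrite !inE eqxx.
rewrite /pr S10 (subset_trans S1S SK) /=; apply: (tom_sub tT WT).
  apply/subsetP => -[x y]; rewrite -in_row rowmix; case: ifP => xS1; last first.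
    rewrite in_row => xy; have [xI _] := sFP _ _ xy.
    by rewrite -in_row (subsetP (FW _ xI _)) ?xS1 ?in_row.
  have xS := subsetP S1S _ xS1; have xI := subsetP sK _ (subsetP SK _ xS).
  move: xS1; rewrite !inE => /andP[/andP[xi _] ne].
  case: (hW _ xI xi) => e; first by rewrite e eqxx in ne.
  by rewrite -(in_row W) e rowmix xS in_row.
by move=> l lI; rewrite rowmix; case: ifP; auto.
Qed.

(** Topes are graphs of functions, with [cnt] as their position. *)
Definition gr (t : L -> R) I := [set p : L * R | (p.1 \in I) && (p.2 == t p.1)].
Definition cnt (t : L -> R) I x := #|[set l in I | t l == x]|.
Definition upd (t : L -> R) k b l := if l == k then b else t l.

Lemma in_gr t I l r : ((l, r) \in gr t I) = (l \in I) && (r == t l).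
Proof. by rewrite inE. Qed.

(** Moving one unit from [t k] to [b] is an equation of sums, which avoids truncated subtraction and
    covers [b] = [t k]. *)
Lemma cnt_upd t I k b x : k \in I -> cnt (upd t k b) I x + (x == t k) = cnt t I x + (x == b).
Proof.
move=> kI; rewrite /cnt (cardsD1 k) [in RHS](cardsD1 k) !inE kI /upd eqxx /=.
have -> : [set l in I | (if l == k then b else t l) == x] :\ k = [set l in I | t l == x] :\ k.
  by apply/setP => l; rewrite !inE; case: (l == k).
rewrite [b == x]eq_sym [t k == x]eq_sym; rewrite addnAC [RHS]addnAC; congr (_ + _); apply: addnC.
Qed.

(** * Growing a tope along the extension property *)

Section Growth.
Variables (I : {set L}) (J : {set R}) (TT : {set {set L * R}}).
Hypotheses (tT : tom I J TT) (ext : textends I J TT).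
Variable t : L -> R.
Hypothesis tTT : gr t I \in TT.

Let tJ l : l \in I -> t l \in J.
Proof.
by move=> lI; have [/withinP h _] := tom_type tT tTT; have [] := h l (t l); rewrite // in_gr lI /=.
Qed.

Lemma gr_sub s F : F \in TT -> gr s I \subset F -> gr s I \in TT.
Proof.
move=> FT s'; apply: (tom_sub tT FT s') => l lI.
by apply/set0Pn; exists (s l); rewrite in_row in_gr lI eqxx.
Qed.

Lemma gr_upd s F k b : gr s I \subset F -> gr (upd s k b) I \subset (k, b) |: F.
Proof.
move=> s'; apply/subsetP => -[x y]; rewrite in_gr in_setU1 /upd => /andP[xI].
case: (x =P k) => [->|_] /eqP->; first by rewrite eqxx.
by rewrite (subsetP s') ?orbT // in_gr xI /=.
Qed.


Lemma row_gr_eq s l x : (l, x) \in gr s I -> x = s l.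
Proof. by rewrite in_gr => /andP[_ /eqP]. Qed.

(* B is the set of right vertices b for which F already contains a tope s_b whose
   position is that of t with one unit moved from b to r. *)
Lemma grow_backward r : r \in J -> exists F, [/\ F \in TT, forall l, #|row F l| <= 2 &
  forall k, (k == r) || (0 < cnt t I k) -> exists s, [/\ gr s I \subset F, gr s I \in TT &
    forall x, cnt s I x + (x == k) = cnt t I x + (x == r)]].
Proof.
move=> rJ.
suff H : forall m (B : {set R}) (F : {set L * R}), #|J :\: B| < m -> r \in B -> B \subset J ->
  F \in TT -> (forall l, #|row F l| <= 2) ->
  (forall l x, (l, x) \in F -> (t l \notin B) = (x \notin B)) ->
  (forall l, l \in I -> t l \notin B -> row F l = [set t l]) ->
  (forall b, b \in B -> exists s, [/\ gr s I \subset F,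
    forall l, l \in I -> t l \notin B -> s l = t l &
    forall x, cnt s I x + (x == b) = cnt t I x + (x == r)]) ->
  exists F, [/\ F \in TT, forall l, #|row F l| <= 2 &
  forall k, (k == r) || (0 < cnt t I k) -> exists s, [/\ gr s I \subset F, gr s I \in TT &
    forall x, cnt s I x + (x == k) = cnt t I x + (x == r)]].
  have rowt l : l \in I -> row (gr t I) l = [set t l].
    by move=> lI; apply/setP => y; rewrite in_row in_gr lI inE.
  apply: (H #|J :\: [set r]|.+1 [set r] (gr t I)) => //; rewrite ?inE ?sub1set //.
  - move=> l; have [lI|lI] := boolP (l \in I); first by rewrite rowt // cards1.
    rewrite (_ : row _ _ = set0) ?cards0 //.
    by apply/setP => y; rewrite in_row in_gr (negPf lI) inE.
  - by move=> l x /row_gr_eq->.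
  - by move=> l lI _; apply: rowt.
  by move=> b; rewrite inE => /eqP->; exists t.
elim=> // m IH B F lm rB BJ FT F2 sep out S.
have [/existsP[l0 /andP[l0I l0B]]|stop] := boolP [exists l, (l \in I) && (t l \notin B)]; last first.
  exists F; split=> // k hk; have kB : k \in B.
    case/orP: hk => [/eqP->//|]; rewrite card_gt0 => /set0Pn[l].
    rewrite inE => /andP[lI /eqP <-]; apply: contraT => h.
    by case/existsP: stop; exists l; rewrite lI.
  by have [s [sF _ e]] := S _ kB; exists s; split=> //; apply: gr_sub sF.
have [sF _] := tom_type tT FT; have sFP := withinP _ _ _ sF.
have [i [b [iK bB F'T]]] : exists k b, [/\ k \in [set l in I | t l \notin B], b \in B & (k, b) |: F \in TT].
  apply: ext => //.
  - by apply/subsetP => l; rewrite inE => /andP[].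
  - by apply/set0Pn; exists l0; rewrite inE l0I.
  - by apply/set0Pn; exists r.
  by move=> l x lx; rewrite inE (sep _ _ lx); have [-> _] := sFP _ _ lx.
move: iK; rewrite inE => /andP[iI iB].
have rowF' l : l != i -> row ((i, b) |: F) l = row F l.
  by move=> li; apply/setP => y; rewrite !in_row in_setU1 xpair_eqE (negPf li).
apply: (IH (t i |: B) ((i, b) |: F)) => //.
- rewrite -ltnS; apply: leq_trans lm; rewrite ltnS; apply: proper_card.
  apply/properP; split; first by apply: setDS; apply: subsetUr.
  by exists (t i); rewrite !in_setD ?iB ?tJ // in_setU1 eqxx.
- by rewrite in_setU1 rB orbT.
- by rewrite subUset sub1set tJ.
- move=> l; have [->|li] := eqVneq l i; last by rewrite rowF'.
  apply: (@leq_trans #|[set t i; b]|); last by rewrite cards2; case: (_ == _).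
  apply: subset_leq_card; apply/subsetP => y.
  rewrite in_set2 in_row in_setU1 xpair_eqE eqxx /= => /orP[->|]; first by rewrite orbT.
  by rewrite -in_row out // inE => ->.
- move=> l x /setU1P[[-> ->]|lx].
    by rewrite !in_setU1 eqxx bB orbT.
  rewrite !in_setU1; have e := sep _ _ lx; have [xB|xB] := boolP (x \in B).
    by move: e; rewrite xB => /negbFE->; rewrite !orbT.
  move: e; rewrite xB => tB; have [lI _] := sFP _ _ lx.
  move: lx; rewrite -in_row out // inE => /eqP->.
  by rewrite (negPf tB).
- move=> l lI; rewrite in_setU1 negb_or => /andP[ne lB].
  by rewrite rowF' ?out //; apply: contra ne => /eqP->.
move=> b'; rewrite in_setU1 => /orP[/eqP->|b'B]; last first.
  have [s [s1 s2 s3]] := S _ b'B; exists s; split=> //.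
    by apply: subset_trans s1 (subsetUr _ _).
  by move=> l lI; rewrite in_setU1 negb_or => /andP[_]; apply: s2.
(* Rerouting [i] to [b] in the tope for [b] restores the unit missing at [b] and takes one from
   [t i] instead. *)
have [s [s1 s2 s3]] := S _ bB; exists (upd s i b); split; first exact: gr_upd.
  move=> l lI; rewrite in_setU1 negb_or => /andP[ne lB].
  by rewrite /upd ifN ?s2 //; apply: contra ne => /eqP->.
by move=> x; rewrite -s3 -(s2 _ iI iB) cnt_upd.
Qed.

(* As above, with C the set of right vertices reached by moving one unit from j0. *)
Lemma grow_forward j0 : 0 < cnt t I j0 -> exists F, [/\ F \in TT,
  forall x, #|col F x| <= cnt t I x + (x != j0) &
  forall b, b \in J -> exists s, [/\ gr s I \subset F, gr s I \in TT,
    forall x, cnt s I x + (x == j0) = cnt t I x + (x == b) &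
    forall l, l \in I -> t l = b -> s l = b]].
Proof.
move=> j0t.
suff H : forall m (C : {set R}) (F : {set L * R}), #|J :\: C| < m -> j0 \in C ->
  F \in TT -> (forall x, #|col F x| <= cnt t I x + (x != j0)) ->
  (forall l x, (l, x) \in F -> (t l \in C) = (x \in C)) ->
  (forall l x, (l, x) \in F -> x \notin C -> x = t l) ->
  (forall c, c \in C -> exists s, [/\ gr s I \subset F,
    forall l, l \in I -> (t l == c) || (t l \notin C) -> s l = t l &
    forall x, cnt s I x + (x == j0) = cnt t I x + (x == c)]) ->
  exists F, [/\ F \in TT,
  forall x, #|col F x| <= cnt t I x + (x != j0) &
  forall b, b \in J -> exists s, [/\ gr s I \subset F, gr s I \in TT,
    forall x, cnt s I x + (x == j0) = cnt t I x + (x == b) &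
    forall l, l \in I -> t l = b -> s l = b]].
  apply: (H #|J :\: [set j0]|.+1 [set j0] (gr t I)) => //; rewrite ?inE //.
  - move=> x; rewrite (_ : col _ _ = [set l in I | t l == x]) ?leq_addr //.
    by apply/setP => l; rewrite in_col in_gr inE [x == _]eq_sym.
  - by move=> l x /row_gr_eq->.
  - by move=> l x /row_gr_eq.
  by move=> b; rewrite inE => /eqP->; exists t.
elim=> // m IH C F lm j0C FT Fc sep out S.
have [JC|JC] := eqVneq (J :\: C) set0.
  exists F; split=> // b bJ.
  have bC : b \in C by apply: contraT => h; have := in_set0 b; rewrite -JC in_setD h bJ.
  have [s [sF h e]] := S _ bC; exists s; split=> //; first exact: gr_sub sF.
  by move=> l lI e'; rewrite h // e' eqxx.
have [sF _] := tom_type tT FT; have sFP := withinP _ _ _ sF.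
have [i [b [iK bB F'T]]] : exists k b, [/\ k \in [set l in I | t l \in C], b \in J :\: C & (k, b) |: F \in TT].
  apply: ext => //.
  - by apply/subsetP => l; rewrite inE => /andP[].
  - exact: subsetDl.
  - move: j0t; rewrite card_gt0 => /set0Pn[l]; rewrite inE => /andP[lI /eqP e].
    by apply/set0Pn; exists l; rewrite inE lI e.
  move=> l x lx; rewrite inE (sep _ _ lx) in_setD; have [-> ->] := sFP _ _ lx.
  by rewrite andbT negbK.
move: iK; rewrite inE => /andP[iI iC]; move: bB; rewrite inE => /andP[bC bJ].
have ti : t i != b by apply: contra bC => /eqP<-.
apply: (IH (b |: C) ((i, b) |: F)) => //.
- rewrite -ltnS; apply: leq_trans lm; rewrite ltnS; apply: proper_card.
  apply/properP; split; first by apply: setDS; apply: subsetUr.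
  by exists b; rewrite !in_setD ?bC // in_setU1 eqxx.
- by rewrite in_setU1 j0C orbT.
(* Only column [b] changes; so far it held only edges of [t], it gains at most one, and [b] is not
   [j0]. *)
- move=> x; have [->|xb] := eqVneq x b; last first.
    apply: leq_trans (Fc x); rewrite (_ : col _ _ = col F x) //.
    by apply/setP => l; rewrite !in_col in_setU1 xpair_eqE (negPf xb) andbF.
  have -> : (b != j0) = 1 :> nat by rewrite (_ : b != j0) //; apply: contra bC => /eqP->.
  rewrite addn1; apply: (@leq_trans #|i |: [set l in I | t l == b]|); last first.
    by rewrite cardsU1; case: (_ \notin _).
  apply: subset_leq_card; apply/subsetP => l.
  rewrite in_col !in_setU1 xpair_eqE eqxx andbT => /orP[->//|lb].
  by have [lI _] := sFP _ _ lb; rewrite inE lI -(out _ _ lb) // eqxx orbT.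
- move=> l x /setU1P[[-> ->]|lx].
    by rewrite !in_setU1 eqxx iC orbT.
  rewrite !in_setU1; have [xC|xC] := boolP (x \in C).
    by rewrite (sep _ _ lx) xC !orbT.
  by rewrite -(out _ _ lx xC) (negPf xC).
- move=> l x /setU1P[[-> ->]|lx]; first by rewrite in_setU1 eqxx.
  by rewrite in_setU1 negb_or => /andP[_]; apply: out.
move=> b'; rewrite in_setU1 => /orP[/eqP->|b'C]; last first.
  have [s [s1 s2 s3]] := S _ b'C; exists s; split=> //.
    by apply: subset_trans s1 (subsetUr _ _).
  by move=> l lI h; apply: s2 => //; case/orP: h => [->//|]; rewrite in_setU1 negb_or orbC => /andP[_ ->].
have [s [s1 s2 s3]] := S _ iC; exists (upd s i b); split; first exact: gr_upd.
  move=> l lI h; rewrite /upd; have [li|li] := eqVneq l i.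
    by move: h; rewrite li in_setU1 (negPf ti) iC.
  apply: s2 => //; case/orP: h => [/eqP->|]; first by rewrite bC orbT.
  by rewrite in_setU1 negb_or => /andP[_ ->]; rewrite orbT.
move=> x; have si : s i = t i by rewrite s2 ?eqxx.
have h1 := s3 x; have h2 := cnt_upd s b x iI; rewrite si in h2.
apply/(@addIn (x == t i)); rewrite addnAC h2 addnAC h1; apply: addnAC.
Qed.

End Growth.
End Tom.

(** * Positions of topes and maximality *)

Section Positions.
Variables L R : finType.
Implicit Types (F G H : {set L * R}) (I : {set L}) (J : {set R}) (TT : {set {set L * R}})
  (s t : L -> R).

(* On a minimal closed class of the relation s(l) -> t(l), an alternating walk
   through l forces s(l) = t(l). *)
Lemma gr_inj I s t : compat (gr s I) (gr t I) -> (forall x, cnt s I x = cnt t I x) ->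
  forall l, l \in I -> s l = t l.
Proof.
move=> c e l0 l0I; apply/eqP; apply: contraT => ne0.
pose D := [set l in I | s l != t l].
have sub (u : L -> R) : gr u D \subset gr u I.
  by apply/subsetP => -[x y]; rewrite !in_gr inE => /andP[/andP[-> _]].
have split (u : L -> R) x : cnt u I x = cnt u D x + #|[set l in I :\: D | u l == x]|.
  rewrite /cnt -(cardsID D [set l in I | u l == x]); congr (_ + _); apply: eq_card => l.
    by rewrite !inE; case: (l \in I) => //=; rewrite andbC.
  by rewrite !inE andbA.
have eD x : cnt s D x = cnt t D x.
  have := e x; rewrite !split; rewrite (_ : [set l in I :\: D | s l == x] = [set l in I :\: D | t l == x]).
    by move/addIn.
  by apply/setP => l; rewrite !inE; case: (l \in I); rewrite ?andbF //= andbT negbK; case: eqP => //= ->.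
have [j0 cj0 min] := min_reach (step (gr s D) (gr t D)) (s l0).
have l0D : l0 \in D by rewrite inE l0I.
have : 0 < cnt s D j0.
  case/connectP: cj0 => p; case/lastP: p => [|p y] /=.
    by move=> _ ->; rewrite card_gt0; apply/set0Pn; exists l0; rewrite in_set l0D eqxx.
  rewrite last_rcons rcons_path => /andP[_ /stepP[l _ lt]] ->; rewrite eD card_gt0.
  by apply/set0Pn; exists l; move: lt; rewrite in_gr in_set => /andP[-> /eqP->] /=.
rewrite card_gt0 => /set0Pn[l1]; rewrite in_set => /andP[l1D /eqP e1].
have l1s : (l1, j0) \in gr s D by rewrite in_gr l1D e1 eqxx.
have l1t : (l1, t l1) \in gr t D by rewrite in_gr l1D eqxx.
have cD : compat (gr s D) (gr t D) by apply: compat_sub c.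
have j0t : step (gr s D) (gr t D) j0 (t l1) by apply/stepP; exists l1.
have := alternating_walk cD l1s l1t (min _ (connect1 j0t)).
by rewrite in_gr eq_sym; move: l1D; rewrite inE => /andP[_ /negPf->]; rewrite andbF.
Qed.

Lemma sum_cnt t I : \sum_x cnt t I x = #|I|.
Proof.
rewrite -sum1_card (partition_big t predT) //=; apply: eq_bigr => x _.
by rewrite /cnt -sum1_card; apply: eq_bigl => l; rewrite inE.
Qed.

Lemma exists_lt_sum (u v : R -> nat) : \sum_x u x = \sum_x v x ->
  (forall x, u x = v x) \/ exists x, u x < v x.
Proof.
move=> e; have [/existsP h|h] := boolP [exists x, u x < v x]; [by right|left].
have le x : v x <= u x by rewrite leqNgt; apply: contra h => h; apply/existsP; exists x.
have le' := leqif_sum (fun x (_ : predT x) => leqif_eq (le x)).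
move: (le'.2); rewrite e eqxx => /esym/forallP h' x.
by have /eqP-> := h' x.
Qed.

(** Start from a constant tope and move units from overfull to underfull places; each move lowers
    the total deficit. *)
Lemma tope_of_position I J TT (v : R -> nat) : tom I J TT -> textends I J TT -> J != set0 ->
  \sum_x v x = #|I| -> (forall x, 0 < v x -> x \in J) ->
  exists t, gr t I \in TT /\ forall x, cnt t I x = v x.
Proof.
move=> tT ext /set0Pn[j jJ] vI vJ.
suff H : forall m t, gr t I \in TT -> \sum_x (v x - cnt t I x) < m ->
    exists t, gr t I \in TT /\ forall x, cnt t I x = v x.
  have h : gr (fun=> j) I \in TT.
    have -> : gr (fun=> j) I = setX I [set j]; last exact: (tom_star tT).
    by apply/setP => -[x y]; rewrite in_gr in_setX inE.
  by have := H _ _ h (ltnSn _).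
elim=> // m IH t tTT lm.
have es : \sum_x cnt t I x = \sum_x v x by rewrite sum_cnt vI.
have [e|[r rv]] := exists_lt_sum es; first by exists t.
have [e|[k kv]] := exists_lt_sum (esym es); first by rewrite e ltnn in rv.
have [F [_ _ S]] := grow_backward tT ext tTT (vJ _ (leq_ltn_trans (leq0n _) rv)).
have [|s [_ sT e]] := S k; first by rewrite (leq_ltn_trans (leq0n _) kv) orbT.
have rk : r != k by apply: contraTneq rv => ->; rewrite -leqNgt ltnW.
apply: (IH s sT); rewrite -ltnS; apply: leq_trans lm; rewrite ltnS.
rewrite (bigD1 r) // [in leqRHS](bigD1 r) //= -addSn; apply: leq_add.
  have := e r; rewrite eqxx (negPf rk) addn0 addn1 => ->; move: rv; clear; lia.
apply: leq_sum => x xr; have := e x; rewrite (negPf xr) addn0.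
have [->|_] := eqVneq x k; last by rewrite addn0 => ->.
by rewrite addn1 => h; move: kv; rewrite -h ltnS -subn_eq0 => /eqP->.
Qed.

(** Maximality for smaller [J] gives extension, which in turn gives maximality. A graph with one
    edge per row equals the tope of its position, by compatibility. A graph with a larger row [l] is
    the only possible elimination at [l] of two smaller ones that differ only there. *)
Lemma tom_maximal I J TT : tom I J TT -> J != set0 -> maximal I J TT /\ textends I J TT.
Proof.
have [m] := ubnP #|J|; elim: m I J TT => // m IH I J TT lm tT J0.
have ext : textends I J TT.
  apply: tom_extends tT => I' J' TT' J'0 lt tT'.
  by case: (IH I' J' TT') => //; apply: leq_trans lt _.
split=> // G sG rG cG.
suff H : forall p H, #|H| < p -> H \subset G -> (forall l, l \in I -> row H l != set0) -> H \in TT.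
  exact: (H #|G|.+1).
elim=> // p IHp H lp sH rH.
have sHP := withinP _ _ _ (subset_trans sH sG).
have [/exists_inP[l lI l2]|small] := boolP [exists l in I, 1 < #|row H l|]; last first.
  have /set0Pn[r0 _] := J0; pose t l := odflt r0 [pick r in row H l].
  have tH l : l \in I -> row H l = [set t l].
    move=> lI; have /cards1P[x ex] : #|row H l| == 1.
      rewrite eqn_leq card_gt0 rH // andbT leqNgt; apply: contra small => h.
      by apply/exists_inP; exists l.
    rewrite ex /t; case: pickP => [y|/(_ x)]; rewrite ex inE ?eqxx //.
    by move/eqP->.
  have eH : H = gr t I.
    apply/setP => -[x y]; rewrite in_gr -in_row; have [xI|xI] := boolP (x \in I).
      by rewrite tH // inE.
    by rewrite in_row; apply: contraNF xI => /sHP[].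
  have [||s [sT es]] := tope_of_position (v := cnt t I) tT ext J0; first exact: sum_cnt.
    move=> x; rewrite card_gt0 => /set0Pn[l]; rewrite inE => /andP[lI /eqP<-].
    by have [] := sHP l (t l); rewrite // -in_row tH // inE.
  have e : forall l, l \in I -> s l = t l.
    apply: gr_inj => //; apply: compat_sub (compatC (cG _ sT)); first exact: subxx.
    by rewrite -eH.
  rewrite eH (_ : gr t I = gr s I) //.
  by apply/setP => -[x y]; rewrite !in_gr; case: (boolP (x \in I)) => //= xI; rewrite e.
have [j jl] : exists j, (l, j) \in H.
  by have /set0Pn[j] := rH _ lI; rewrite in_row; exists j.
have [j' j'l jj'] : exists2 j', (l, j') \in H & j' != j.
  move: l2; rewrite (cardsD1 j) in_row jl ltnS card_gt0 => /set0Pn[j'].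
  by rewrite in_setD1 in_row => /andP[? ?]; exists j'.
pose H1 : {set L * R} := H :\ (l, j).
pose H2 := [set q in H | (q.1 == l) ==> (q.2 == j)].
have row1 l' : row H1 l' = if l' == l then row H l :\ j else row H l'.
  apply/setP => y; rewrite in_row in_setD1 xpair_eqE.
  have [->|ne] := eqVneq l' l; last by rewrite in_row.
  by rewrite in_setD1 in_row.
have row2 l' : row H2 l' = if l' == l then [set j] else row H l'.
  apply/setP => y; rewrite in_row inE /=.
  have [->|ne] := eqVneq l' l; last by rewrite in_row andbT.
  by rewrite inE; have [->|] := eqVneq y j; rewrite ?andbF // jl.
have T1 : H1 \in TT.
  apply: IHp; first by move: lp; rewrite (cardsD1 (l, j)) jl.
    exact: subset_trans (subsetDl _ _) sH.
  move=> l' l'I; rewrite row1; case: (l' =P l) => _; last exact: rH.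
  by apply/set0Pn; exists j'; rewrite in_setD1 jj' in_row.
have T2 : H2 \in TT.
  have s2 : H2 \subset H by apply/subsetP => q; rewrite inE => /andP[].
  apply: IHp; last 1 first.
  - move=> l' l'I; rewrite row2; case: (l' =P l) => _; last exact: rH.
    by apply/set0Pn; exists j; rewrite inE.
  - rewrite -ltnS; apply: leq_trans lp; rewrite ltnS; apply: proper_card.
    by apply/properP; split=> //; exists (l, j'); rewrite // inE /= eqxx (negPf jj') andbF.
  exact: subset_trans s2 sH.
have [W [WT eW hW]] := tom_elim tT T1 T2 lI.
have [/withinP sWP _] := tom_type tT WT.
suff -> : H = W by [].
apply/setP => -[x y]; have [xI|xI] := boolP (x \in I); last first.
  by apply/idP/idP => [/sHP[]|/sWP[]]; rewrite (negPf xI).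
rewrite -!in_row; have [->|xl] := eqVneq x l.
  rewrite eW row1 row2 eqxx; congr (y \in _); rewrite setUC setD1K //.
  by rewrite in_row.
by case: (hW _ xI xl) => ->; rewrite ?row1 ?row2 (negPf xl).
Qed.

End Positions.

(** * Linkage graphs are connected *)

Section Linkage.
Variables L R : finType.
Implicit Types (F G N : {set L * R}) (A I : {set L}) (B J : {set R}) (m : R -> {set L * R}).

Lemma card_resp N A B : matching N -> A \subset dom N -> B \subset cod N -> resp N A B ->
  #|A| = #|B|.
Proof.
move=> mN sA sB rs; rewrite -(card_pre mN sB); apply: eq_card => l.
apply/idP/preP => [lA|[r rB lr]]; last by rewrite (rs _ _ lr).
by have /domP[r lr] := subsetP sA _ lA; exists r; rewrite // -(rs _ _ lr).
Qed.

(* A cut (A, B) respected by F has |A| = |B \ b| for all b in J, hence B is empty or J. *)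
Lemma linkage F I J m : F \subset setX I J -> (forall l, #|row F l| <= 2) -> J != set0 ->
  (forall b, b \in J -> [/\ matching (m b), dom (m b) = I, cod (m b) = J :\ b & m b \subset F]) ->
  [/\ F = \bigcup_(b in J) m b, forall l, l \in I -> #|row F l| = 2 & conn F I J].
Proof.
move=> sF F2 J0 mP; have sFP := withinP _ _ _ sF; set U := \bigcup_(b in J) m b.
have sU : U \subset F by apply/bigcupsP => b /mP[].
(* If (l, r) is an edge of one matching, the matching for [r] misses [r] and gives [l] a second
   neighbour. *)
have rowU l : l \in I -> 1 < #|row U l|.
  have /set0Pn[b bJ] := J0; have [mb db _ _] := mP _ bJ; rewrite -db => /domP[r lr].
  have lI : l \in I by rewrite -db (mem_dom lr).
  have rJ : r \in J by have [] := sFP l r; rewrite // (subsetP sU) //; apply/bigcupP; exists b.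
  have [mr dr cr _] := mP _ rJ; have : l \in dom (m r) by rewrite dr.
  case/domP => r' lr'; have rr' : r' != r.
    by have := mem_cod lr'; rewrite cr in_setD1 => /andP[].
  apply: (@leq_trans #|[set r; r']|); first by rewrite cards2 eq_sym rr'.
  apply: subset_leq_card; apply/subsetP => x; rewrite in_set2 in_row => /orP[]/eqP->.
    by apply/bigcupP; exists b.
  by apply/bigcupP; exists r.
have rowS l : row U l \subset row F l.
  by apply/subsetP => r; rewrite !in_row; apply: subsetP.
split.
- apply/eqP; rewrite eq_sym eqEsubset sU; apply/subsetP => -[l r] lr.
  have [lI _] := sFP _ _ lr; have /eqP e : row U l == row F l.
    by rewrite eqEcard rowS; apply: leq_trans (F2 l) (rowU _ lI).
  by rewrite -in_row e in_row.
- move=> l lI; apply/eqP; rewrite eqn_leq F2.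
  by apply: leq_trans (rowU _ lI) (subset_leq_card (rowS l)).
move=> A B sA sB rs ne.
have cAB b : b \in J -> #|A| = #|B :\ b|.
  move=> bJ; have [mb db cb sb] := mP _ bJ; apply: card_resp mb _ _ _.
  - by rewrite db.
  - by rewrite cb; apply: setSD.
  move=> l r lr; rewrite in_setD1 (rs _ _ (subsetP sb _ lr)).
  by have := mem_cod lr; rewrite cb in_setD1 => /andP[->].
have cAB1 b : b \in B -> #|A|.+1 = #|B|.
  by move=> bB; rewrite (cAB b) ?(subsetP sB) // [RHS](cardsD1 b) bB.
have cAB0 b : b \in J -> b \notin B -> #|A| = #|B|.
  by move=> bJ bB; rewrite (cAB b) // [RHS](cardsD1 b) (negPf bB).
have /set0Pn[b bB] : B != set0.
  case/orP: ne => //; apply: contraNneq => B0; have /set0Pn[b bJ] := J0.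
  by rewrite -cards_eq0 (cAB0 b) // B0 ?cards0 // inE.
have BJ : B = J.
  apply/eqP; rewrite eqEsubset sB; apply/subsetP => b' b'J; apply: contraT => b'B.
  by have := cAB1 _ bB; rewrite (cAB0 _ b'J b'B) => /eqP; rewrite eqn_leq ltnn.
split=> //; apply/eqP; rewrite eqEcard sA.
have [mb db cb _] := mP _ (subsetP sB _ bB).
by rewrite -db card_dom // -(card_cod mb) cb -BJ -(cAB b) ?leqnn //; apply: (subsetP sB).
Qed.

Lemma gr_perfect (s : L -> R) I J : (forall x, cnt s I x = (x \in J)) ->
  [/\ matching (gr s I), dom (gr s I) = I & cod (gr s I) = J].
Proof.
move=> e; split.
- apply: matchingI => [l r r' /row_gr_eq-> /row_gr_eq->|l l' r] //.
  rewrite !in_gr => /andP[lI /eqP el] /andP[lI' /eqP el'].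
  have /card_le1_eqP h : #|[set l in I | s l == r]| <= 1 by rewrite [#|_|]e; case: (_ \in _).
  by apply: h; rewrite inE ?lI ?lI' -?el -?el' eqxx.
- apply/setP => l; apply/domP/idP => [[r]|lI]; first by rewrite in_gr => /andP[].
  by exists (s l); rewrite in_gr lI eqxx.
apply/setP => r; have := e r; rewrite /cnt; case: (boolP (r \in J)) => _ h.
  have : 0 < #|[set l in I | s l == r]| by rewrite h.
  rewrite card_gt0 => /set0Pn[l]; rewrite inE => /andP[lI /eqP sl].
  by apply/codP; exists l; rewrite in_gr lI sl eqxx.
apply/codP => -[l]; rewrite in_gr => /andP[lI /eqP rl].
by move/eqP: h; rewrite cards_eq0 => /eqP/setP/(_ l); rewrite !inE lI rl eqxx.
Qed.

End Linkage.

(** * Translation to types *)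

Section Translation.
Variables n d : nat.
Implicit Types (G N P U V : {set 'I_n * 'I_d}) (I : {set 'I_n}) (J : {set 'I_d}).

Lemma is_pmP N I J : is_pm N I J <-> [/\ matching N, dom N = I & cod N = J].
Proof.
split=> [[s [hI hJ]]|[mN <- <-]].
  have sP := withinP _ _ _ s.
  have rI l r r' : (l, r) \in N -> (l, r') \in N -> r = r'.
    move=> lr lr'; have [lI _] := sP _ _ lr.
    have /eqP/cards1P[x ex] := hI _ lI.
    have h y : (l, y) \in N -> y = x by rewrite -in_row /row ex inE => /eqP.
    by rewrite (h r) // (h r').
  have rJ l l' r : (l, r) \in N -> (l', r) \in N -> l = l'.
    move=> lr lr'; have [_ rJ] := sP _ _ lr.
    have /eqP/cards1P[x ex] := hJ _ rJ.
    have h y : (y, r) \in N -> y = x by rewrite -in_col /col ex inE => /eqP.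
    by rewrite (h l) // (h l').
  split; first exact: matchingI.
    apply/setP => l; apply/domP/idP => [[r /sP[]//]|lI].
    have /eqP/cards1P[x ex] := hI _ lI; exists x; rewrite -in_row /row ex inE //.
  apply/setP => r; apply/codP/idP => [[l /sP[]//]|rJ'].
  have /eqP/cards1P[x ex] := hJ _ rJ'; exists x; rewrite -in_col /col ex inE //.
split; first by apply/withinP => l r lr; rewrite (mem_dom lr) (mem_cod lr).
split=> [l /domP[r lr]|r /codP[l lr]]; apply/eqP/cards1P.
  exists r; apply/setP => y; rewrite !inE; apply/idP/eqP => [h|->//].
  exact: matching_fun mN h lr.
exists l; apply/setP => y; rewrite !inE; apply/idP/eqP => [h|->//].
exact: matching_inj mN h lr.
Qed.

Lemma compatibleP U V : compatible U V <-> compat U V.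
Proof.
split=> [h N1 N2 s1 s2 m1 m2 e e'|h I J N1 N2 s1 s2 /is_pmP[m1 d1 c1] /is_pmP[m2 d2 c2]].
  by apply: (h (dom N2) (cod N2)) => //; apply/is_pmP.
by apply: h => //; rewrite ?d1 ?c1.
Qed.

(** The edges of a cycle, taken alternately, form two distinct matchings on the same vertices. *)
Lemma compat_acyclic G : compat G G -> acyclic G.
Proof.
move=> c [k [a [b [ia [ib h]]]]].
have io : injective (@ordS k.+2) := can_inj (@ordSK k.+2).
pose N1 := [set (a t, b t) | t : 'I_k.+2].
pose N2 := [set (a (ordS t), b t) | t : 'I_k.+2].
have m1 : matching N1.
  apply: matchingI => [? ? ?|? ? ?] /imsetP[t _ [-> ->]] /imsetP[t' _ []].
    by move=> /ia-> ->.
  by move=> -> /ib->.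
have m2 : matching N2.
  apply: matchingI => [? ? ?|? ? ?] /imsetP[t _ [-> ->]] /imsetP[t' _ []].
    by move=> /ia/io-> ->.
  by move=> -> /ib->.
have e : N1 = N2.
  apply: c => //.
  - by apply/subsetP => p /imsetP[t _ ->]; case: (h t).
  - by apply/subsetP => p /imsetP[t _ ->]; case: (h t).
  - apply/setP => l; apply/domP/domP => -[r /imsetP[t _ [-> _]]].
      by exists (b (ord_pred t)); apply/imsetP; exists (ord_pred t) => //; rewrite ord_predK.
    by exists (b (ordS t)); apply/imsetP; exists (ordS t).
  - apply/setP => r; apply/codP/codP => -[l /imsetP[t _ [_ ->]]].
      by exists (a (ordS t)); apply/imsetP; exists t.
    by exists (a t); apply/imsetP; exists t.
have : (a ord0, b ord0) \in N2 by rewrite -e; apply/imsetP; exists ord0.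
by case/imsetP => t _ [/ia e1 /ib e2]; move: e1; rewrite -e2 => /(congr1 val).
Qed.

(** Going along [N] and back along [N'] permutes the left vertices. An edge of [N] outside [N']
    starts at a vertex that is not fixed, and its orbit is a cycle. *)
Lemma acyclic_matching_sub G N N' : acyclic G -> N \subset G -> N' \subset G ->
  matching N -> matching N' -> dom N = dom N' -> cod N = cod N' -> N \subset N'.
Proof.
move=> ac sN sN' mN mN' ed ec; apply/subsetP => -[l0 r0] l0r0; apply: contraT => nl.
case: ac; pose f l := odflt r0 [pick r | (l, r) \in N].
have fN l : l \in dom N -> (l, f l) \in N.
  by case/domP => r lr; rewrite /f; case: pickP => [//|/(_ r)]; rewrite lr.
pose g r := odflt l0 [pick l | (l, r) \in N'].
have gN r : r \in cod N' -> (g r, r) \in N'.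
  by case/codP => l lr; rewrite /g; case: pickP => [//|/(_ l)]; rewrite lr.
(* The identity off [dom N] makes [s] injective on the whole type, so that [order] and [orbit]
   apply. *)
pose s l := if l \in dom N then g (f l) else l.
have sNN l : l \in dom N -> (s l, f l) \in N'.
  by move=> lN; rewrite /s lN; apply: gN; rewrite -ec; apply: mem_cod (fN _ lN).
have sdom l : l \in dom N -> s l \in dom N.
  by move=> lN; rewrite ed; apply: mem_dom (sNN _ lN).
have si : injective s.
  move=> x y; have [xN|xN] := boolP (x \in dom N); have [yN|yN] := boolP (y \in dom N).
  - move=> e; have hx := sNN _ xN; have hy := sNN _ yN; rewrite e in hx.
    have ef := matching_fun mN' hx hy; have h := fN _ xN; rewrite ef in h.
    exact: matching_inj mN h (fN _ yN).
  - by move=> e; have := sdom _ xN; rewrite e /s (negPf yN) (negPf yN).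
  - by move=> e; have := sdom _ yN; rewrite -e /s (negPf xN) (negPf xN).
  - by rewrite /s (negPf xN) (negPf yN).
have l0N := mem_dom l0r0.
have f0 : f l0 = r0 := matching_fun mN (fN _ l0N) l0r0.
have s0 : s l0 != l0.
  by apply: contra nl => /eqP e; have := sNN _ l0N; rewrite e f0.
have ord2 : 1 < order s l0.
  have := orderSpred s l0; case e: (order s l0) => [|[|k]] // _.
  by have := iter_order si l0; rewrite e /= => /eqP; rewrite (negPf s0).
(* [has_cycle] counts the vertices on each side as its parameter plus two. *)
exists (order s l0).-2.
have eo : (order s l0).-2.+2 = order s l0 by case: (order s l0) ord2 => [|[|]].
have iN t : iter t s l0 \in dom N by elim: t => //= t; apply: sdom.
exists (fun t : 'I_(order s l0).-2.+2 => iter t s l0).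
exists (fun t : 'I_(order s l0).-2.+2 => f (iter t s l0)).
have inj_a : injective (fun t : 'I_(order s l0).-2.+2 => iter t s l0).
  move=> t t' e; apply/val_inj/eqP.
  have := orbit_uniq s l0; rewrite /orbit => u.
  have lt : t < order s l0 by rewrite -[ltnRHS]eo.
  have lt' : t' < order s l0 by rewrite -[ltnRHS]eo.
  rewrite -(nth_uniq l0 _ _ u) ?size_traject //.
  by rewrite !nth_traject //; apply/eqP.
split=> //; split.
  move=> t t' /= e; apply: inj_a; have h := fN _ (iN t); rewrite e in h.
  exact: matching_inj mN h (fN _ (iN t')).
move=> t; split; first by apply: (subsetP sN); apply: fN.
have -> : iter (ordS t) s l0 = s (iter t s l0).
  rewrite /=; have := ltn_ord t; rewrite leq_eqVlt => /orP[/eqP e|lt].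
    by rewrite e modnn /= -iterS e eo iter_order.
  by rewrite modn_small // iterS.
by apply: (subsetP sN'); apply: sNN.
Qed.

Lemma acyclic_unique G N N' : acyclic G -> N \subset G -> N' \subset G ->
  matching N -> matching N' -> dom N = dom N' -> cod N = cod N' -> N = N'.
Proof.
move=> ac s s' m m' e e'; apply/eqP; rewrite eqEsubset.
by rewrite (acyclic_matching_sub ac s s') //= (acyclic_matching_sub ac s' s).
Qed.

Lemma ensembleP (M : ensemble_t n d) : is_ensemble M -> ensemble (fun I J => M (I, J)).
Proof.
case=> _ [e1 [e2 [e3 e4]]]; split.
- by move=> I J /e1/is_pmP.
- move=> I J N e s; have [mM dM cM] := (is_pmP _ _ _).1 (e1 _ _ e).
  have mN := matching_sub s mM; have eN := matching_sizes mN.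
  have sM : M (dom N, cod N) \subset M (I, J).
    apply: e2 => //; first by rewrite -dM; apply: dom_sub.
      by rewrite -cM; apply: cod_sub.
    by exists N; split=> //; apply/is_pmP.
  have [mM' dM' cM'] := (is_pmP _ _ _).1 (e1 _ _ eN).
  apply/eqP; rewrite eqEsubset (matching_sub2 mM s sM) ?dM' //.
  by rewrite (matching_sub2 mM sM s) // dM'.
- move=> I J N N' e c c'; have [[_ [ac _]] _] := e3 _ _ e.
  apply: (acyclic_unique ac); apply/subsetP => -[l r].
    by case/c => I' [s e' h]; apply/bigcupP; exists I'; rewrite // s e' eqxx.
  by case/c' => I' [s e' h]; apply/bigcupP; exists I'; rewrite // s e' eqxx.
- move=> I J N N' e c c'; have [[_ [ac _]] _] := e4 _ _ e.
  apply: (acyclic_unique ac); apply/subsetP => -[l r].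
    by case/c => I' [s e' h]; apply/bigcupP; exists I'; rewrite // s e' eqxx.
  by case/c' => I' [s e' h]; apply/bigcupP; exists I'; rewrite // s e' eqxx.
Qed.

Lemma in_tgraph (T : tuple_t n d) l r : ((l, r) \in tgraph T) = (r \in T l).
Proof. by rewrite inE. Qed.

Lemma row_tgraph (T : tuple_t n d) l : row (tgraph T) l = T l.
Proof. by apply/setP => r; rewrite in_row in_tgraph. Qed.

Definition gtuple G : tuple_t n d := [ffun l => row G l].

Lemma gtupleK G : tgraph (gtuple G) = G.
Proof. by apply/setP => -[l r]; rewrite in_tgraph ffunE in_row. Qed.

Lemma tgraph_inj : injective (@tgraph n d).
Proof. by move=> T T' e; apply/ffunP => l; rewrite -!row_tgraph e. Qed.

(** * From ensembles to oriented matroids *)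

Section FromEnsemble.
Variable M : ensemble_t n d.
Hypotheses (eM : is_ensemble M).
Let Mf : matching_family _ _ := fun I J => M (I, J).
Let eMf : ensemble Mf := ensembleP eM.

Definition tom_of : {set tuple_t n d} :=
  [set T : tuple_t n d | [forall l, T l != set0] && good Mf (tgraph T)].

Lemma tom_ofP T : reflect (is_type T /\ good Mf (tgraph T)) (T \in tom_of).
Proof. by rewrite inE; apply: (iffP andP) => -[/forallP]. Qed.

Lemma tom_of_TOM : is_TOM tom_of.
Proof.
split; first by move=> T /tom_ofP[t g]; split=> //; apply: compat_acyclic (good_compat g g).
split.
  move=> j; apply/tom_ofP; split; first by move=> l; rewrite ffunE; apply/set0Pn; exists j; rewrite inE.
  (* A matching in a constant type has at most one edge. *)
  apply/goodP => N s mN; have [e|[[l r] lr]] := set_0Vmem N.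
    by apply: (ens_closed eMf (I := dom N) (J := cod N)); rewrite ?matching_sizes // e sub0set.
  have /goodP g := good1 eMf l r; apply: g => //; apply/subsetP => -[x y] xy.
  have h u v : (u, v) \in N -> v = j by move/(subsetP s); rewrite in_tgraph ffunE inE => /eqP.
  move: (h _ _ xy) (h _ _ lr) => ey er; rewrite {}ey {}er in xy lr *.
  by rewrite (matching_inj mN xy lr) inE.
split; first by move=> T T' /tom_ofP[_ g] t' s; apply/tom_ofP; split=> //; apply: good_sub g.
split.
  by move=> U V /tom_ofP[_ gU] /tom_ofP[_ gV]; apply/compatibleP; apply: good_compat gU gV.
move=> U V i /tom_ofP[tU gU] /tom_ofP[tV gV].
case: (@good_elim _ _ Mf eMf (tgraph U) (tgraph V) i) => // [l|l|W [gW eW hW]];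
  rewrite ?row_tgraph //.
exists (gtuple W); split; last split.
- apply/tom_ofP; rewrite gtupleK; split=> // l; rewrite ffunE.
  have [->|li] := eqVneq l i; last by case: (hW _ li) => ->; rewrite row_tgraph.
  rewrite eW !row_tgraph; apply/set0Pn; have /set0Pn[x xU] := tU i.
  by exists x; rewrite inE xU.
- by rewrite ffunE eW !row_tgraph.
- by move=> l /hW; rewrite ffunE !row_tgraph.
Qed.

Lemma extract_tom_of (r0 : 'I_d) : extract tom_of = M.
Proof.
apply/ffunP => -[I J]; rewrite ffunE /=; have [e|ne] := eqVneq; last first.
  by case: eM => e0 _; rewrite e0.
have [mM dM cM] := ens_matching eMf e.
case: pickP => [G /andP[/imsetP[T]]|].
  rewrite inE => /andP[/tom_ofP[tT gT] _] eG /andP[/forall_inP tI /forall_inP tJ] /=.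
  have [mG dG cG] : [/\ matching G, dom G = I & cod G = J].
    apply/is_pmP; split; first by rewrite eG; apply: subsetIr.
    by split=> x xI; apply/eqP; [apply: tI | apply: tJ].
  have /goodP g := gT; rewrite [LHS]g ?dG ?cG //.
  by rewrite eG; apply: subsetIl.
(* Completing [M (I, J)] to a type leaves its rows in [I] alone, so the minor returns it. *)
have gM := good_M eMf e; have [X [sX gX tX rX]] := good_complete eMf r0 gM.
move/(_ (Mf I J)); case/negP.
have eX : tgraph (gtuple X) :&: setX I J = Mf I J.
  rewrite gtupleK; apply/setP => -[l r]; rewrite inE in_setX; apply/andP/idP.
    by case=> lr /andP[lI _]; move: lr; rewrite -in_row rX ?dM // in_row.
  move=> lr; split; first exact: (subsetP sX).
  have := mem_dom lr; have := mem_cod lr; by rewrite dM cM => -> ->.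
have [_ [hI hJ]] : is_pm (Mf I J) I J by apply/is_pmP.
apply/andP; split; last first.
  apply/andP; split; first by apply/forall_inP => l /hI ->.
  by apply/forall_inP => r /hJ ->.
apply/imsetP; exists (gtuple X) => //; rewrite inE; apply/andP; split.
  by apply/tom_ofP; rewrite gtupleK; split=> // l; rewrite ffunE.
by rewrite eX; apply/forall_inP => l /hI ->.
Qed.

End FromEnsemble.

End Translation.

(** * From oriented matroids to ensembles *)

Section FromTom.
Variables n d : nat.
Implicit Types (G N P U V : {set 'I_n * 'I_d}) (I : {set 'I_n}) (J : {set 'I_d})
  (T : tuple_t n d) (TT : {set tuple_t n d}).

Lemma tom_graphs TT : is_TOM TT -> tom setT setT (@tgraph n d @: TT).
Proof.
case=> hT [hstar [hsub [hcompat helim]]]; split.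
- move=> G /imsetP[T /hT[tT _] ->]; split=> [|l _]; last by rewrite row_tgraph.
  by apply/withinP => l r _; rewrite !inE.
- move=> j _; apply/imsetP; exists [ffun=> [set j]] => //.
  by apply/setP => -[l r]; rewrite in_tgraph ffunE in_setX !inE.
- move=> G H /imsetP[T TTT ->] sH hH; apply/imsetP; exists (gtuple H); rewrite ?gtupleK //.
  by apply: hsub TTT _ _; rewrite ?gtupleK // => l; rewrite ffunE hH ?inE.
- move=> U V /imsetP[T hU ->] /imsetP[T' hV ->]; apply/compatibleP; exact: hcompat.
move=> U V i /imsetP[T hU ->] /imsetP[T' hV ->] _.
have [W [hW [eW hi]]] := helim _ _ i hU hV.
exists (tgraph W); split; [exact: imset_f | by rewrite !row_tgraph |].
by move=> l _ li; rewrite !row_tgraph; apply: hi.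
Qed.

Lemma minorE TT I J : minor TT I J = tminor (@tgraph n d @: TT) I J.
Proof.
apply/setP => H; apply/imsetP/tminorP => [[T]|[G /imsetP[T hT ->] [-> h]]].
  rewrite inE => /andP[hT /forall_inP h] ->; exists (tgraph T); first exact: imset_f.
  by split=> // l /h; rewrite /ldeg -/(row _ _) card_gt0.
by exists T; rewrite // inE hT; apply/forall_inP => l /h; rewrite -card_gt0.
Qed.

Lemma pm_tests N I J : N \subset setX I J ->
  reflect (is_pm N I J) (is_tope_on I N && has_pos_ones J N).
Proof.
move=> s; apply: (iffP andP) => [[/forall_inP hI /forall_inP hJ]|[_ [hI hJ]]].
  by split=> //; split=> x xI; apply/eqP; [apply: hI | apply: hJ].
by split; apply/forall_inP => x xI; apply/eqP; [apply: hI | apply: hJ].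
Qed.

Lemma conn_connect_adj G I J x y : G \subset setX I J -> conn G I J ->
  x \in vset I J -> y \in vset I J -> connect (adj G) x y.
Proof.
move=> /withinP sG cG xIJ yIJ.
pose A := [set l in I | connect (adj G) x (inl l)].
pose B := [set r in J | connect (adj G) x (inr r)].
have [eA eB] : A = I /\ B = J.
  apply: cG.
  - by apply/subsetP => l; rewrite inE => /andP[].
  - by apply/subsetP => l; rewrite inE => /andP[].
  - move=> l r lr; have [lI rJ] := sG _ _ lr; rewrite !inE lI rJ /=.
    by apply/idP/idP => h; apply: connect_trans h _; apply: connect1.
  move: xIJ; rewrite inE; case ex: {1}x => [l|r] h; apply/orP; [left|right].
    by apply/set0Pn; exists l; rewrite inE h -ex connect0.
  by apply/set0Pn; exists r; rewrite inE h -ex connect0.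
move: yIJ; rewrite inE; case: y => [l|r]; first by rewrite -eA inE => /andP[].
by rewrite -eB inE => /andP[].
Qed.

Section ExtractMap.
Variables (TT : {set tuple_t n d}) (hTT : is_TOM TT) (r0 : 'I_d).
Let tTT := tom_graphs hTT.

Lemma minor_tom I J : tom I J (minor TT I J).
Proof. by rewrite minorE; apply: tminor_tom tTT _ _; apply: subsetT. Qed.

Lemma minor_tope I J (v : 'I_d -> nat) : J != set0 ->
  \sum_x v x = #|I| -> (forall x, 0 < v x -> x \in J) ->
  textends I J (minor TT I J) /\
  exists t, gr t I \in minor TT I J /\ forall x, cnt t I x = v x.
Proof.
move=> J0 vI vJ; have [_ ext] := tom_maximal (minor_tom I J) J0; split=> //.
exact: tope_of_position (minor_tom I J) ext J0 vI vJ.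
Qed.

Lemma minor_sub I J G : G \in minor TT I J -> exists2 T, T \in TT & G \subset tgraph T.
Proof. by case/imsetP => T; rewrite inE => /andP[hT _] ->; exists T; rewrite // subsetIl. Qed.

Lemma sum_mem J : \sum_x (x \in J) = #|J|.
Proof. by rewrite -sum1_card [RHS]big_mkcond; apply: eq_bigr => x _; case: (x \in J). Qed.

Lemma minor_perfect I J : #|I| = #|J| -> exists2 N, N \in minor TT I J & is_pm N I J.
Proof.
(* The existence of topes by position is available for nonempty [J]; the empty matching comes from a
   constant type. *)
move=> e; have [J0|J0] := eqVneq J set0.
  have I0 : I = set0 by apply/eqP; rewrite -cards_eq0 e J0 cards0.
  have [_ [star _]] := hTT; exists set0; rewrite J0 I0.
    apply/imsetP; exists [ffun=> [set r0]]; last by apply/setP => -[x y]; rewrite in_setI in_setX !in_set0 !andbF.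
    by rewrite inE star; apply/forall_inP => l; rewrite inE.
  by split; rewrite ?sub0set //; split=> x; rewrite inE.
have [||_ [t [tM et]]] := @minor_tope I J (fun x => x \in J) J0.
- by rewrite sum_mem.
- by move=> x; case: (x \in J).
by exists (gr t I) => //; apply/is_pmP; apply: gr_perfect.
Qed.

Lemma extract_minor I J : #|I| = #|J| ->
  extract TT (I, J) \in minor TT I J /\ is_pm (extract TT (I, J)) I J.
Proof.
move=> e; rewrite ffunE /= e eqxx.
have sM N : N \in minor TT I J -> N \subset setX I J by case/(tom_type (minor_tom I J)).
case: pickP => [N /andP[NM h]|] /=; first by split=> //; apply/pm_tests; rewrite ?sM.
have [N NM /(pm_tests (sM _ NM)) h] := minor_perfect e.
by move/(_ N); rewrite NM h.
Qed.

(** The extracted matching lies in a type of [TT] too, and types are compatible; so extraction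
    records every matching of every type. *)
Lemma extract_unique T N : T \in TT -> N \subset tgraph T -> matching N ->
  extract TT (dom N, cod N) = N.
Proof.
move=> hT sN mN; have [/minor_sub[T' hT' s'] /is_pmP[m' d' c']] := extract_minor (matching_sizes mN).
have [_ [_ [_ [comp _]]]] := hTT; have /compatibleP c := comp _ _ hT' hT.
exact: c.
Qed.

Lemma minor_unique I J N : N \in minor TT I J -> forall N', N' \subset N -> matching N' ->
  extract TT (dom N', cod N') = N'.
Proof. by move=> /minor_sub[T hT s] N' s'; apply: extract_unique hT _; apply: subset_trans s. Qed.

(** In the tope at [J :\ r], moving one unit from [b] to [r] gives the position [J :\ b]; one grown
    graph contains all these matchings. *)
Lemma extract_right I J : #|I| + 1 = #|J| -> exists F, [/\ F \in minor TT I J,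
  forall l, #|row F l| <= 2 & forall b, b \in J -> extract TT (I, J :\ b) \subset F].
Proof.
move=> e; have J0 : J != set0 by rewrite -card_gt0 -e addn1.
have /set0Pn[r rJ] := J0.
have [||ext [t [tM et]]] := @minor_tope I J (fun x => x \in J :\ r) J0.
- by rewrite sum_mem; apply/eqP; rewrite -(eqn_add2r 1) e (cardsD1 r J) rJ addnC.
- by move=> x; rewrite in_setD1; case: (x \in J); rewrite ?andbF.
have [F [FM F2 S]] := grow_backward (minor_tom I J) ext tM rJ.
exists F; split=> // b bJ; have [|s [sF _ es]] := S b.
  by rewrite et in_setD1 bJ; case: (b == r).
have [] := @gr_perfect _ _ s I (J :\ b).
  move=> x; apply/(@addIn (x == b)); rewrite es et !in_setD1.
  have [->|_] := eqVneq x r; first by rewrite rJ /=; case: (r == b).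
  by have [->|_] := eqVneq x b; rewrite ?bJ ?addn0.
by move=> m dm cm; rewrite -{1}dm -cm (minor_unique FM).
Qed.

(** Start from a tope whose position is one on [J] with [j0] counted twice. Growing forward moves
    the surplus unit to any [t i] while keeping [i] there; deleting row [i] leaves the matching of
    [I :\ i]. *)
Lemma extract_left I J : #|I| = #|J| + 1 -> exists F : {set 'I_n * 'I_d}, [/\ F \subset setX I J, compat F F,
  forall r, #|col F r| <= 2 & forall i, i \in I -> extract TT (I :\ i, J) \subset F].
Proof.
move=> e; have [J0|J0] := eqVneq J set0.
  exists set0; split; first exact: sub0set.
  - by move=> N N'; rewrite !subset0 => /eqP-> /eqP->.
  - by move=> r; rewrite (_ : col _ _ = set0) ?cards0 //; apply/setP => l; rewrite !inE.
  move=> i iI; have [|_ [s _]] := @extract_minor (I :\ i) J.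
    by apply/eqP; rewrite -(eqn_add2r 1) -e [eqbRHS](cardsD1 i) iI addnC.
  by apply: subset_trans s _; apply/subsetP => -[x y]; rewrite J0 !inE andbF.
have /set0Pn[j0 j0J] := J0.
have [||ext [t [tM et]]] := @minor_tope I J (fun x => (x \in J) + (x == j0)) J0.
- rewrite big_split /= sum_mem e; congr (_ + _); rewrite (bigD1 j0) //= eqxx big1 // => x.
  by move/negPf->.
- by move=> x; have [->//|_] := eqVneq x j0; rewrite addn0; case: (x \in J).
have [|F [FM F2 S]] := grow_forward (minor_tom I J) ext tM (j0 := j0).
  by rewrite et eqxx addn1.
exists F; split.
- by have [] := tom_type (minor_tom I J) FM.
- exact: (tom_compat (minor_tom I J)).
- by move=> r; apply: leq_trans (F2 r) _; rewrite et; case: (_ \in J); case: (_ == j0).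
move=> i iI.
have tJ : t i \in J.
  have : 0 < cnt t I (t i) by rewrite card_gt0; apply/set0Pn; exists i; rewrite inE iI eqxx.
  by rewrite et; have [->//|_] := eqVneq (t i) j0; rewrite addn0; case: (_ \in J).
have [s [sF _ es si]] := S _ tJ.
have ci x : cnt s (I :\ i) x + (x == t i) = cnt s I x.
  rewrite [RHS](cardsD1 i) inE iI si //= addnC [t i == x]eq_sym; congr (_ + _).
  by apply: eq_card => l; rewrite !inE andbA.
have [] := @gr_perfect _ _ s (I :\ i) J.
  move=> x; apply/(@addIn (x == t i)); rewrite ci; apply/(@addIn (x == j0)).
  by rewrite es et addnAC.
move=> m dm cm; rewrite -{1}dm -cm (minor_unique FM) //.
  apply: subset_trans sF; apply/subsetP => -[x y]; rewrite !in_gr.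
  by rewrite in_setD1 => /andP[/andP[_ ->]].
apply: subset_trans sF; apply/subsetP => -[x y]; rewrite !in_gr.
by rewrite in_setD1 => /andP[/andP[_ ->]].
Qed.

Lemma extract_ensemble : is_ensemble (extract TT).
Proof.
split; first by move=> I J ne; rewrite ffunE /= (negPf ne).
split; first by move=> I J /extract_minor[].
split.
  move=> I I' J J' e _ _ [N [sN /is_pmP[mN <- <-]]].
  by have [h _] := extract_minor e; rewrite (minor_unique h).
split=> I J e U.
  have [F [sF cF F2 S]] := extract_left e.
  have I0 : I != set0 by rewrite -card_gt0 e addn1.
  have [|r||eF F2' cn] := @linkage _ _ (tr F) J I (fun i => tr (extract TT (I :\ i, J))) _ _ I0.
  - by rewrite -tr_setX tr_subset.
  - by rewrite row_tr.
  - move=> i iI; have [|_ /is_pmP[mM dM cM]] := @extract_minor (I :\ i) J.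
      by apply/eqP; rewrite -(eqn_add2r 1) -e [eqbRHS](cardsD1 i) iI addnC.
    by rewrite matching_trE dom_tr cod_tr tr_subset S.
  (* The subsets of [I] of size |J| are the sets [I :\ i], so this union is the one in [linkage]. *)
  have eU : U = F.
    apply/setP => -[l r]; rewrite -(in_tr F) eF; apply/bigcupP/bigcupP => -[X].
      case/andP => sX eX lr; have : 0 < #|I :\: X|.
        by rewrite cardsD (setIidPr sX) e (eqP eX) addnC addnK.
      rewrite card_gt0 => /set0Pn[i]; rewrite inE => /andP[iX iI]; exists i => //.
      rewrite in_tr (_ : I :\ i = X) //; apply/eqP; rewrite eq_sym eqEcard; apply/andP; split.
        by rewrite subsetD1 sX.
      by rewrite (eqP eX) -(leq_add2r 1) -e (cardsD1 i I) iI addnC.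
    rewrite in_tr => iI h; exists (I :\ X) => //; rewrite subsetDl /=.
    by rewrite -(eqn_add2r 1) -e [eqbRHS](cardsD1 X) iI addnC.
  rewrite eU; split; last by move=> j /F2'; rewrite row_tr.
  split=> //; split; first exact: compat_acyclic.
  by move=> x y; apply: conn_connect_adj => //; rewrite -[F]trK; apply: conn_tr.
have [F [FM F2 S]] := extract_right e.
have [sF _] := tom_type (minor_tom I J) FM.
have J0 : J != set0 by rewrite -card_gt0 -e addn1.
have [b bJ|eF F2' cn] := @linkage _ _ F I J (fun b => extract TT (I, J :\ b)) sF F2 J0.
  have [|_ /is_pmP[mM dM cM]] := @extract_minor I (J :\ b).
    by apply/eqP; rewrite -(eqn_add2r 1) e [eqbLHS](cardsD1 b) bJ addnC.
  by split=> //; apply: S.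
have eU : U = F.
  apply/setP => -[l r]; rewrite eF; apply/bigcupP/bigcupP => -[X].
    case/andP => sX eX lr; have : 0 < #|J :\: X|.
      by rewrite cardsD (setIidPr sX) -e (eqP eX) addnC addnK.
    rewrite card_gt0 => /set0Pn[i]; rewrite inE => /andP[iX iI]; exists i => //.
    rewrite (_ : J :\ i = X) //; apply/eqP; rewrite eq_sym eqEcard; apply/andP; split.
      by rewrite subsetD1 sX.
    by rewrite (eqP eX) -(leq_add2r 1) e (cardsD1 i J) iI addnC.
  move=> iI h; exists (J :\ X) => //; rewrite subsetDl /=.
  by rewrite -(eqn_add2r 1) e [eqbRHS](cardsD1 X) iI addnC.
rewrite eU; split=> //; split=> //; split.
  by apply: compat_acyclic; apply: (tom_compat (minor_tom I J)).
by move=> x y; apply: conn_connect_adj.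
Qed.

End ExtractMap.

(** Matchings of types on either side are read off the common extraction, so a type of [TT1] is
    compatible with all of [TT2]; maximality puts it there. *)
Lemma extract_sub TT1 TT2 (r0 : 'I_d) : is_TOM TT1 -> is_TOM TT2 ->
  extract TT1 = extract TT2 -> TT1 \subset TT2.
Proof.
move=> h1 h2 e; apply/subsetP => T hT; have t2 := tom_graphs h2.
have [|mx _] := tom_maximal t2; first by apply/set0Pn; exists r0; rewrite inE.
have [tT _] := h1.1 _ hT.
have /imsetP[T' hT' /tgraph_inj->//] : tgraph T \in @tgraph n d @: TT2.
apply: mx; [by apply/withinP => l r _; rewrite !inE | by move=> l _; rewrite row_tgraph|].
move=> V /imsetP[T' hT' ->] N N' s s' m m' ed ec.
by rewrite -(extract_unique h1 r0 hT s m) e ed ec (extract_unique h2 r0 hT' s' m').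
Qed.

End FromTom.

Theorem mainTheorem8 (n d : nat) (hn : 0 < n) (hd : 0 < d) :
  (forall TT : {set tuple_t n d}, is_TOM TT -> is_ensemble (extract TT)) /\
  (forall TT1 TT2 : {set tuple_t n d}, is_TOM TT1 -> is_TOM TT2 ->
     extract TT1 = extract TT2 -> TT1 = TT2) /\
  (forall M : ensemble_t n d, is_ensemble M ->
     exists TT : {set tuple_t n d}, is_TOM TT /\ extract TT = M).
Proof.
pose r0 := Ordinal hd; split; first by move=> TT hTT; apply: extract_ensemble r0.
split=> [TT1 TT2 h1 h2 e|M hM].
  by apply/eqP; rewrite eqEsubset (extract_sub r0 h1 h2 e) (extract_sub r0 h2 h1).
by exists (tom_of M); split; [apply: tom_of_TOM | apply: extract_tom_of r0].
Qed.
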